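(* Let $\mu$ be a directed distance on $S$. (1) If $\dim T_\mu\le1$, then for every network $(G,S,c)$ the $\mu$-weighted maximum multiflow problem has an integral optimal multiflow. (2) If $\dim\bar Q^{slim}_\mu\le1$, then for every network $(G,S,c)$ that is properly inner Eulerian relative to $\mu$, the $\mu$-weighted maximum multiflow problem has an integral optimal multiflow.
   Context: A network $(G,S,c)$: finite digraph $G=(VG,EG)$, terminals $S\subseteq VG$, capacity $c:EG\to\mathbb Z_+$. A multiflow is a set $\mathcal P$ of directed paths joining distinct terminals with $\lambda:\mathcal P\to\mathbb R_+$, $\sum_{P\ni e}\lambda(P)\le c(e)$ for all $e$; it is integral if $\lambda$ is integer-valued. A directed distance is $\mu:S\times S\to\mathbb R_+$ with zero diagonal. The $\mu$-weighted maximum multiflow problem asks to maximize $\sum_P\lambda(P)\mu(s_P,t_P)$ ($s_P,t_P$ start and end of $P$) over all multiflows. A node fulfills the Eulerian condition if its outgoing capacity equals its incoming capacity. Let $S^c,S^r$ be disjoint copies of $S$ ($s^c,s^r$; $X^c,X^r$ for $X\subseteq S$), $S^{cr}=S^c\cup S^r$; $p\le q$ coordinatewise. $P_\mu=\{p\in\mathbb R^{S^{cr}}:p(s^c)+p(t^r)\ge\mu(s,t)\ \forall s,t\}$ (a polyhedron); $T_\mu$ = set of minimal points of $P_\mu^+$ (the nonnegative points of $P_\mu$); $Q_\mu$ = set of minimal points of $P_\mu$. Both are unions of faces of $P_\mu$; $\dim T_\mu$ is the largest dimension of a face of $P_\mu$ contained in $T_\mu$. $L=\mathbb R(\mathbf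 1,-\mathbf 1)$ ($1$ on $S^c$, $-1$ on $S^r$). For $p\in Q_\mu$, $K(p)$ is the bipartite graph on $S^{cr}$ with edges $s^ct^r$ where $p(s^c)+p(t^r)=\mu(s,t)$; $N_p(U)$ = nodes outside $U$ adjacent to $U$. $\mathcal S_0$ = family of $X\subseteq S$ with $\mu(s,t)=0$ for $s,t\in X$. For $X\in\mathcal S_0$: $Q_{\mu,X}$ = points $p\in Q_\mu$ with ($s^cs^r\in EK(p)\iff s\in X$); $p$ is a fat relative to $X$ if $p\in Q_{\mu,X}$ and $N_p(S^c\setminus X^c)\subseteq S^r\setminus X^r$ or $N_p(S^r\setminus X^r)\subseteq S^c\setminus X^c$; $Q^{deg}_{\mu,X}$ = points of $Q_{\mu,X}$ with one of these an equality. Proper fat: fat in no degenerate set. $Q^{slim}_\mu$ = $Q_\mu$ minus proper fats; $p\sim q$ on it if $p-q\in L$ or both lie in some $Q^{deg}_{\mu,X}$ with $p-q\in L+\mathbb R(\mathbf 1_{X^c},-\mathbf 1_{X^r})$; $\bar Q^{slim}_\mu=Q^{slim}_\mu/\sim$ (slimmed tropical polytope). $\dim\bar Q^{slim}_\mu$ is the largest dimension of the faces of $Q^{slim}_\mu$ (faces of $P_\mu$ within $Q_\mu$, restricted to $Q^{slim}_\mu$) taken modulo $\sim$. A terminal $s$ is proper if $\{p\in Q_\mu:p(s^c)+p(s^r)=0\}$ contains no fat (relative to any $X\in\mathcal S_0$); the network is properly inner Eulerian relative to $\mu$ if every node other than proper terminals fulfills the Eulerian condition.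
   Formalization: The dimension of T_μ is taken over faces of P_μ^+ (the nonnegative part of P_μ) contained in T_μ, since no nonempty face of P_μ itself lies in T_μ when S is nonempty. *)

(* Defs.v *)
From HB Require Import structures.
From mathcomp Require Import all_boot all_order all_algebra.
From mathcomp Require Import classical_sets reals.

Set Implicit Arguments.
Unset Strict Implicit.
Unset Printing Implicit Defensive.

Import Order.TTheory GRing.Theory Num.Theory.
Local Open Scope ring_scope.

(** * Networks and multiflows *)

(* The inclusion of S into the node set is the injection [term]. Parallel arcs
   and loops are allowed; simple digraphs are the case where
   a |-> (src a, tgt a) is injective. *)
Record network (S : finType) := Network {
  node : finType;
  arc : finType;
  src : arc -> node;
  tgt : arc -> node;
  term : S -> node;
  term_inj : injective term;
  cap : arc -> nat }.

Section Multiflows.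
Variables (R : realType) (S : finType).

Fixpoint walk (N : network S) (u : node N) (p : seq (arc N)) (v : node N) :
    bool :=
  if p is a :: p' then (src a == u) && walk (tgt a) p' v else u == v.

(* (s, t, p): start terminal, end terminal, sequence of arcs. *)
Definition tpath (N : network S) : Type := (S * S * seq (arc N))%type.

(* Nodes do not repeat along a path; inner nodes may be terminals. *)
Definition is_tpath (N : network S) (P : tpath N) : bool :=
  let: (s, t, p) := P in
  [&& s != t, walk (term N s) p (term N t) & uniq (term N s :: map (@tgt S N) p)].

Record multiflow (N : network S) := Multiflow {
  paths : seq (tpath N);
  weight : tpath N -> R;
  paths_uniq : uniq paths;
  pathsP : forall P, P \in paths -> is_tpath P;
  weight_ge0 : forall P, P \in paths -> 0 <= weight P;
  weight_cap : forall a : arc N,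
    \sum_(P <- paths | a \in P.2) weight P <= (cap a)%:R }.

Definition integral (N : network S) (f : multiflow N) : Prop :=
  forall P, P \in paths f -> weight f P \is a Num.int.

Definition value (mu : S -> S -> R) (N : network S) (f : multiflow N) : R :=
  \sum_(P <- paths f) weight f P * mu P.1.1 P.1.2.

Definition optimal (mu : S -> S -> R) (N : network S) (f : multiflow N) : Prop :=
  forall g : multiflow N, value mu g <= value mu f.

Definition eulerian_at (N : network S) (v : node N) : Prop :=
  (\sum_(a | src a == v) cap a = \sum_(a | tgt a == v) cap a)%N.

End Multiflows.

(** * Faces and dimensions *)

Section Polyhedra.
Variables (R : realType) (I : finType).
Local Notation V := {ffun I -> R^o}.

Definition dot (w p : V) : R := \sum_i w i * p i.

Definition face (P F : set V) : Prop :=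
  exists (w : V) (b : R), (forall p, P p -> b <= dot w p) /\
    F = [set p | P p /\ dot w p = b]%classic.

Definition minimal_points (A : set V) : set V :=
  [set p | A p /\ forall q, A q -> (forall i, q i <= p i) -> q = p]%classic.

Definition affinely_independent (n : nat) (p : 'I_n -> V) : Prop :=
  forall a : 'I_n -> R,
    \sum_i a i = 0 -> \sum_i a i *: p i = 0 -> forall i, a i = 0.

Definition convex_hull (n : nat) (p : 'I_n -> V) : set V :=
  [set q | exists a : 'I_n -> R,
    [/\ forall i, 0 <= a i, \sum_i a i = 1 & q = \sum_i a i *: p i]]%classic.

Definition dim_le (A : set V) (k : nat) : Prop :=
  forall (n : nat) (p : 'I_n.+1 -> V),
    (forall i, A (p i)) -> affinely_independent p -> (n <= k)%N.

(* Meant for [A] a finite union of polyhedra and [eqv] an equivalence whose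
   classes in each cell are pieces of affine subspaces, so A/eqv is piecewise
   linear; its dimension is the largest n such that A contains an n-simplex
   that embeds into the quotient. *)
Definition quotient_dim_le (A : set V) (eqv : V -> V -> Prop) (k : nat) : Prop :=
  forall (n : nat) (p : 'I_n.+1 -> V),
    affinely_independent p -> (convex_hull p `<=` A)%classic ->
    (forall x y, convex_hull p x -> convex_hull p y -> eqv x y -> x = y) ->
    (n <= k)%N.

End Polyhedra.

(** * Directed tight span and slimmed tropical polytope *)

Section Distances.
Variables (R : realType) (S : finType).

Definition directed_distance (mu : S -> S -> R) : Prop :=
  (forall s t, 0 <= mu s t) /\ (forall s, mu s s = 0).

(* [inl s] is s^c and [inr s] is s^r. *)
Definition point := {ffun S + S -> R^o}.

Variable mu : S -> S -> R.

Definition P_mu : set point :=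
  [set p | forall s t, mu s t <= p (inl s) + p (inr t)]%classic.

Definition P_mu_plus : set point :=
  [set p | P_mu p /\ forall x, 0 <= p x]%classic.

Definition T_mu : set point := minimal_points P_mu_plus.

Definition Q_mu : set point := minimal_points P_mu.

(* The faces are those of the polyhedron P_mu_plus: P_mu is invariant under
   translation by (1, -1), so that (for S nonempty) no nonempty face of P_mu
   itself lies in the nonnegative orthant. *)
Definition dim_T_mu_le (k : nat) : Prop :=
  forall F, face P_mu_plus F -> (F `<=` T_mu)%classic -> dim_le F k.

Definition K (p : point) : rel (S + S) := fun x y =>
  match x, y with
  | inl s, inr t | inr t, inl s => p (inl s) + p (inr t) == mu s t
  | _, _ => false
  end.

Definition nbrs (p : point) (U : {set S + S}) : {set S + S} :=
  [set y | (y \notin U) && [exists x in U, K p x y]].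

Definition copyc (X : {set S}) : {set S + S} := [set inl s | s in X].
Definition copyr (X : {set S}) : {set S + S} := [set inr s | s in X].

Definition zero_on (X : {set S}) : Prop :=
  forall s t, s \in X -> t \in X -> mu s t = 0.

Definition Q_at (X : {set S}) : set point :=
  [set p | Q_mu p /\ forall s, K p (inl s) (inr s) = (s \in X)]%classic.

Definition fat (X : {set S}) (p : point) : Prop :=
  Q_at X p /\ ((nbrs p (copyc (~: X)) \subset copyr (~: X)) \/
               (nbrs p (copyr (~: X)) \subset copyc (~: X))).

Definition Q_deg (X : {set S}) : set point :=
  [set p | Q_at X p /\ (nbrs p (copyc (~: X)) = copyr (~: X) \/
                        nbrs p (copyr (~: X)) = copyc (~: X))]%classic.

Definition proper_fat (p : point) : Prop :=
  (exists2 X, zero_on X & fat X p) /\ (forall X, zero_on X -> ~ Q_deg X p).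

Definition Q_slim : set point :=
  [set p | Q_mu p /\ ~ proper_fat p]%classic.

(* The vector (1_{X^c}, -1_{X^r}). *)
Definition shift (X : {set S}) : point :=
  [ffun x => match x with
             | inl s => (s \in X)%:R
             | inr s => - (s \in X)%:R
             end].

Definition slim_equiv (p q : point) : Prop :=
  (exists a : R, p - q = a *: shift [set: S]) \/
  (exists X : {set S}, [/\ zero_on X, Q_deg X p, Q_deg X q &
     exists a b : R, p - q = a *: shift [set: S] + b *: shift X]).

Definition dim_Q_slim_quotient_le (k : nat) : Prop :=
  forall F, face P_mu F -> (F `<=` Q_mu)%classic ->
    quotient_dim_le (F `&` Q_slim)%classic slim_equiv k.

Definition proper_terminal (s : S) : Prop :=
  forall X p, zero_on X -> Q_mu p -> p (inl s) + p (inr s) = 0 -> ~ fat X p.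

Definition properly_inner_eulerian (N : network S) : Prop :=
  forall v : node N,
    (forall s, proper_terminal s -> v <> term N s) -> eulerian_at v.

End Distances.

(* Main.v *)
(* Suppose that [mu] is a nonnegative combination of cut distances
   [(s \in A) && (t \in B)] over pairwise compatible pairs of disjoint sets
   [(A, B)]. Every multiflow then has value at most the same combination of the
   minimum cuts from [A] to [B], and an integral multiflow attaining all these
   minima at once is found by splitting off: two consecutive arcs [x -> t -> z]
   are replaced by [x -> z] as long as no minimum cut decreases. When nothing can
   be split any more, submodularity uncrosses the sets that block the splittings
   and shows that the arcs leaving a minimum cut for [(A, B)] run from [A] to [B].
   Pairs of opposite direction need the Eulerian condition at the nodes they
   leave free, hence the role of proper terminals.

   If the tight span has dimension at most 1, a 2x2 submatrix of [mu] that
   violates the corresponding minor law yields a two-dimensional face; so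
   [mu s t = max 0 (f s - h t)], and the thresholds of [f] and [h] give a chain
   of cuts. For the slimmed tropical polytope the same role is played by 3x3
   submatrices: a dual solution of a tropically nonsingular one is perturbed so
   that its entries are independent over the integral combinations of the
   values of [mu]; extended to a point of Q_mu and slid into Q_slim, it has three
   classes of tight terminals which move independently modulo L. Without such
   submatrices [mu] is tree-like: a terminal [r] of a pair at maximal round trip
   sits at the end of a pendant edge, and cutting the edge off, in both
   directions, leaves a directed distance of the same kind. *)

Require Import Defs.
From mathcomp Require Import classical_sets.
From mathcomp Require Import all_boot all_order all_algebra.
From mathcomp Require Import reals zify ring lra.
From mathcomp Require boolp cardinality constructive_ereal lebesgue_measure.

Set Implicit Arguments.
Unset Strict Implicit.
Unset Printing Implicit Defensive.

(** * Locking by splitting off *)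

(** The quotient by [~] decides what a minor must provide. Points of one degenerate set that differ
    by a shift of [X] are identified, so a class of tight terminals counts as a dimension only if it
    contains a terminal of positive round trip [p(s^c) + p(s^r)]; [minor] certifies this by
    inequalities on coordinates that sliding leaves fixed. Genericity replaces any study of the
    components of [K(p)]: every coordinate is some [x i], up to sign and an integer combination of
    values of [mu], and touching coordinates must have the same index. Each slide stops when a new
    pair touches, so this form persists. On the flow side, uncrossing opposed cuts needs balanced
    nodes, while a proper terminal may be unbalanced. A private source and sink restore the balance
    but are themselves never free, so opposed cuts must together account for every proper terminal.
    This is where [one_way] enters: a proper terminal missed by two opposed cuts would strictly
    shorten some trip in both directions. *)

Section Locking.
Variables (M : finType) (T : eqType) (K : Type).
Local Notation marc := (M * M * seq T)%type.
Implicit Types (G H : seq marc) (X Y Z W : {set M}) (x t z v : M).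

Definition arcs_between G X Y : nat :=
  count (fun a : marc => (a.1.1 \in X) && (a.1.2 \in Y)) G.

Definition outdeg G X : nat := arcs_between G X (~: X).

Definition balanced G v : Prop :=
  count (fun a : marc => a.1.1 == v) G = count (fun a : marc => a.1.2 == v) G.

(** The labels record which path of original arcs a merged arc stands for, so that paths can be read
    off at the end. *)
Inductive splits_to : seq marc -> seq marc -> Prop :=
| splits_refl G : splits_to G G
| splits_step G G0 G' x t z p q :
    perm_eq G ((x, t, p) :: (t, z, q) :: G0) ->
    splits_to ((x, z, p ++ q) :: G0) G' -> splits_to G G'.

Variables (E : K -> Prop) (P N : K -> {set M}).

Definition is_cut (e : K) X : bool := (P e \subset X) && (X \subset ~: N e).

Definition tight G (e : K) X : Prop :=
  is_cut e X /\ forall Y, is_cut e Y -> outdeg G X <= outdeg G Y.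

Definition nested (e f : K) : bool := (P e \subset P f) && (N f \subset N e).
(** Nestedness of [e] with the reversal of [f], in one order here and in the other order for
    [away]. *)
Definition facing (e f : K) : bool := (P e \subset N f) && (P f \subset N e).
Definition away (e f : K) : bool := (N e \subset P f) && (N f \subset P e).
Definition compatible (e f : K) : bool :=
  [|| nested e f, nested f e, facing e f | away e f].

Definition free (e : K) v : bool := (v \notin P e) && (v \notin N e).

Lemma ex_tight G e : P e \subset ~: N e -> exists X, tight G e X.
Proof.
move=> PN; have cP : is_cut e (P e) by rewrite /is_cut subxx.
by case: (arg_minnP (outdeg G) cP) => X cX minX; exists X.
Qed.

Lemma is_cutP e X : reflect ((forall v, v \in P e -> v \in X) /\
  (forall v, v \in N e -> v \notin X)) (is_cut e X).
Proof.
apply: (iffP andP) => [[/subsetP PX /subsetP XN]|[PX XN]].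
  split=> // v vN; apply/negP => /XN; by rewrite inE vN.
split; apply/subsetP => // v vX; rewrite inE.
by apply/negP => /XN; rewrite vX.
Qed.

(** Submodularity with its exact defect. For two minimum cuts the defect vanishes, and it is this
    absence of arcs that is exploited later. *)
Lemma outdeg_nested G X Y : outdeg G X + outdeg G Y =
  outdeg G (X :&: Y) + outdeg G (X :|: Y) +
  (arcs_between G (X :\: Y) (Y :\: X) + arcs_between G (Y :\: X) (X :\: Y)).
Proof.
rewrite /outdeg /arcs_between; elim: G => //= a G.
rewrite !inE; move: (count _ _) (count _ _) (count _ _) (count _ _)
  (count _ _) (count _ _) => *.
by case: (a.1.1 \in X); case: (a.1.1 \in Y); case: (a.1.2 \in X);
  case: (a.1.2 \in Y) => /=; lia.
Qed.

(** If [I] is balanced, [outdeg G I] cancels against the arcs entering [I], and posimodularity with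
    its exact defect remains. *)
Lemma outdeg_facing G X Y (I := X :&: Y) (O := ~: (X :|: Y)) :
  outdeg G X + outdeg G Y + arcs_between G (~: I) I =
  outdeg G (X :\: Y) + outdeg G (Y :\: X) + outdeg G I +
  (arcs_between G I O + arcs_between G O I).
Proof.
rewrite /outdeg /arcs_between /I /O; elim: G => //= a G.
rewrite !inE; move: (count _ _) (count _ _) (count _ _) (count _ _)
  (count _ _) (count _ _) (count _ _) (count _ _) => *.
by case: (a.1.1 \in X); case: (a.1.1 \in Y); case: (a.1.2 \in X);
  case: (a.1.2 \in Y) => /=; lia.
Qed.

(** This is [outdeg_facing] for the complements in the reversed graph: [O] takes the place of the
    intersection. *)
Lemma outdeg_away G X Y (I := X :&: Y) (O := ~: (X :|: Y)) :
  outdeg G X + outdeg G Y + outdeg G O =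
  outdeg G (X :|: ~: Y) + outdeg G (Y :|: ~: X) + arcs_between G (~: O) O +
  (arcs_between G I O + arcs_between G O I).
Proof.
rewrite /outdeg /arcs_between /I /O; elim: G => //= a G.
rewrite !inE; move: (count _ _) (count _ _) (count _ _) (count _ _)
  (count _ _) (count _ _) (count _ _) (count _ _) => *.
by case: (a.1.1 \in X); case: (a.1.1 \in Y); case: (a.1.2 \in X);
  case: (a.1.2 \in Y) => /=; lia.
Qed.

Lemma count_tails G X :
  count (fun a : marc => a.1.1 \in X) G =
  \sum_(v in X) count (fun a : marc => a.1.1 == v) G.
Proof.
elim: G => [|a G IH] /=; first by rewrite big1.
rewrite big_split /= -IH; congr addn.
case: (boolP (a.1.1 \in X)) => aX.
  rewrite (bigD1 a.1.1) //= eqxx big1 // => v /andP[_ /negPf].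
  by rewrite eq_sym => ->.
rewrite big1 // => v vX; case: eqP => // av; by rewrite av vX in aX.
Qed.

Lemma count_heads G X :
  count (fun a : marc => a.1.2 \in X) G =
  \sum_(v in X) count (fun a : marc => a.1.2 == v) G.
Proof.
elim: G => [|a G IH] /=; first by rewrite big1.
rewrite big_split /= -IH; congr addn.
case: (boolP (a.1.2 \in X)) => aX.
  rewrite (bigD1 a.1.2) //= eqxx big1 // => v /andP[_ /negPf].
  by rewrite eq_sym => ->.
rewrite big1 // => v vX; case: eqP => // av; by rewrite av vX in aX.
Qed.

Lemma balanced_set G X : (forall v, v \in X -> balanced G v) ->
  outdeg G X = arcs_between G (~: X) X.
Proof.
move=> bal.
have tails : count (fun a : marc => a.1.1 \in X) G =
    outdeg G X + arcs_between G X X.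
  rewrite /outdeg /arcs_between; elim: {bal} G => //= a G ->; rewrite !inE.
  by case: (a.1.1 \in X); case: (a.1.2 \in X) => /=; lia.
have heads : count (fun a : marc => a.1.2 \in X) G =
    arcs_between G (~: X) X + arcs_between G X X.
  rewrite /arcs_between; elim: {bal tails} G => //= a G ->; rewrite !inE.
  by case: (a.1.1 \in X); case: (a.1.2 \in X) => /=; lia.
have : count (fun a : marc => a.1.1 \in X) G = count (fun a : marc => a.1.2 \in X) G.
  by rewrite count_tails count_heads; apply: eq_bigr => v /bal.
by rewrite tails heads => /addIn.
Qed.

Lemma arcs_between_gt0 G X Y (a : marc) :
  a \in G -> a.1.1 \in X -> a.1.2 \in Y -> 0 < arcs_between G X Y.
Proof.
move=> aG aX aY; rewrite /arcs_between -has_count; apply/hasP; exists a => //.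
by rewrite aX aY.
Qed.

Hypothesis compat : forall e f, E e -> E f -> compatible e f.

Section Uncrossing.
Variable G : seq marc.
Hypothesis bal : forall e v, E e -> free e v -> balanced G v.

Lemma tight_nested e f X Y : nested e f -> tight G e X -> tight G f Y ->
  [/\ tight G e (X :&: Y), tight G f (X :|: Y),
      arcs_between G (X :\: Y) (Y :\: X) = 0 &
      arcs_between G (Y :\: X) (X :\: Y) = 0].
Proof.
move=> /andP[/subsetP Pef /subsetP Nfe] [/is_cutP[PX NX] mX] [/is_cutP[PY NY] mY].
have cI : is_cut e (X :&: Y).
  apply/is_cutP; split=> v ve; rewrite inE.
    by rewrite PX ?PY ?Pef.
  by rewrite negb_and NX.
have cU : is_cut f (X :|: Y).
  apply/is_cutP; split=> v ve; rewrite inE.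
    by rewrite PY ?orbT.
  by rewrite negb_or NX ?NY ?Nfe.
have := outdeg_nested G X Y; have := mX _ cI; have := mY _ cU => h1 h2 h3.
split; [split=> // Z cZ; have := mX _ cZ|split=> // Z cZ; have := mY _ cZ| |]; lia.
Qed.

Lemma tight_facing e f X Y : E e -> E f -> facing e f ->
  tight G e X -> tight G f Y ->
  [/\ tight G e (X :\: Y), tight G f (Y :\: X),
      arcs_between G (X :&: Y) (~: (X :|: Y)) = 0 &
      arcs_between G (~: (X :|: Y)) (X :&: Y) = 0].
Proof.
move=> Ee Ef /andP[/subsetP Pef /subsetP Pfe].
move=> [/is_cutP[PX NX] mX] [/is_cutP[PY NY] mY].
have cI : is_cut e (X :\: Y).
  apply/is_cutP; split=> v ve; rewrite inE.
    by rewrite PX ?NY ?Pef.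
  by rewrite negb_and NX ?orbT.
have cU : is_cut f (Y :\: X).
  apply/is_cutP; split=> v ve; rewrite inE.
    by rewrite PY ?NX ?Pfe.
  by rewrite negb_and NY ?orbT.
(* A node of [X :&: Y] avoids [N e] because of [X], and avoids [P e], a part of [N f], because of
   [Y]; so it is free for [e]. *)
have balI : outdeg G (X :&: Y) = arcs_between G (~: (X :&: Y)) (X :&: Y).
  apply: balanced_set => v; rewrite inE => /andP[vX vY]; apply: (bal Ee).
  apply/andP; split; apply/negP; last by move/NX; rewrite vX.
  by move/Pef/NY; rewrite vY.
have := outdeg_facing G X Y; have := mX _ cI; have := mY _ cU => h1 h2 h3.
split; [split=> // Z cZ; have := mX _ cZ|split=> // Z cZ; have := mY _ cZ| |]; lia.
Qed.

Lemma tight_away e f X Y : E e -> E f -> away e f ->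
  tight G e X -> tight G f Y ->
  [/\ tight G e (X :|: ~: Y), tight G f (Y :|: ~: X),
      arcs_between G (X :&: Y) (~: (X :|: Y)) = 0 &
      arcs_between G (~: (X :|: Y)) (X :&: Y) = 0].
Proof.
move=> Ee Ef /andP[/subsetP Pef /subsetP Pfe].
move=> [/is_cutP[PX NX] mX] [/is_cutP[PY NY] mY].
have cI : is_cut e (X :|: ~: Y).
  apply/is_cutP; split=> v ve; rewrite !inE.
    by rewrite PX.
  by rewrite negb_or NX ?negbK ?PY ?Pef.
have cU : is_cut f (Y :|: ~: X).
  apply/is_cutP; split=> v ve; rewrite !inE.
    by rewrite PY.
  by rewrite negb_or NY ?negbK ?PX ?Pfe.
have balO : outdeg G (~: (X :|: Y)) = arcs_between G (~: (~: (X :|: Y))) (~: (X :|: Y)).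
  apply: balanced_set => v; rewrite !inE negb_or => /andP[vX vY]; apply: (bal Ee).
  apply/andP; split; apply/negP; first by move/PX; rewrite (negPf vX).
  by move/Pef/PY; rewrite (negPf vY).
have := outdeg_away G X Y; have := mX _ cI; have := mY _ cU => h1 h2 h3.
split; [split=> // Z cZ; have := mX _ cZ|split=> // Z cZ; have := mY _ cZ| |]; lia.
Qed.

(** The two positions of a tight set that loses an arc when [x -> t -> z] becomes [x -> z], required
    for all [z] of a list at once. *)
Definition covers1 x t (s : seq M) e W : Prop :=
  [/\ E e, tight G e W, t \in W, x \notin W & {in s, forall z, z \notin W}].
Definition covers2 x t (s : seq M) e W : Prop :=
  [/\ E e, tight G e W, x \in W, t \notin W & {in s, forall z, z \in W}].

(** An arc crossing [X] and [Y] in opposite directions joins the two differences, where tight sets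
    of nested cuts have no arcs. *)
Lemma tight_conflict e f X Y (a : marc) : E e -> E f -> a \in G ->
  tight G e X -> tight G f Y ->
  [|| (a.1.1 \in Y) && (a.1.2 \notin Y) && (a.1.1 \notin X) && (a.1.2 \in X)
    | (a.1.1 \in X) && (a.1.2 \notin X) && (a.1.1 \notin Y) && (a.1.2 \in Y)] ->
  facing e f \/ away e f.
Proof.
move=> Ee Ef aG tX tY xy.
case: (or4P (compat Ee Ef)) => h; [| |by left|by right]; exfalso.
  have [_ _ h1 h2] := tight_nested h tX tY; move: xy.
  case/orP => /andP[/andP[/andP[aY bY] aX] bX].
    suff: 0 < arcs_between G (Y :\: X) (X :\: Y) by rewrite h2.
    by apply: arcs_between_gt0 aG _ _; rewrite !inE ?aX ?bX ?aY ?bY.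
  suff: 0 < arcs_between G (X :\: Y) (Y :\: X) by rewrite h1.
  by apply: arcs_between_gt0 aG _ _; rewrite !inE ?aX ?bX ?aY ?bY.
have [_ _ h1 h2] := tight_nested h tY tX; move: xy.
case/orP => /andP[/andP[/andP[aY bY] aX] bX].
  suff: 0 < arcs_between G (Y :\: X) (X :\: Y) by rewrite h1.
  by apply: arcs_between_gt0 aG _ _; rewrite !inE ?aX ?bX ?aY ?bY.
suff: 0 < arcs_between G (X :\: Y) (Y :\: X) by rewrite h2.
by apply: arcs_between_gt0 aG _ _; rewrite !inE ?aX ?bX ?aY ?bY.
Qed.

(** An arc crossing both sets in the same direction joins the intersection and the outside of the
    union, where opposed cuts have no arcs. *)
Lemma tight_agree e f X Y (a : marc) : E e -> E f -> a \in G ->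
  tight G e X -> tight G f Y ->
  a.1.1 \in X = (a.1.1 \in Y) -> a.1.2 \in X = (a.1.2 \in Y) ->
  a.1.1 \in X = (a.1.2 \notin X) -> nested e f \/ nested f e.
Proof.
move=> Ee Ef aG tX tY xy1 xy2 x12.
case: (or4P (compat Ee Ef)) => h; [by left|by right| |]; exfalso.
  have [_ _ h1 h2] := tight_facing Ee Ef h tX tY.
  case: (boolP (a.1.2 \in X)) => aX.
    suff: 0 < arcs_between G (~: (X :|: Y)) (X :&: Y) by rewrite h2.
    by apply: arcs_between_gt0 aG _ _; rewrite !inE -?xy1 -?xy2 ?x12 aX.
  suff: 0 < arcs_between G (X :&: Y) (~: (X :|: Y)) by rewrite h1.
  by apply: arcs_between_gt0 aG _ _; rewrite !inE -?xy1 -?xy2 ?x12 ?(negPf aX).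
have [_ _ h1 h2] := tight_away Ee Ef h tX tY.
case: (boolP (a.1.2 \in X)) => aX.
  suff: 0 < arcs_between G (~: (X :|: Y)) (X :&: Y) by rewrite h2.
  by apply: arcs_between_gt0 aG _ _; rewrite !inE -?xy1 -?xy2 ?x12 aX.
suff: 0 < arcs_between G (X :&: Y) (~: (X :|: Y)) by rewrite h1.
by apply: arcs_between_gt0 aG _ _; rewrite !inE -?xy1 -?xy2 ?x12 ?(negPf aX).
Qed.

Lemma covers_mix x t p s1 s2 e f X Y : (x, t, p) \in G ->
  covers1 x t s1 e X -> covers2 x t s2 f Y ->
  (exists W, covers1 x t (s1 ++ s2) e W) \/ (exists W, covers2 x t (s1 ++ s2) f W).
Proof.
move=> aG [Ee tX tinX xX sX] [Ef tY xY tinY sY].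
have [|h|h] := tight_conflict Ee Ef aG tX tY.
- by rewrite /= xX tinX xY tinY.
- have [tX' _ _ _] := tight_facing Ee Ef h tX tY; left; exists (X :\: Y).
  split=> //; rewrite ?inE ?tinX ?tinY ?(negPf xX) ?andbF // => z.
  rewrite mem_cat inE negb_and negbK => /orP[/sX ->|/sY ->] //; by rewrite orbT.
- have [_ tY' _ _] := tight_away Ee Ef h tX tY; right; exists (Y :|: ~: X).
  split=> //; rewrite ?inE ?xY ?negb_or ?negbK ?tinX ?tinY // => z.
  rewrite mem_cat !inE => /orP[/sX ->|/sY ->] //; by rewrite orbT.
Qed.

Lemma covers11 x t p s1 s2 e f X Y : (x, t, p) \in G ->
  covers1 x t s1 e X -> covers1 x t s2 f Y ->
  exists g W, covers1 x t (s1 ++ s2) g W.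
Proof.
move=> aG [Ee tX tinX xX sX] [Ef tY tinY xY sY].
have [|||h|h] := tight_agree Ee Ef aG tX tY.
- by rewrite /= (negPf xX) (negPf xY).
- by rewrite /= tinX tinY.
- by rewrite /= tinX (negPf xX).
- have [tI _ _ _] := tight_nested h tX tY; exists e, (X :&: Y).
  split=> //; rewrite ?inE ?tinX ?tinY ?negb_and ?xX // => z.
  by rewrite mem_cat inE negb_and => /orP[/sX ->|/sY ->] //; rewrite orbT.
- have [tI _ _ _] := tight_nested h tY tX; exists f, (Y :&: X).
  split=> //; rewrite ?inE ?tinX ?tinY ?negb_and ?xY // => z.
  by rewrite mem_cat inE negb_and => /orP[/sX ->|/sY ->] //; rewrite orbT.
Qed.

Lemma covers22 x t p s1 s2 e f X Y : (x, t, p) \in G ->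
  covers2 x t s1 e X -> covers2 x t s2 f Y ->
  exists g W, covers2 x t (s1 ++ s2) g W.
Proof.
move=> aG [Ee tX xX tinX sX] [Ef tY xY tinY sY].
have [|||h|h] := tight_agree Ee Ef aG tX tY.
- by rewrite /= xX xY.
- by rewrite /= (negPf tinX) (negPf tinY).
- by rewrite /= xX tinX.
- have [_ tU _ _] := tight_nested h tX tY; exists f, (X :|: Y).
  split=> //; rewrite ?inE ?xX ?xY ?negb_or ?tinX ?tinY // => z.
  by rewrite mem_cat inE => /orP[/sX ->|/sY ->] //; rewrite orbT.
- have [_ tU _ _] := tight_nested h tY tX; exists e, (Y :|: X).
  split=> //; rewrite ?inE ?xX ?xY ?negb_or ?tinX ?tinY // => z.
  by rewrite mem_cat inE => /orP[/sX ->|/sY ->] //; rewrite orbT.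
Qed.

Definition locked_pair x t z : Prop :=
  exists e W, [/\ E e, tight G e W &
    (t \in W) && (x \notin W) && (z \notin W) ||
    (x \in W) && (z \in W) && (t \notin W)].

(** Uncrossing merges the sets that block the single splittings at the arc [x -> t] into one set
    blocking all of them, so that [t] can be moved across its boundary. *)
Lemma covers_all x t p (s : seq M) : (x, t, p) \in G -> s != [::] ->
  {in s, forall z, locked_pair x t z} ->
  exists e W, covers1 x t s e W \/ covers2 x t s e W.
Proof.
move=> aG; have one z : locked_pair x t z ->
    exists e W, covers1 x t [:: z] e W \/ covers2 x t [:: z] e W.
  case=> e [W [Ee tW /orP[/andP[/andP[h1 h2] h3]|/andP[/andP[h1 h2] h3]]]];
    exists e, W; [left|right]; split=> // z'; by rewrite inE => /eqP->.
elim: s => // z [|z' s] IH _ lk.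
  by apply: one; apply: lk; rewrite inE eqxx.
have [//|z2 z2s|e [W cW]] := IH; first by apply: lk; rewrite inE z2s orbT.
have [e' [W' cW']] := one z (lk z (mem_head _ _)).
rewrite -cat1s; case: cW cW' => cW [] cW'.
- by have [g [Z cZ]] := covers11 aG cW' cW; exists g, Z; left.
- have perm_cov1 e0 W0 : covers1 x t ((z' :: s) ++ [:: z]) e0 W0 ->
      covers1 x t ([:: z] ++ (z' :: s)) e0 W0.
    by case=> ? ? ? ? h; split=> // z0; rewrite mem_cat orbC -mem_cat; apply: h.
  have perm_cov2 e0 W0 : covers2 x t ((z' :: s) ++ [:: z]) e0 W0 ->
      covers2 x t ([:: z] ++ (z' :: s)) e0 W0.
    by case=> ? ? ? ? h; split=> // z0; rewrite mem_cat orbC -mem_cat; apply: h.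
  case: (covers_mix aG cW cW') => [[Z /perm_cov1 cZ]|[Z /perm_cov2 cZ]].
    by exists e, Z; left.
  by exists e', Z; right.
- by case: (covers_mix aG cW' cW) => [[Z cZ]|[Z cZ]];
    [exists e', Z; left|exists e, Z; right].
- by have [g [Z cZ]] := covers22 aG cW' cW; exists g, Z; right.
Qed.

Definition heads t : seq M := [seq a.1.2 | a <- G & a.1.1 == t].

(** All arcs out of [t] end in [Y]: taking [t] in creates no leaving arc and saves [a]. *)
Lemma no_out_add Y t a : a \in G -> a.1.1 \in Y -> a.1.2 = t -> t \notin Y ->
  {in heads t, forall z, z \in Y} -> outdeg G (t |: Y) < outdeg G Y.
Proof.
move=> aG aY at_ tY hY.
have le (H : seq marc) : {subset H <= G} -> outdeg H (t |: Y) +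
    (has (fun b : marc => (b.1.1 \in Y) && (b.1.2 == t)) H) <= outdeg H Y.
  elim: H => //= b H IH sub.
  have /IH : {subset H <= G} by move=> c cH; apply: sub; rewrite inE cH orbT.
  have bG : b \in G by apply: sub; rewrite inE eqxx.
  have hb : b.1.1 == t -> b.1.2 \in Y.
    move=> bt; apply: hY; apply/mapP; exists b => //; by rewrite mem_filter bt.
  rewrite /outdeg /arcs_between /= !inE.
  move: (count _ _) (count _ _) (has _ _) => c1 c2 h.
  case: (boolP (b.1.1 == t)) hb => [/eqP->|_] hb.
    by rewrite (negPf tY) hb //= !orbT /=; lia.
  case: (b.1.1 \in Y) => /=; last by lia.
  case: (boolP (b.1.2 == t)) => [/eqP->|_]; first by rewrite tY /=; lia.
  by case: (b.1.2 \in Y) => /=; lia.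
have := le G (fun _ h => h).
rewrite (_ : has _ _ = true) ?addn1 //; apply/hasP; exists a => //.
by rewrite aY at_ eqxx.
Qed.

Lemma balanced_remove W t a : a \in G -> a.1.1 \notin W -> a.1.2 = t -> t \in W ->
  {in heads t, forall z, z \notin W} -> balanced G t ->
  outdeg G (W :\ t) < outdeg G W.
Proof.
move=> aG aW at_ tW hW bt.
have le (H : seq marc) : {subset H <= G} ->
    outdeg H (W :\ t) + count (fun b : marc => b.1.1 == t) H +
      (has (fun b : marc => (b.1.1 \notin W) && (b.1.2 == t)) H)
    <= outdeg H W + count (fun b : marc => b.1.2 == t) H.
  elim: H => //= b H IH sub.
  have /IH : {subset H <= G} by move=> c cH; apply: sub; rewrite inE cH orbT.
  have bG : b \in G by apply: sub; rewrite inE eqxx.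
  have hb : b.1.1 == t -> b.1.2 \notin W.
    move=> bt'; apply: hW; apply/mapP; exists b => //; by rewrite mem_filter bt'.
  rewrite /outdeg /arcs_between /= !inE.
  move: (count _ _) (count _ _) (count _ _) (count _ _) (has _ _) => c1 c2 c3 c4 h.
  case: (boolP (b.1.1 == t)) hb => [/eqP->|_] hb.
    rewrite tW (negPf (hb isT)) /=; by case: (b.1.2 == t) => /=; lia.
  case: (b.1.1 \in W) => /=; last by case: (b.1.2 == t) => /=; lia.
  case: (boolP (b.1.2 == t)) => [/eqP->|_]; first by rewrite tW /=; lia.
  by case: (b.1.2 \in W) => /=; lia.
have := le G (fun _ h => h); rewrite bt.
rewrite (_ : has _ _ = true); first by lia.
by apply/hasP; exists a => //; rewrite aW at_ eqxx.
Qed.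

Hypothesis locked : forall x t z p q, (x, t, p) \in G -> (t, z, q) \in G ->
  (x, t, p) != (t, z, q) -> locked_pair x t z.

(** Otherwise [t] is free for [g], hence has outgoing arcs, and one tight set [W] blocks all
    splittings at [x -> t]. As [W] cannot be improved by moving [t], the node [t] belongs to [P e]
    or [N e] for the cut [e] of [W]. Uncrossing [W] with [Z] then yields [t \in N g], or a minimum
    cut for [g] that improves when [t] is added. *)
Lemma tight_out_heads g Z x t p : E g -> tight G g Z -> (x, t, p) \in G ->
  x \in Z -> t \notin Z -> t \in N g.
Proof.
move=> Eg tZ aG xZ tZn; apply/negPn/negP => tN.
have [cZ mZ] := tZ; have /is_cutP[PZ NZ] := cZ.
have tP : t \notin P g by apply/negP => /PZ; rewrite (negPf tZn).
have fr : free g t by rewrite /free tP.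
have hne : heads t != [::].
  rewrite -size_eq0 size_map size_filter.
  have := bal Eg fr; rewrite /balanced => ->; rewrite -lt0n -has_count.
  by apply/hasP; exists (x, t, p) => /=.
have lk : {in heads t, forall z, locked_pair x t z}.
  move=> z /mapP[[[t' z'] q]]; rewrite mem_filter /= => /andP[/eqP-> bG] ->.
  apply: (locked aG bG); apply: contraNneq tZn => -[xt _ _].
  by rewrite -xt.
have done Z' : is_cut g Z' -> outdeg G Z' <= outdeg G Z -> x \in Z' ->
    t \notin Z' -> {in heads t, forall z, z \in Z'} -> False.
  move=> cZ' dZ' xZ' tZ' hZ'.
  have lt := no_out_add aG (_ : (x, t, p).1.1 \in Z') erefl tZ' hZ'.
  have /mZ : is_cut g (t |: Z').
    have /is_cutP[PZ' NZ'] := cZ'; apply/is_cutP; split=> v vg; rewrite !inE.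
      by rewrite PZ' ?orbT.
    by rewrite negb_or NZ' // andbT; apply: contraNneq tN => <-.
  by rewrite leqNgt (leq_trans (lt xZ')).
have [e [W [[Ee tW tinW xW hW]|[Ee tW xW tinW hW]]]] := covers_all aG hne lk.
  have [cW mW] := tW; have /is_cutP[PW NW] := cW.
  have tNe : t \notin N e by apply/negP => /NW; rewrite tinW.
  have tPe : t \in P e.
    apply/negPn/negP => tPe.
    have bt : balanced G t by apply: (bal Ee); rewrite /free tPe.
    have /mW : is_cut e (W :\ t).
      apply/is_cutP; split=> v ve; rewrite !inE.
        by rewrite PW // andbT; apply: contraNneq tPe => <-.
      by rewrite negb_and NW ?orbT.
    by rewrite leqNgt (balanced_remove aG _ erefl tinW hW bt).
  have [|/andP[_ /subsetP h]|h] := tight_conflict Eg Ee aG tZ tW.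
  - by rewrite /= xZ tZn xW tinW !orbT.
  - by case/negP: tN; apply: h.
  - have [[cZ' mZ'] _ _ _] := tight_away Eg Ee h tZ tW.
    apply: (done _ cZ' (mZ' _ cZ)); rewrite ?inE ?xZ ?negb_or ?tZn ?negbK ?tinW //.
    by move=> z /hW; rewrite !inE => ->; rewrite orbT.
have [cW mW] := tW; have /is_cutP[PW NW] := cW.
have tNe : t \in N e.
  apply/negPn/negP => tNe.
  have /mW : is_cut e (t |: W).
    apply/is_cutP; split=> v ve; rewrite !inE.
      by rewrite PW ?orbT.
    by rewrite negb_or NW // andbT; apply: contraNneq tNe => <-.
  by rewrite leqNgt (no_out_add aG _ erefl tinW hW).
have [|||/andP[_ /subsetP h]|h] := tight_agree Eg Ee aG tZ tW.
- by rewrite /= xZ xW.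
- by rewrite /= (negPf tZn) (negPf tinW).
- by rewrite /= xZ tZn.
- by case/negP: tN; apply: h.
- have [_ [cU mU] _ _] := tight_nested h tW tZ.
  apply: (done _ cU (mU _ cZ)); rewrite ?inE ?xZ ?orbT ?negb_or ?tinW ?tZn //.
  by move=> z /hW; rewrite !inE => ->.
Qed.

End Uncrossing.
End Locking.

Section LockingTheorem.
Variables (M : finType) (T : eqType) (K : Type).
Local Notation marc := (M * M * seq T)%type.
Implicit Types (G H : seq marc) (X Y Z W : {set M}) (x t z v : M).
Variable E : K -> Prop.

Definition flip_arcs G : seq marc := [seq (a.1.2, a.1.1, a.2) | a <- G].

Lemma outdeg_flip G X : outdeg (flip_arcs G) X = outdeg G (~: X).
Proof.
rewrite /outdeg /arcs_between count_map; apply: eq_count => a /=.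
by rewrite !inE negbK andbC.
Qed.

Lemma is_cut_flip (P N : K -> {set M}) e X : is_cut N P e X = is_cut P N e (~: X).
Proof. by rewrite /is_cut setCS andbC -setCS setCK. Qed.

Lemma tight_flip (P N : K -> {set M}) G e X :
  tight P N G e X -> tight N P (flip_arcs G) e (~: X).
Proof.
case=> cX mX; split; first by rewrite is_cut_flip setCK.
by move=> Y; rewrite is_cut_flip !outdeg_flip setCK => /mX.
Qed.

Lemma balanced_flip G v : balanced G v -> balanced (flip_arcs G) v.
Proof. by rewrite /balanced !count_map => bal; symmetry; apply: bal. Qed.

Lemma locked_flip (P N : K -> {set M}) G x t z :
  locked_pair E P N G x t z -> locked_pair E N P (flip_arcs G) z t x.
Proof.
case=> e [W [Ee tW h]]; exists e, (~: W); split=> //; first exact: tight_flip.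
move: h; rewrite !inE !negbK.
by case: (t \in W); case: (x \in W); case: (z \in W).
Qed.

Variables P N : K -> {set M}.
Hypothesis compat : forall e f, E e -> E f -> compatible P N e f.
Hypothesis disj : forall e, E e -> P e \subset ~: N e.

Lemma locked_tight G g Z : (forall e v, E e -> free P N e v -> balanced G v) ->
  (forall x t z p q, (x, t, p) \in G -> (t, z, q) \in G ->
     (x, t, p) != (t, z, q) -> locked_pair E P N G x t z) ->
  E g -> tight P N G g Z -> outdeg G Z = arcs_between G (P g) (N g).
Proof.
move=> bal lk Eg tZ; have [/is_cutP[PZ NZ] _] := tZ.
apply: eq_in_count => -[[x t] p] aG /=; rewrite inE.
apply/andP/andP => [[xZ tZn]|[/PZ-> /NZ->]] //; split.
  (* The statement on tails is the one on heads in the reversed graph, where [P] and [N] change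
     places. *)
  have compat' : forall e f, E e -> E f -> compatible N P e f.
    move=> e f Ee Ef; have := compat Ee Ef.
    rewrite /compatible /nested /facing /away.
    by case/or4P => /andP[-> ->]; rewrite ?orbT.
  apply: (tight_out_heads compat' _ _ Eg (tight_flip tZ) (x := t) (p := p)).
  - by move=> e v Ee fv; apply/balanced_flip/(bal e) => //; rewrite /free andbC.
  - move=> x' t' z' p' q' /mapP[[[a b] c] abG [-> -> pc]].
    move=> /mapP[[[a' b'] c'] abG' [/= eqb -> eqc]] /= ne; apply: locked_flip.
    rewrite -eqb in abG' ne *; apply: lk abG' abG _; apply: contraNneq ne.
    by case=> aa ab cc; rewrite pc eqc aa cc -ab.
  - by apply/mapP; exists (x, t, p).
  - by rewrite inE.
  - by rewrite inE xZ.
exact: (tight_out_heads compat bal lk Eg tZ aG).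
Qed.

Lemma balanced_perm G H v : perm_eq G H -> balanced G v -> balanced H v.
Proof. by move=> /permP eqGH; rewrite /balanced !eqGH. Qed.

Theorem locking G : (forall e v, E e -> free P N e v -> balanced G v) ->
  exists G', splits_to G G' /\
    forall e, E e -> exists2 X, is_cut P N e X &
      outdeg G X <= arcs_between G' (P e) (N e).
Proof.
have [n] := ubnP (size G); elim: n G => // n IH G ltG bal.
have [[x [t [z [p [q [G0 [eqG nlk]]]]]]]|lk] := boolp.pselect
   (exists x t z p q G0, perm_eq G ((x, t, p) :: (t, z, q) :: G0) /\
      ~ locked_pair E P N G x t z).
  pose G1 := (x, z, p ++ q) :: G0.
  have szG : size G1 < n by have := perm_size eqG; move: ltG => /= + eq; rewrite eq ltnS.
  have [] := IH G1 szG.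
    move=> e v Ee /(bal _ _ Ee) /(balanced_perm eqG); rewrite /balanced /=.
    by move=> eqc; apply: (@addnI (t == v)); rewrite addnCA eqc; lia.
  move=> G' [sp cuts]; exists G'; split; first exact: splits_step eqG sp.
  move=> e Ee; have [X cX dX] := cuts e Ee.
  have [Y tY] := ex_tight G (disj Ee); have [cY mY] := tY.
  exists Y => //; apply: leq_trans dX; have := mY X cX.
  have dG : outdeg G X = (x \in X) && (t \notin X) + ((t \in X) && (z \notin X)) +
      outdeg G0 X.
    by rewrite /outdeg /arcs_between (permP eqG) /= !inE addnA.
  have -> : outdeg G1 X = (x \in X) && (z \notin X) + outdeg G0 X.
    by rewrite /outdeg /arcs_between /= !inE.
  rewrite dG => le; have [tX|ntX] := boolp.pselect (tight P N G e X).
    move: le; case: (boolP ((t \in X) && (x \notin X) && (z \notin X) ||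
      (x \in X) && (z \in X) && (t \notin X))) => bad.
      by case: nlk; exists e, X.
    by move: bad; case: (x \in X); case: (t \in X); case: (z \in X) => //=; lia.
  (* A splitting lowers an outdegree by at most one, so a cut that is not tight cannot fall below
     the old minimum. *)
  have lt : outdeg G Y < outdeg G X.
    rewrite ltnNge; apply/negP => leX; apply: ntX; split=> // Z /mY.
    exact: leq_trans.
  by move: lt; rewrite dG; case: (x \in X); case: (t \in X); case: (z \in X) => //=; lia.
exists G; split; first exact: splits_refl.
move=> e Ee; have [Z tZ] := ex_tight G (disj Ee); exists Z; first by case: tZ.
rewrite (locked_tight bal _ Ee tZ) // => x t z p q aG bG ne.
apply: boolp.contrapT => nlk; apply: lk.
exists x, t, z, p, q, (rem (t, z, q) (rem (x, t, p) G)); split=> //.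
apply: perm_trans (perm_to_rem aG) _; rewrite perm_cons; apply: perm_to_rem.
by apply: rem_mem bG; rewrite eq_sym.
Qed.
End LockingTheorem.

Import Order.TTheory GRing.Theory Num.Theory.
Local Open Scope ring_scope.

(** * Integral multiflows from compatible cuts *)

Section NetworkLocking.
Variables (R : realType) (S : finType) (N : network S).
Local Notation V := (node N).
Local Notation M := (V + (V + V))%type.
Local Notation marc := (M * M * seq (Defs.arc N))%type.
Local Notation cut := ({set S} * {set S} * R)%type.

Lemma simple_walk (u v : V) p : walk u p v ->
  exists q, [/\ walk u q v, uniq (u :: map (@tgt S N) q) & {subset q <= p}].
Proof.
elim: p u => [|a p IH] u /=; first by move=> uv; exists [::]; split.
case/andP => /eqP <- /IH[q [wq uq sq]].
have sub : {subset q <= a :: p} by move=> b /sq bp; rewrite inE bp orbT.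
have [inq|ninq] := boolP (src a \in tgt a :: map (@tgt S N) q); last first.
  exists (a :: q); split; [by rewrite /= eqxx|by rewrite cons_uniq ninq|].
  by move=> b; rewrite !inE => /predU1P[->|/sq->]; rewrite ?eqxx ?orbT.
have suffix_walk (w : V) (r : seq (Defs.arc N)) (x : V) : walk w r v ->
    uniq (w :: map (@tgt S N) r) -> x \in w :: map (@tgt S N) r ->
    exists r', [/\ walk x r' v, uniq (x :: map (@tgt S N) r') & {subset r' <= r}].
  elim: r w => [|b r IHr] w wr ur.
    rewrite /= inE => /eqP ->; exists [::]; split=> //.
  rewrite inE => /predU1P[->|xr]; first by exists (b :: r); split.
  have /andP[_ ur'] : (w \notin map (@tgt S N) (b :: r)) &&
    uniq (map (@tgt S N) (b :: r)) by [].
  have /andP[_ wr'] : (src b == w) && walk (tgt b) r v by [].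
  have [r' [h1 h2 h3]] := IHr _ wr' ur' xr; exists r'; split=> // c /h3.
  by rewrite inE => ->; rewrite orbT.
have [r [h1 h2 h3]] := suffix_walk _ _ _ wq uq inq.
by exists r; split=> // b /h3 /sub.
Qed.

Lemma walk_cat (u w v : V) p q : walk u p w -> walk w q v -> walk u (p ++ q) v.
Proof.
elim: p u => [|a p IH] u /=; first by move=> /eqP ->.
by case/andP => -> /IH h /h.
Qed.

Lemma walk_crosses (X : pred V) (u v : V) p : walk u p v -> X u -> ~~ X v ->
  exists2 a, a \in p & X (src a) && ~~ X (tgt a).
Proof.
elim: p u => [|a p IH] u /=; first by move=> /eqP -> ->.
case/andP => /eqP <- wp Xu Xv; have [Xa|Xa] := boolP (X (tgt a)).
  by have [b bp h] := IH _ wp Xa Xv; exists b; rewrite ?inE ?bp ?orbT.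
by exists a; rewrite ?inE ?eqxx ?Xu.
Qed.

Definition at_terms (A : {set S}) (v : V) : bool := v \in term N @: A.

Lemma at_termsP (A B : {set S}) v : at_terms A v -> at_terms B v ->
  [disjoint A & B] -> False.
Proof.
case/imsetP => s sA -> /imsetP[t tB /(@term_inj _ N) st] /pred0P/(_ s) /=.
by rewrite sA st tB.
Qed.

Lemma at_termsS (A B : {set S}) v : A \subset B -> at_terms A v -> at_terms B v.
Proof. by move=> AB; apply: subsetP; apply: imsetS. Qed.

Variable wild : pred V.

(* A node [v] of the network is [inl v]; a wild node [v] moreover gets a
   private source [inr (inl v)] and a private sink [inr (inr v)], and then
   paths start and end there rather than at [inl v]. *)
Definition source_side (e : cut) : {set M} := [set m : M | match m with
  | inl v => ~~ wild v && at_terms e.1.1 v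
  | inr (inl v) => wild v && at_terms e.1.1 v
  | inr (inr v) => wild v && ~~ at_terms e.1.2 v end].
Definition sink_side (e : cut) : {set M} := [set m : M | match m with
  | inl v => ~~ wild v && at_terms e.1.2 v
  | inr (inl v) => wild v && ~~ at_terms e.1.1 v
  | inr (inr v) => wild v && at_terms e.1.2 v end].

Definition outcap (v : V) : nat := (\sum_(a | src a == v) cap a)%N.
Definition incap (v : V) : nat := (\sum_(a | tgt a == v) cap a)%N.

Definition copies (I : finType) (c : I -> nat) (h : I -> marc) : seq marc :=
  flatten [seq nseq (c i) (h i) | i <- enum I].

Definition ext_arcs : seq marc :=
  copies (@cap S N) (fun a => (inl (src a), inl (tgt a), [:: a])) ++
  copies (fun v => wild v * outcap v)%N (fun v => (inr (inl v), inl v, [::])) ++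
  copies (fun v => wild v * incap v)%N (fun v => (inl v, inr (inr v), [::])).

Lemma count_copies (I : finType) c h (Q : pred marc) :
  count Q (@copies I c h) = (\sum_i c i * Q (h i))%N.
Proof.
rewrite /copies count_flatten -map_comp sumnE big_map big_enum /=.
by apply: eq_bigr => i _; rewrite count_nseq mulnC.
Qed.

Lemma count_ext_arcs (Q : pred marc) : count Q ext_arcs =
  (\sum_a cap a * Q (inl (src a), inl (tgt a), [:: a]) +
   (\sum_v wild v * outcap v * Q (inr (inl v), inl v, [::]) +
    \sum_v wild v * incap v * Q (inl v, inr (inr v), [::])))%N.
Proof. by rewrite !count_cat !count_copies. Qed.

Lemma sum_pick (I : finType) (F : I -> nat) i :
  (\sum_j F j * (j == i) = F i)%N.
Proof.
rewrite (bigD1 i) //= eqxx muln1 big1 ?addn0 // => j /negPf->.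
by rewrite muln0.
Qed.

(** The private arcs, [outcap v] entering and [incap v] leaving, balance a wild node [v]. Its
    private nodes always lie on a side of [e], hence are never free: a private sink that is no
    target of [e] goes to the source side, where arcs into it do not count. *)
Lemma ext_arcs_balanced (e : cut) m : (forall v, ~~ wild v -> eulerian_at v) ->
  free source_side sink_side e m -> balanced ext_arcs m.
Proof.
move=> eul; rewrite /balanced /free !count_ext_arcs !inE; case: m => [v|[v|v]] /=.
- move=> _.
  have e1 : (\sum_v0 wild v0 * outcap v0 * ((inr (inl v0) : M) == inl v))%N = 0%N.
    by rewrite big1 // => w _; rewrite muln0.
  have e2 : (\sum_v0 wild v0 * incap v0 * ((inr (inr v0) : M) == inl v))%N = 0%N.
    by rewrite big1 // => w _; rewrite muln0.
  rewrite e1 e2 addn0 add0n.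
  have e3 (c : V -> nat) : (\sum_v0 wild v0 * c v0 * ((inl v0 : M) == inl v))%N =
      (wild v * c v)%N by apply: (sum_pick (fun w => wild w * c w)%N).
  rewrite !e3.
  have -> : (\sum_a cap a * ((inl (src a) : M) == inl v))%N = outcap v.
    rewrite /outcap [RHS]big_mkcond; apply: eq_bigr => a _.
    by rewrite inj_eq; [case: (_ == _); rewrite ?muln1 ?muln0|exact: inl_inj].
  have -> : (\sum_a cap a * ((inl (tgt a) : M) == inl v))%N = incap v.
    rewrite /incap [RHS]big_mkcond; apply: eq_bigr => a _.
    by rewrite inj_eq; [case: (_ == _); rewrite ?muln1 ?muln0|exact: inl_inj].
  case: (boolP (wild v)) => [_|/eul]; first by rewrite !mul1n addnC.
  by rewrite /eulerian_at !mul0n !addn0 /outcap /incap => ->.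
- have [wv|nwv _] := boolP (wild v); first by rewrite /=; case: at_terms.
  rewrite [X in (_ + (X + _))%N]big1 => [|w _].
    rewrite !big1 // => w _; rewrite ?muln0 //.
  have [->|ne] := eqVneq w v; first by rewrite (negPf nwv) mul0n.
  by case: eqP => [[wv]|]; [rewrite wv eqxx in ne|rewrite muln0].
- have [wv|nwv _] := boolP (wild v); first by rewrite /=; case: at_terms.
  rewrite [X in (_ = _ + (_ + X))%N]big1 => [|w _].
    rewrite !big1 // => w _; rewrite ?muln0 //.
  have [->|ne] := eqVneq w v; first by rewrite (negPf nwv) mul0n.
  by case: eqP => [[wv]|]; [rewrite wv eqxx in ne|rewrite muln0].
Qed.

(** The conditions on wild nodes express the inclusions of sides at private nodes: for facing cuts,
    a private sink on the source side of one, that is, outside its targets, must be a target of the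
    other. *)
Definition compatible_cuts (e f : cut) : bool :=
  [|| (e.1.1 \subset f.1.1) && (f.1.2 \subset e.1.2),
      (f.1.1 \subset e.1.1) && (e.1.2 \subset f.1.2),
      [&& e.1.1 \subset f.1.2, f.1.1 \subset e.1.2 &
        [forall v, wild v ==> at_terms e.1.2 v || at_terms f.1.2 v]]
    | [&& e.1.2 \subset f.1.1, f.1.2 \subset e.1.1 &
        [forall v, wild v ==> at_terms e.1.1 v || at_terms f.1.1 v]]].

Lemma compatible_sides (e f : cut) :
  [disjoint e.1.1 & e.1.2] -> [disjoint f.1.1 & f.1.2] ->
  compatible_cuts e f -> compatible source_side sink_side e f.
Proof.
move=> dje djf.
have nest (e' f' : cut) : (e'.1.1 \subset f'.1.1) && (f'.1.2 \subset e'.1.2) ->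
    nested source_side sink_side e' f'.
  case/andP => h1 h2; apply/andP; split; apply/subsetP => -[v|[v|v]];
    rewrite !inE => /andP[->] /=.
  - exact: at_termsS.
  - exact: at_termsS.
  - by apply: contraNN; apply: at_termsS.
  - exact: at_termsS.
  - by apply: contraNN; apply: at_termsS.
  - exact: at_termsS.
have face (e' f' : cut) : [disjoint f'.1.1 & f'.1.2] -> e'.1.1 \subset f'.1.2 ->
    (forall v, wild v -> at_terms e'.1.2 v || at_terms f'.1.2 v) ->
    source_side e' \subset sink_side f'.
  move=> dj h1 h3; apply/subsetP => -[v|[v|v]]; rewrite !inE => /andP[wv] h.
  - by rewrite wv (at_termsS h1).
  - rewrite wv /=; apply/negP => h'; apply: at_termsP h' _ dj.
    exact: at_termsS h1 h.
  - by have := h3 _ wv; rewrite wv (negPf h).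
have awy (e' f' : cut) : [disjoint f'.1.1 & f'.1.2] -> e'.1.2 \subset f'.1.1 ->
    (forall v, wild v -> at_terms e'.1.1 v || at_terms f'.1.1 v) ->
    sink_side e' \subset source_side f'.
  move=> dj h1 h3; apply/subsetP => -[v|[v|v]]; rewrite !inE => /andP[wv] h.
  - by rewrite wv (at_termsS h1).
  - by have := h3 _ wv; rewrite wv (negPf h).
  - rewrite wv /=; apply/negP => h'; apply: at_termsP _ h' dj.
    exact: at_termsS h1 h.
rewrite /compatible; case/or4P => [/nest->|/nest->||]; rewrite ?orbT //.
  case/and3P => h1 h2 /forallP h3.
  suff -> : facing source_side sink_side e f by rewrite !orbT.
  apply/andP; split; apply: face => // v wv; have := h3 v; rewrite wv //=.
  by rewrite orbC.
case/and3P => h1 h2 /forallP h3.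
suff -> : away source_side sink_side e f by rewrite !orbT.
apply/andP; split; apply: awy => // v wv; have := h3 v; rewrite wv //=.
by rewrite orbC.
Qed.

Lemma outdeg_ext_arcs X : outdeg ext_arcs X =
  (\sum_a cap a * ((inl (src a) \in X) && (inl (tgt a) \notin X)) +
   (\sum_v wild v * outcap v * ((inr (inl v) \in X) && (inl v \notin X)) +
    \sum_v wild v * incap v * ((inl v \in X) && (inr (inr v) \notin X))))%N.
Proof.
rewrite /outdeg /arcs_between count_ext_arcs /=.
by congr (_ + (_ + _))%N; apply: eq_bigr => i _; rewrite inE.
Qed.

Lemma flow_through_arcs (f : multiflow R N) (Q : pred (tpath N)) (D : pred (Defs.arc N)) :
  (forall P, P \in paths f -> Q P -> exists2 a, a \in P.2 & D a) ->
  \sum_(P <- paths f | Q P) weight f P <= (\sum_(a | D a) cap a)%N%:R.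
Proof.
move=> hQ; rewrite natr_sum.
apply: (@le_trans _ _ (\sum_(a | D a) \sum_(P <- paths f | a \in P.2) weight f P));
  last by apply: ler_sum => a _; apply: weight_cap.
rewrite [X in _ <= X](eq_bigr (fun a => \sum_(P <- paths f)
   (if a \in P.2 then weight f P else 0))); last by move=> a _; rewrite big_mkcond.
rewrite exchange_big /= big_mkcond /= !big_seq; apply: ler_sum => P Pf.
have w0 := weight_ge0 Pf; case: ifP => [/(hQ _ Pf)[a aP Da]|_].
  rewrite (bigD1 a) //= aP lerDl; apply: sumr_ge0 => b _; by case: ifP.
by apply: sumr_ge0 => b _; case: ifP.
Qed.

(** Each path is charged to one counted arc: an arc of its own if [X] separates its ends, else the
    private arc at its start or at its end, which must then be wild. All paths starting at [v] use
    arcs out of [v], so the private arcs at [v] suffice; likewise at the end. *)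
Lemma cut_bound (f : multiflow R N) (e : cut) X :
  [disjoint e.1.1 & e.1.2] -> is_cut source_side sink_side e X ->
  \sum_(P <- paths f | (P.1.1 \in e.1.1) && (P.1.2 \in e.1.2)) weight f P
    <= (outdeg ext_arcs X)%:R.
Proof.
move=> dje /is_cutP[PX NX]; rewrite outdeg_ext_arcs.
set Q := fun P : tpath N => (P.1.1 \in e.1.1) && (P.1.2 \in e.1.2).
pose D1 := [pred a : Defs.arc N | (inl (src a) \in X) && (inl (tgt a) \notin X)].
pose Q2 v := [pred P : tpath N | Q P && (term N P.1.1 == v)].
pose Q3 v := [pred P : tpath N | Q P && (term N P.1.2 == v)].
pose W2 v := [&& wild v, inr (inl v) \in X & inl v \notin X].
pose W3 v := [&& wild v, inl v \in X & inr (inr v) \notin X].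
pose Q1 := [pred P : tpath N | [&& Q P, inl (term N P.1.1) \in X &
  inl (term N P.1.2) \notin X]].
have tp (P : tpath N) : P \in paths f ->
    P.1.1 != P.1.2 /\ walk (term N P.1.1) P.2 (term N P.1.2).
  by move/pathsP; case: P => [[s t] p] /and3P[].
have b1 : \sum_(P <- paths f | Q1 P) weight f P <= (\sum_(a | D1 a) cap a)%N%:R.
  apply: flow_through_arcs => P Pf /and3P[_ h1 h2].
  exact: (walk_crosses (X := fun v => inl v \in X) (tp _ Pf).2 h1 h2).
have neq (P : tpath N) : P \in paths f -> term N P.1.1 != term N P.1.2.
  by move=> /tp[ne _]; apply: contraNneq ne => /(@term_inj _ N) ->.
have b2 v : \sum_(P <- paths f | Q2 v P) weight f P <= (outcap v)%:R.
  apply: flow_through_arcs => P Pf /= /andP[_ /eqP <-].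
  have ne : ~~ pred1 (term N P.1.1) (term N P.1.2) by rewrite /= eq_sym neq.
  have [a aP /andP[/eqP h _]] :=
    walk_crosses (X := pred1 (term N P.1.1)) (tp _ Pf).2 (eqxx (term N P.1.1)) ne.
  by exists a => //; apply/eqP.
have b3 v : \sum_(P <- paths f | Q3 v P) weight f P <= (incap v)%:R.
  apply: flow_through_arcs => P Pf /= /andP[_ /eqP <-].
  have ne : ~~ predC1 (term N P.1.2) (term N P.1.2) by rewrite /= negbK.
  have [a aP /andP[_ /negPn/eqP h]] :=
    walk_crosses (X := predC1 (term N P.1.2)) (tp _ Pf).2 (neq _ Pf) ne.
  by exists a => //; apply/eqP.
have -> : (\sum_a cap a * ((inl (src a) \in X) && (inl (tgt a) \notin X)) +
   (\sum_v wild v * outcap v * ((inr (inl v) \in X) && (inl v \notin X)) +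
    \sum_v wild v * incap v * ((inl v \in X) && (inr (inr v) \notin X))))%N =
  (\sum_(a | D1 a) cap a + (\sum_(v | W2 v) outcap v + \sum_(v | W3 v) incap v))%N.
  congr (_ + (_ + _))%N; rewrite [RHS]big_mkcond; apply: eq_bigr => i _ /=.
  - by case: (_ && _); rewrite ?muln1 ?muln0.
  - by rewrite /W2; case: (wild i) => //=; case: (_ && _); rewrite ?mul1n ?muln1 ?muln0.
  - by rewrite /W3; case: (wild i) => //=; case: (_ && _); rewrite ?mul1n ?muln1 ?muln0.
rewrite !natrD.
have le2 : \sum_(v | W2 v) \sum_(P <- paths f | Q2 v P) weight f P <=
   (\sum_(v | W2 v) outcap v)%N%:R by rewrite natr_sum; apply: ler_sum.
have le3 : \sum_(v | W3 v) \sum_(P <- paths f | Q3 v P) weight f P <=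
   (\sum_(v | W3 v) incap v)%N%:R by rewrite natr_sum; apply: ler_sum.
apply: le_trans (lerD b1 (lerD le2 le3)).
have sw (W : pred V) (q : tpath N -> V) :
    \sum_(v | W v) \sum_(P <- paths f | Q P && (q P == v)) weight f P =
    \sum_(P <- paths f) (if Q P && W (q P) then weight f P else 0).
  under eq_bigr do rewrite big_mkcond.
  rewrite exchange_big /=; apply: eq_bigr => P _.
  case: (boolP (Q P)) => QP /=; last by rewrite big1.
  rewrite -big_mkcondr /=; case: ifP => WP.
    by rewrite (big_pred1 (q P)) // => v /=; rewrite eq_sym andbC;
      case: eqP => // ->; rewrite WP.
  by rewrite big_pred0 // => v; rewrite andbC; case: eqP => // <-.
rewrite /Q2 /Q3 /= (sw W2 (fun P => term N P.1.1)) (sw W3 (fun P => term N P.1.2)).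
rewrite big_mkcond [X in X + _]big_mkcond -!big_split /= big_seq [X in _ <= X]big_seq.
apply: ler_sum => P Pf; have w0 := weight_ge0 Pf.
rewrite -/(Q P); case: (boolP (Q P)) => /= [/andP[sA tB]|_]; last by rewrite !addr0.
have atA : at_terms e.1.1 (term N P.1.1) by apply: imset_f.
have atB : at_terms e.1.2 (term N P.1.2) by apply: imset_f.
have h0 (b : bool) : 0 <= (if b then weight f P else 0) by case: b.
case: (boolP (inl (term N P.1.1) \in X)) => sX /=; last first.
  suff -> : W2 (term N P.1.1) by rewrite add0r lerDl.
  rewrite /W2 sX andbT; have [ws|ws] := boolP (wild (term N P.1.1)).
    by rewrite PX // !inE ws atA.
  by case/negP: sX; apply: PX; rewrite !inE ws atA.
case: (boolP (inl (term N P.1.2) \in X)) => tX /=; last by rewrite lerDl addr_ge0.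
suff -> : W3 (term N P.1.2) by rewrite add0r lerDr.
rewrite /W3 tX /=; have [ws|ws] := boolP (wild (term N P.1.2)).
  by rewrite NX // !inE ws atB.
by have := NX (inl (term N P.1.2)); rewrite !inE ws atB tX => /(_ isT).
Qed.

Definition base (m : M) : V :=
  match m with inl v | inr (inl v) | inr (inr v) => v end.

Definition proper_arc (i : marc) : bool :=
  [&& walk (base i.1.1) i.2 (base i.1.2),
      (if i.1.1 is inr (inr _) then false else true) &
      (if i.1.2 is inr (inl _) then false else true)].

Definition usage (G : seq marc) (a : Defs.arc N) : nat :=
  (\sum_(i <- G) count_mem a i.2)%N.

Lemma splits_to_proper G G' : splits_to G G' -> all proper_arc G ->
  all proper_arc G' /\ forall a, usage G' a = usage G a.
Proof.
elim=> [//|{}G G0 {}G' x t z p q eqG _ IH].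
rewrite (perm_all _ eqG) /= => /and3P[/and3P[w1 h1 h2] /and3P[w2 h3 h4] all0].
have [|h h'] := IH.
  by rewrite /= all0 andbT; apply/and3P; split=> //=; apply: walk_cat w1 w2.
split=> // a; rewrite h' /usage (perm_big _ eqG) /= !big_cons /=.
by rewrite count_cat addnA.
Qed.

Lemma big_copies (I : finType) c h (F : marc -> nat) :
  (\sum_(i <- @copies I c h) F i = \sum_i c i * F (h i))%N.
Proof.
rewrite /copies big_flatten big_map big_enum /=; apply: eq_bigr => i _.
by rewrite big_nseq iter_addn_0 mulnC.
Qed.

Lemma usage_ext_arcs a : usage ext_arcs a = cap a.
Proof.
rewrite /usage !big_cat !big_copies /= [X in (_ + (X + _))%N]big1 => [|v _];
  last by rewrite muln0.
rewrite [X in (_ + (_ + X))%N]big1 => [|v _]; last by rewrite muln0.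
by rewrite !addn0 -[RHS](sum_pick (@cap S N)); apply: eq_bigr => b _; rewrite addn0.
Qed.

Lemma proper_ext_arcs : all proper_arc ext_arcs.
Proof.
apply/allP => i; rewrite !mem_cat => /or3P[] /flattenP[l /mapP[j _ ->]];
  by rewrite mem_nseq => /andP[_ /eqP ->]; rewrite /proper_arc /= ?eqxx.
Qed.

(** Shortening a walk to a simple path only lowers the use of arcs. Merged arcs that do not join
    distinct terminals are dropped; they never count for disjoint [A] and [B]. *)
Lemma tpaths_of_arcs (H : seq marc) : all proper_arc H ->
  exists L : seq (tpath N), [/\ all (@is_tpath S N) L,
    forall a, (\sum_(P <- L) (a \in P.2) <= usage H a)%N &
    forall A B : {set S}, [disjoint A & B] ->
      (count (fun i : marc => at_terms A (base i.1.1) && at_terms B (base i.1.2)) H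
        <= count (fun P : tpath N => (P.1.1 \in A) && (P.1.2 \in B)) L)%N].
Proof.
elim: H => [_|[[x y] p] H IH /= /andP[/and3P[/= wp _ _] /IH[L [tL uL cL]]]].
  by exists [::]; split=> // a; rewrite big_nil.
have [[s [t [xs yt st]]]|no] := boolp.pselect (exists s t,
    [/\ base x = term N s, base y = term N t & s != t]).
  rewrite xs yt in wp; have [q [wq uq sq]] := simple_walk wp.
  exists ((s, t, q) :: L); split.
  - by rewrite /= tL andbT; apply/and3P; split.
  - move=> a; rewrite /usage !big_cons; apply: leq_add (uL a) => /=.
    case: (boolP (a \in q)) => // /sq ap; by rewrite -has_pred1 has_count in ap *.
  - move=> A B AB /=; apply: leq_add (cL A B AB).
    rewrite xs yt /at_terms !(mem_imset _ _ (@term_inj _ N)).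
    by [].
exists L; split=> //.
  by move=> a; rewrite /usage big_cons; apply: leq_trans (uL a) (leq_addl _ _).
move=> A B AB /=; suff -> : at_terms A (base x) && at_terms B (base y) = false.
  exact: cL.
apply/negP => /andP[/imsetP[s sA xs] /imsetP[t tB yt]]; apply: no.
exists s, t; split=> //; apply: contraTneq tB => <-.
by rewrite (disjointFr AB sA).
Qed.

Theorem integral_optimal (mu : S -> S -> R) (E : seq cut) :
  (forall s t, mu s t =
     \sum_(e <- E) e.2 * ((s \in e.1.1) && (t \in e.1.2))%:R) ->
  (forall e : cut, e \in E -> 0 <= e.2 /\ [disjoint e.1.1 & e.1.2]) ->
  (forall v, ~~ wild v -> eulerian_at v) ->
  {in E &, forall e f, compatible_cuts e f} ->
  exists f : multiflow R N, integral f /\ optimal mu f.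
Proof.
move=> muE posE eul compE.
pose EE e := e \in E.
have [|||G' [sp cuts]] := @locking M (Defs.arc N) cut EE source_side sink_side _ _ ext_arcs.
- move=> e f Ee Ef; have [_ de] := posE e Ee; have [_ df] := posE f Ef.
  by apply: compatible_sides => //; apply: compE.
- move=> e Ee; have [_ de] := posE e Ee; apply/subsetP => -[v|[v|v]];
    rewrite !inE => /andP[wv] h; rewrite wv /= ?h // ?negbK //.
  by apply/negP => h'; apply: at_termsP h h' de.
- by move=> e v _; apply: ext_arcs_balanced.
have [prG' usG'] := splits_to_proper sp proper_ext_arcs.
have [L [tL uL cL]] := tpaths_of_arcs prG'.
pose wt (P : tpath N) : R := (count_mem P L)%:R.
have sumL (F : tpath N -> R) (Q : pred (tpath N)) :
    \sum_(P <- undup L | Q P) wt P * F P = \sum_(P <- L | Q P) F P.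
  rewrite -[RHS]big_undup_iterop_count; apply: eq_bigr => P _.
  by rewrite Monoid.iteropE /wt mulr_natl iter_addr addr0.
have capL a : \sum_(P <- undup L | a \in P.2) wt P <= (cap a)%:R.
  have := sumL (fun=> 1) (fun P => a \in P.2).
  under eq_bigr do rewrite mulr1.
  move=> ->; rewrite -usage_ext_arcs -usG' big_mkcond /=.
  apply: (@le_trans _ _ (\sum_(P <- L) (a \in P.2))%N%:R); last first.
    by rewrite ler_nat; apply: uL.
  by rewrite natr_sum le_eqVlt; apply/orP; left; apply/eqP/eq_bigr => P _; case: ifP.
have okL P : P \in undup L -> is_tpath P by rewrite mem_undup; apply: (allP tL).
have wt0 P : P \in undup L -> 0 <= wt P by rewrite ler0n.
exists (Multiflow (undup_uniq L) okL wt0 capL); split.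
  by move=> P _ /=; rewrite natr_int.
move=> g; rewrite /value /= sumL.
have swap (I : Type) (r : seq I) (w : I -> R) (s t : I -> S) :
    \sum_(i <- r) w i * mu (s i) (t i) = \sum_(e <- E) e.2 *
       \sum_(i <- r | (s i \in e.1.1) && (t i \in e.1.2)) w i.
  under [RHS]eq_bigr do rewrite big_mkcond mulr_sumr.
  rewrite exchange_big /=; apply: eq_bigr => i _; rewrite muE mulr_sumr.
  apply: eq_bigr => e _; case: ifP => _; rewrite ?mulr1 ?mulr0 //; ring.
have -> : \sum_(P <- L) mu P.1.1 P.1.2 = \sum_(P <- L) 1 * mu P.1.1 P.1.2.
  by apply: eq_bigr => P _; rewrite mul1r.
rewrite !swap [X in X <= _]big_seq [X in _ <= X]big_seq; apply: ler_sum => e Ee.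
have [e0 de] := posE e Ee; apply: ler_wpM2l => //.
have [X cX dX] := cuts e Ee; apply: le_trans (cut_bound g de cX) _.
have -> : \sum_(P <- L | (P.1.1 \in e.1.1) && (P.1.2 \in e.1.2)) (1 : R) =
    (count (fun P : tpath N => (P.1.1 \in e.1.1) && (P.1.2 \in e.1.2)) L)%:R.
  by rewrite -sum1_count natr_sum.
rewrite ler_nat; apply: leq_trans dX (leq_trans _ (cL _ _ de)).
set Q := fun i : marc => at_terms e.1.1 (base i.1.1) && at_terms e.1.2 (base i.1.2).
(* Proper arcs do not start at private sinks or end at private sources. So those from one side to
   the other join genuine terminals of [e.1.1] and [e.1.2], not nodes placed there for balance. *)
have -> : arcs_between G' (source_side e) (sink_side e) =
    count (fun i : marc => [&& i.1.1 \in source_side e, i.1.2 \in sink_side e & Q i]) G'.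
  apply: eq_in_count => -[[x y] p] /(allP prG')/and3P[_ /= h1 h2].
  rewrite andbA; case: (boolP (_ && _)) => //= /andP[]; rewrite !inE /Q /=.
  case: x h1 => [v|[v|//]] _ /andP[_ ->]; case: y h2 => [w|[//|w]] _ /andP[_ ->] //.
by apply: sub_count => i /and3P[].
Qed.

End NetworkLocking.

(** * Generic choices and common margins *)

(** The image of [f] is countable, hence of Lebesgue measure zero, while the interval has measure
    [d]. *)
Lemma interval_avoids (R : realType) (T : countType) (f : T -> R) (d : R) :
  0 < d -> exists x, 0 < x < d /\ forall t, f t != x.
Proof.
move=> d0; apply: boolp.contrapT => no.
pose i0d : interval R := Interval (BRight 0) (BLeft d).
pose A : set R := mkset (fun x : R => x \in i0d).
have sub : (A `<=` classical_sets.image classical_sets.setT f)%classic.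
  move=> x x0d; apply: boolp.contrapT => nof; apply: no.
  exists x; split; first by move: x0d; rewrite /A /mkset /i0d in_itv.
  by move=> t; apply/eqP => ft; apply: nof; exists t.
have cnt : cardinality.countable A.
  apply: (cardinality.sub_countable (cardinality.subset_card_le sub)).
  apply: (cardinality.sub_countable (cardinality.card_image_le _ _)).
  exact: cardinality.countableP.
have := lebesgue_measure.countable_lebesgue_measure0 cnt.
rewrite /A lebesgue_measure.lebesgue_measure_itv /= constructive_ereal.lte_fin d0.
by rewrite constructive_ereal.sube0 => -[d0']; rewrite d0' ltxx in d0.
Qed.

Lemma uniform_margin (R : realType) (I : finType) (Q : I -> R -> Prop) :
  (forall i m m', 0 < m' -> m' <= m -> Q i m -> Q i m') ->
  (forall i, exists m, 0 < m /\ Q i m) -> exists m, 0 < m /\ forall i, Q i m.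
Proof.
move=> anti ex; have [f fP] := boolp.choice ex.
have [m [m0 mP]] : exists m, 0 < m /\ forall i, i \in enum I -> m <= f i.
  elim: (enum I) => [|i s [m [m0 mP]]]; first by exists 1; split.
  exists (Num.min m (f i)); split; first by rewrite lt_min m0; have [] := fP i.
  move=> j; rewrite inE ge_min => /predU1P[->|/mP->] //; by rewrite lexx orbT.
exists m; split=> // i; have [_] := fP i; apply: anti => //.
by apply: mP; rewrite mem_enum.
Qed.

(** * Cells of the slimmed tropical polytope *)

Section Slim.
Variables (R : realType) (S : finType) (mu : S -> S -> R).
Implicit Types (pc pr : S -> R) (cc cr : S -> 'I_3) (s t u w x : S).

Definition touch pc pr s t : bool := pc s + pr t == mu s t.

Definition feasible pc pr : Prop := forall s t, mu s t <= pc s + pr t.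

(** This makes a feasible point minimal in [P_mu]: every coordinate is held up by an equality. *)
Definition spanned pc pr : Prop :=
  (forall s, exists t, touch pc pr s t) /\ (forall t, exists s, touch pc pr s t).

(* The points of Q_slim, in terms of K and of X = {s | touch s s}: nonfat, or
   degenerate on one of the two sides. *)
Definition slim_shape pc pr : Prop :=
  let T := touch pc pr in
  [\/ (exists x u, [/\ T x x, ~~ T u u & T x u]) /\
      (exists w x, [/\ ~~ T w w, T x x & T w x]),
      (forall x u, T x x -> ~~ T u u -> ~~ T x u) /\
      (forall w, ~~ T w w -> exists2 u, ~~ T u u & T w u)
    | (forall w x, ~~ T w w -> T x x -> ~~ T w x) /\
      (forall u, ~~ T u u -> exists2 w, ~~ T w w & T w u)].

(** The classes are unions of components of [K(p)]. Each must contain a terminal of positive round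
    trip, because shifts of the remaining terminals may vanish in the quotient. *)
Definition three_classes pc pr cc cr : Prop :=
  (forall s t, touch pc pr s t -> cc s = cr t) /\
  (forall i, exists s, ~~ touch pc pr s s /\ (cc s = i \/ cr s = i)).

Definition no_three_classes : Prop := forall pc pr cc cr,
  feasible pc pr -> spanned pc pr -> slim_shape pc pr ->
  three_classes pc pr cc cr -> False.

Definition glue pc pr : Defs.point R S :=
  [ffun v => match v with inl s => pc s | inr s => pr s end].

Lemma glue_inl pc pr s : glue pc pr (inl s) = pc s. Proof. by rewrite ffunE. Qed.
Lemma glue_inr pc pr s : glue pc pr (inr s) = pr s. Proof. by rewrite ffunE. Qed.
Definition glueE := (glue_inl, glue_inr).

Lemma K_glue pc pr s t : K mu (glue pc pr) (inl s) (inr t) = touch pc pr s t.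
Proof. by rewrite /K !glueE. Qed.

Lemma K_glueC pc pr s t : K mu (glue pc pr) (inr t) (inl s) = touch pc pr s t.
Proof. by rewrite /K !glueE. Qed.

Lemma glue_Q pc pr : feasible pc pr -> spanned pc pr -> Q_mu mu (glue pc pr).
Proof.
move=> fe [sp1 sp2]; split; first by move=> s t; rewrite !glueE.
move=> q Pq qp; apply/ffunP => -[s|t].
  have [t /eqP st] := sp1 s; have := Pq s t; have := qp (inl s); have := qp (inr t).
  rewrite !glueE => h1 h2 h3; apply/eqP; rewrite eq_le h2 /=; lra.
have [s /eqP st] := sp2 t; have := Pq s t; have := qp (inl s); have := qp (inr t).
rewrite !glueE => h1 h2 h3; apply/eqP; rewrite eq_le h1 /=; lra.
Qed.

Lemma in_copyc (X : {set S}) s : (inl s \in copyc X) = (s \in X).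
Proof. by rewrite mem_imset // => a b []. Qed.
Lemma in_copyr (X : {set S}) s : (inr s \in copyr X) = (s \in X).
Proof. by rewrite mem_imset // => a b []. Qed.
Lemma inr_copyc (X : {set S}) s : (inr s \in copyc X) = false.
Proof. by apply/imsetP => -[]. Qed.
Lemma inl_copyr (X : {set S}) s : (inl s \in copyr X) = false.
Proof. by apply/imsetP => -[]. Qed.
Definition copyE := (in_copyc, in_copyr, inr_copyc, inl_copyr).

Lemma nbrs_copyc pc pr (Y : {set S}) v : v \in nbrs mu (glue pc pr) (copyc Y) =
  if v is inr t then [exists s in Y, touch pc pr s t] else false.
Proof.
rewrite inE; case: v => [s|t].
  apply/andP => -[_ /exists_inP[[x|x] //]].
  by rewrite copyE.
rewrite copyE /=; apply/exists_inP/exists_inP => [[[s|s]]|[s sY st]].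
- by rewrite copyE K_glue => sY st; exists s.
- by rewrite copyE.
- by exists (inl s); rewrite ?copyE ?K_glue.
Qed.

Lemma nbrs_copyr pc pr (Y : {set S}) v : v \in nbrs mu (glue pc pr) (copyr Y) =
  if v is inl s then [exists t in Y, touch pc pr s t] else false.
Proof.
rewrite inE; case: v => [s|t]; last first.
  apply/andP => -[_ /exists_inP[[x|x] //]].
  by rewrite copyE.
rewrite copyE /=; apply/exists_inP/exists_inP => [[[t|t]]|[t tY st]].
- by rewrite copyE.
- by rewrite copyE K_glueC => sY st; exists t.
- by exists (inr t); rewrite ?copyE ?K_glueC.
Qed.

Hypothesis dmu : directed_distance mu.
Let mu_ge0 s t : 0 <= mu s t. Proof. by have [+ _] := dmu; apply. Qed.
Let mu_refl s : mu s s = 0. Proof. by have [_ +] := dmu; apply. Qed.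

Lemma touch_refl pc pr s : touch pc pr s s = (pc s + pr s == 0).
Proof. by rewrite /touch mu_refl. Qed.

Definition zero_set pc pr : {set S} := [set s | touch pc pr s s].

(** Both round trips are zero, so the feasibility of [(s, t)] and [(t, s)] adds up to
    [mu s t + mu t s <= 0]. *)
Lemma touch_zero pc pr s t : feasible pc pr -> touch pc pr s s ->
  touch pc pr t t -> touch pc pr s t /\ mu s t = 0.
Proof.
move=> fe; rewrite !touch_refl => /eqP ss /eqP tt.
have h1 := fe s t; have h2 := fe t s; have h3 := mu_ge0 s t; have h4 := mu_ge0 t s.
have e : mu s t = 0 by apply/eqP; rewrite eq_le; apply/andP; split; lra.
by split=> //; apply/eqP; rewrite e; lra.
Qed.

Lemma Q_at_zero_set pc pr X : Q_at mu X (glue pc pr) -> X = zero_set pc pr.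
Proof. by case=> _ h; apply/setP => s; rewrite inE -h K_glue. Qed.

Lemma zero_on_zero_set pc pr : feasible pc pr -> zero_on mu (zero_set pc pr).
Proof. by move=> fe s t; rewrite !inE => hs ht; have [] := touch_zero fe hs ht. Qed.

Lemma glue_slim pc pr : feasible pc pr -> spanned pc pr -> slim_shape pc pr ->
  Q_slim mu (glue pc pr).
Proof.
move=> fe sp sh; split; first exact: glue_Q.
have atX : Q_at mu (zero_set pc pr) (glue pc pr).
  by split=> [|s]; [exact: glue_Q|rewrite K_glue inE].
move=> [[X zX [aX fatX]] nodeg]; rewrite (Q_at_zero_set aX) in fatX.
case: sh => -[h1 h2].
- case: h1 h2 => x [u [xx uu xu]] [w [y [ww yy wy]]].
  case: fatX => /subsetP h.
    have := h (inr y); rewrite nbrs_copyc copyE !inE yy /= => /(_ _)/negP; apply=> //.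
    by apply/exists_inP; exists w; rewrite ?inE.
  have := h (inl x); rewrite nbrs_copyr copyE !inE xx /= => /(_ _)/negP; apply=> //.
  by apply/exists_inP; exists u; rewrite ?inE.
- apply: (nodeg _ (zero_on_zero_set fe)); split=> //; right.
  apply/setP => -[w|u]; rewrite nbrs_copyr !copyE // !inE.
  apply/exists_inP/idP => [[u]|/h2[u uu wu]]; last by exists u; rewrite ?inE.
  by rewrite !inE => uu; apply: contraL => ww; apply: h1.
- apply: (nodeg _ (zero_on_zero_set fe)); split=> //; left.
  apply/setP => -[w|u]; rewrite nbrs_copyc !copyE // !inE.
  apply/exists_inP/idP => [[w]|/h2[w ww wu]]; last by exists w; rewrite ?inE.
  by rewrite !inE => ww; apply: contraL => uu; apply: h1.
Qed.

(* Moving two of the three classes sweeps out a triangle inside one face. *)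
Section Triangle.
Variables (pc pr : S -> R) (cc cr : S -> 'I_3).
Hypotheses (fe : feasible pc pr) (sp : spanned pc pr) (sh : slim_shape pc pr).
Hypothesis same_class : forall s t, touch pc pr s t -> cc s = cr t.
Hypothesis all_classes : forall i, exists s,
  ~~ touch pc pr s s /\ (cc s = i \/ cr s = i).

(** Class 0 is the reference that stays put. Columns move against the rows, so that sums within a
    class are kept. *)
Definition weight2 (a b : R) (i : 'I_3) : R :=
  if val i is 0%N then 0 else if val i is 1%N then a else b.
Definition move_c (a b : R) s : R := pc s + weight2 a b (cc s).
Definition move_r (a b : R) s : R := pr s - weight2 a b (cr s).

Lemma weight2_bound a b i : 0 <= a -> 0 <= b -> 0 <= weight2 a b i <= a + b.
Proof.
by rewrite /weight2 => a0 b0; case: i => -[|[|i]] /= _; apply/andP; split; lra.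
Qed.

Lemma move_touch (d : R) :
  (forall s t, ~~ touch pc pr s t -> mu s t + d < pc s + pr t) ->
  forall a b, 0 <= a -> 0 <= b -> a + b <= d ->
    feasible (move_c a b) (move_r a b) /\
    forall s t, touch (move_c a b) (move_r a b) s t = touch pc pr s t.
Proof.
move=> hd a b a0 b0 ab.
have key1 s t : touch pc pr s t -> move_c a b s + move_r a b t = mu s t.
  by move=> h; have e := same_class h; move/eqP: h; rewrite /move_c /move_r e; lra.
have key2 s t : ~~ touch pc pr s t -> mu s t < move_c a b s + move_r a b t.
  move=> /hd; rewrite /move_c /move_r.
  have /andP[] := weight2_bound (cc s) a0 b0; have /andP[] := weight2_bound (cr t) a0 b0.
  lra.
split=> s t; case: (boolP (touch pc pr s t)) => h.
- by rewrite key1.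
- by apply/ltW/key2.
- by apply/eqP/key1.
- by apply/negP => /eqP h'; have := key2 s t h; rewrite h' ltxx.
Qed.

(** Off [X] an equivalence is a common translation by some [k], and every class has a terminal
    there. Class 0 does not move, so [k = 0]. *)
Lemma move_inj (d : R) :
  (forall s t, ~~ touch pc pr s t -> mu s t + d < pc s + pr t) ->
  forall a b a' b', 0 <= a -> 0 <= b -> a + b <= d ->
  0 <= a' -> 0 <= b' -> a' + b' <= d ->
  slim_equiv mu (glue (move_c a b) (move_r a b)) (glue (move_c a' b') (move_r a' b')) ->
  a = a' /\ b = b'.
Proof.
move=> hd a b a' b' a0 b0 ab a0' b0' ab' eqv.
have [k hk] : exists k, forall s, ~~ touch pc pr s s ->
    move_c a b s - move_c a' b' s = k /\ move_r a b s - move_r a' b' s = - k.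
  case: eqv => [[k eqk]|[X [_ [aX _] _ [k [k' eqk]]]]]; exists k => s ss.
    have := congr1 (fun p : Defs.point R S => p (inl s)) eqk.
    have := congr1 (fun p : Defs.point R S => p (inr s)) eqk.
    rewrite !ffunE !inE /= => -> ->; split.
      by rewrite -[LHS]/(k * 1); ring.
    by rewrite -[LHS]/(k * - 1); ring.
  have sX : s \in X = false.
    case: aX => _ /(_ s); rewrite K_glue => <-.
    by rewrite (move_touch hd a0 b0 ab).2; apply/negbTE.
  have := congr1 (fun p : Defs.point R S => p (inl s)) eqk.
  have := congr1 (fun p : Defs.point R S => p (inr s)) eqk.
  rewrite !ffunE !inE sX /= oppr0 => -> ->; split.
    by rewrite -[LHS]/(k * 1 + k' * 0); ring.
  by rewrite -[LHS]/(k * - 1 + k' * 0); ring.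
have hw i : weight2 a b i - weight2 a' b' i = k.
  have [s [ss [<-|<-]]] := all_classes i; have [] := hk s ss;
    by rewrite /move_c /move_r; lra.
have := hw (@Ordinal 3 0 isT); have := hw (@Ordinal 3 1 isT).
have := hw (@Ordinal 3 2 isT); rewrite /weight2 /=; split; lra.
Qed.

End Triangle.

Lemma dim_no_three_classes : dim_Q_slim_quotient_le mu 1 -> no_three_classes.
Proof.
move=> dimle pc pr cc cr fe sp sh cl.
have [d [d0 hd]] : exists d, 0 < d /\ forall st : S * S,
    ~~ touch pc pr st.1 st.2 -> mu st.1 st.2 + d < pc st.1 + pr st.2.
  apply: (uniform_margin (Q := fun st d => ~~ touch pc pr st.1 st.2 ->
    mu st.1 st.2 + d < pc st.1 + pr st.2)).
    by move=> st m m' m0 mm h /h; lra.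
  move=> [s t] /=; case: (boolP (touch pc pr s t)) => h; first by exists 1; split.
  exists ((pc s + pr t - mu s t) / 2); have : mu s t < pc s + pr t.
    rewrite lt_neqAle fe andbT; apply: contra h; rewrite /touch eq_sym.
    by move=> /eqP ->.
  by move=> lt; split=> [|_]; lra.
have {}hd s t := hd (s, t).
pose mv a b := glue (move_c pc cc a b) (move_r pr cr a b).
have mvT a b : 0 <= a -> 0 <= b -> a + b <= d ->
    feasible (move_c pc cc a b) (move_r pr cr a b) /\
    forall s t, touch (move_c pc cc a b) (move_r pr cr a b) s t = touch pc pr s t.
  exact: (move_touch (proj1 cl) hd).
have mvQ a b : 0 <= a -> 0 <= b -> a + b <= d -> Q_slim mu (mv a b).
  move=> a0 b0 ab; have [fe' T] := mvT _ _ a0 b0 ab; apply: glue_slim => //.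
    by split=> s; [have [t st] := proj1 sp s|have [t st] := proj2 sp s];
      exists t; rewrite T.
  case: sh => -[h1 h2]; [apply: Or31|apply: Or32|apply: Or33]; split.
  - by have [x [u xu]] := h1; exists x, u; rewrite !T.
  - by have [x [u xu]] := h2; exists x, u; rewrite !T.
  - by move=> x u; rewrite !T; apply: h1.
  - by move=> w; rewrite T => /h2[u uu wu]; exists u; rewrite T.
  - by move=> x u; rewrite !T; apply: h1.
  - by move=> w; rewrite T => /h2[u uu wu]; exists u; rewrite T.
(* The functional [w] adds up the tight constraints, so on the face [F] all of them stay tight. *)
pose w : Defs.point R S := [ffun v => match v with
  | inl s => (\sum_t (touch pc pr s t)%:R) | inr t => \sum_s (touch pc pr s t)%:R end].
have dotw (p : Defs.point R S) : dot w p =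
    \sum_s \sum_t (touch pc pr s t)%:R * (p (inl s) + p (inr t)).
  rewrite /dot big_sumType /= [X in _ + X](eq_bigr (fun t =>
    \sum_s (touch pc pr s t)%:R * p (inr t))); last first.
    by move=> t _; rewrite ffunE mulr_suml.
  rewrite exchange_big /= -big_split /=; apply: eq_bigr => s _.
  rewrite ffunE mulr_suml -big_split /=; apply: eq_bigr => t _; ring.
pose b0 := \sum_s \sum_t (touch pc pr s t)%:R * mu s t.
pose F : set (Defs.point R S) := [set p | P_mu mu p /\ dot w p = b0]%classic.
have FP p : F p -> forall s t, touch pc pr s t -> p (inl s) + p (inr t) = mu s t.
  case=> Pp; rewrite dotw /b0 => eq s t st.
  have nn s' t' : 0 <= (touch pc pr s' t')%:R * (p (inl s') + p (inr t')) -
      (touch pc pr s' t')%:R * mu s' t'.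
    by rewrite -mulrBr mulr_ge0 // subr_ge0.
  have : \sum_s' \sum_t' ((touch pc pr s' t')%:R * (p (inl s') + p (inr t')) -
      (touch pc pr s' t')%:R * mu s' t') = 0.
    under eq_bigr do rewrite sumrB.
    by rewrite sumrB eq subrr.
  move/psumr_eq0P => /(_ (fun s' _ => sumr_ge0 _ (fun t' _ => nn s' t'))) /(_ s isT).
  move/psumr_eq0P => /(_ (fun t' _ => nn s t')) /(_ t isT).
  by rewrite st !mul1r => /eqP; rewrite subr_eq0 => /eqP.
have faceF : face (P_mu mu) F.
  exists w, b0; split=> // p Pp; rewrite dotw /b0; apply: ler_sum => s _.
  by apply: ler_sum => t _; apply: ler_wpM2l.
have FQ : (F `<=` Q_mu mu)%classic.
  move=> p Fp; have [Pp _] := Fp; rewrite (_ : p = glue (p \o inl) (p \o inr)).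
    apply: glue_Q => //; split=> s.
      by have [t /(FP _ Fp) st] := proj1 sp s; exists t; apply/eqP.
    by have [t /(FP _ Fp) st] := proj2 sp s; exists t; apply/eqP.
  by apply/ffunP => -[s|s]; rewrite !ffunE.
have mvF a b : 0 <= a -> 0 <= b -> a + b <= d -> F (mv a b).
  move=> a0 b0' ab; have [fe' T] := mvT _ _ a0 b0' ab; split.
    by move=> s t; rewrite !glueE.
  rewrite dotw; apply: eq_bigr => s _; apply: eq_bigr => t _; rewrite !glueE.
  by case: (boolP (touch pc pr s t)); rewrite ?mul0r // -T => /eqP ->.
pose tri (i : 'I_3) : Defs.point R S :=
  mv (if val i == 1%N then d else 0) (if val i == 2%N then d else 0).
have sum3 (f : 'I_3 -> R) : \sum_i f i =
    f (@Ordinal 3 0 isT) + f (@Ordinal 3 1 isT) + f (@Ordinal 3 2 isT).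
  rewrite !big_ord_recl big_ord0 /= addr0 addrA.
  by congr (f _ + f _ + f _); apply: val_inj.
have combE (al : 'I_3 -> R) s : (\sum_i al i *: tri i) (inl s) =
    (\sum_i al i) * pc s +
      weight2 (al (@Ordinal 3 1 isT) * d) (al (@Ordinal 3 2 isT) * d) (cc s).
  rewrite sum_ffunE !sum3 !ffunE /= /move_c /weight2.
  by case: (cc s) => -[|[|[|//]]] /= _; rewrite /GRing.scale /=; ring.
have combEr (al : 'I_3 -> R) s : (\sum_i al i *: tri i) (inr s) =
    (\sum_i al i) * pr s -
      weight2 (al (@Ordinal 3 1 isT) * d) (al (@Ordinal 3 2 isT) * d) (cr s).
  rewrite sum_ffunE !sum3 !ffunE /= /move_r /weight2.
  by case: (cr s) => -[|[|[|//]]] /= _; rewrite /GRing.scale /=; ring.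
have hullE (q : Defs.point R S) : convex_hull tri q ->
    exists a b, [/\ 0 <= a, 0 <= b, a + b <= d & q = mv a b].
  case=> al [al0 al1 ->]; exists (al (@Ordinal 3 1 isT) * d), (al (@Ordinal 3 2 isT) * d).
  split; rewrite ?mulr_ge0 ?(ltW d0) //.
    rewrite -mulrDl ler_piMl ?(ltW d0) //; move: al1; rewrite sum3.
    have := al0 (@Ordinal 3 0 isT); lra.
  by apply/ffunP => -[s|s]; rewrite ?combE ?combEr al1 mul1r !ffunE.
suff : (2 <= 1)%N by [].
apply: (dimle F faceF FQ 2 tri).
- move=> al al0 comb.
  have hw i : weight2 (al (@Ordinal 3 1 isT) * d) (al (@Ordinal 3 2 isT) * d) i = 0.
    have [s [_ [<-|<-]]] := proj2 cl i.
      by have := congr1 (fun p : Defs.point R S => p (inl s)) comb;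
        rewrite combE al0 mul0r add0r ffunE.
    have := congr1 (fun p : Defs.point R S => p (inr s)) comb.
    by rewrite combEr al0 mul0r add0r ffunE => /eqP; rewrite oppr_eq0 => /eqP.
  have h1 := hw (@Ordinal 3 1 isT); have h2 := hw (@Ordinal 3 2 isT).
  move: h1 h2 al0; rewrite /weight2 /= sum3 => /eqP; rewrite mulf_eq0 (gt_eqF d0) orbF.
  move=> /eqP h1 /eqP; rewrite mulf_eq0 (gt_eqF d0) orbF => /eqP h2.
  rewrite h1 h2 !addr0 => h0 i.
  case: i => -[|[|[|//]]] lti; [rewrite -h0|rewrite -h1|rewrite -h2];
    by congr (al _); apply: val_inj.
- move=> q /hullE[a [b [a0 b0' ab ->]]]; split; first exact: mvF.
  exact: mvQ.
- move=> x y /hullE[a [b [a0 b0' ab ->]]] /hullE[a' [b' [a0' b0'' ab' ->]]] eqv.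
  by have [-> ->] := move_inj (proj1 cl) (proj2 cl) hd a0 b0' ab a0' b0'' ab' eqv.
Qed.

End Slim.

Lemma ex_max (R : realType) (I : finType) (i0 : I) (F : I -> R) :
  exists i, forall j, F j <= F i.
Proof.
by case: (@Order.TotalTheory.arg_maxP _ R I i0 predT F isT) => i _ h; exists i => j; apply: h.
Qed.

Lemma ex_min (R : realType) (I : finType) (i0 : I) (F : I -> R) :
  exists i, forall j, F i <= F j.
Proof.
by case: (@Order.TotalTheory.arg_minP _ R I i0 predT F isT) => i _ h; exists i => j; apply: h.
Qed.

(** * Generic points and forbidden minors *)

Section Combinations.
Variables (R : realType) (S : finType) (mu : S -> S -> R).

(** Integer coefficients keep the combinations countable, so that an arbitrarily small perturbation
    avoids them. *)
Definition combination (a : R) : Prop :=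
  exists n : {ffun S * S -> int}, a = \sum_k (n k)%:~R * mu k.1 k.2.

Lemma combination0 : combination 0.
Proof.
by exists [ffun=> 0]; rewrite big1 // => k _; rewrite ffunE mul0r.
Qed.

Lemma combinationD a b : combination a -> combination b -> combination (a + b).
Proof.
move=> [n ->] [m ->]; exists [ffun k => n k + m k].
by rewrite -big_split /=; apply: eq_bigr => k _; rewrite ffunE rmorphD mulrDl.
Qed.

Lemma combinationN a : combination a -> combination (- a).
Proof.
move=> [n ->]; exists [ffun k => - n k].
by rewrite -sumrN; apply: eq_bigr => k _; rewrite ffunE rmorphN mulNr.
Qed.

Lemma combinationB a b : combination a -> combination b -> combination (a - b).
Proof. by move=> ha hb; apply: combinationD => //; apply: combinationN. Qed.

Lemma combination_mu s t : combination (mu s t).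
Proof.
exists [ffun k => (k == (s, t))%:R]; rewrite (bigD1 (s, t)) //= ffunE eqxx mul1r.
by rewrite big1 ?addr0 // => k /negPf h; rewrite ffunE h mul0r.
Qed.

Definition independent (x : 'I_3 -> R) : Prop :=
  forall i j, combination (x i - x j) -> i = j.

Definition shifted (x : 'I_3 -> R) (e : R) (i : 'I_3) : R := x i + (val i)%:R * e.

Lemma independent_shift (x : 'I_3 -> R) (d : R) : 0 < d ->
  exists e, 0 < e < d /\ independent (shifted x e).
Proof.
move=> d0.
(* These are the values of [e] for which two entries would differ by a combination. For equal
   indices the quotient is 0 by convention, a value outside the interval. *)
pose f (k : 'I_3 * 'I_3 * {ffun S * S -> int}) : R :=
  (\sum_st (k.2 st)%:~R * mu st.1 st.2 - (x k.1.1 - x k.1.2)) /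
  ((val k.1.1)%:R - (val k.1.2)%:R).
have [e [e0d ef]] := interval_avoids f d0; exists e; split=> // i j [n].
rewrite /shifted => eqn; apply: boolp.contrapT => /eqP ne.
have ne' : (val i)%:R - (val j)%:R != 0 :> R by rewrite subr_eq0 eqr_nat.
have /eqP[] := ef (i, j, n); rewrite /f /= -eqn.
by apply: (mulIf ne'); rewrite mulfVK //; ring.
Qed.
End Combinations.

Section TopExtension.
Variables (R : realType) (S : finType) (mu : S -> S -> R).
Variables (y : 'I_3 -> S) (x : 'I_3 -> R).

(** Columns get the least values allowed by the rows [y], then rows the least values allowed by the
    columns. Each [y j] dominates in some column, so the second pass returns [x j]. *)
Lemma top_extension : (forall j, exists u, forall i, mu (y i) u - x i <= mu (y j) u - x j) ->
  exists pc pr, [/\ feasible mu pc pr, spanned mu pc pr,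
    forall i, pc (y i) = x i,
    forall v, exists i, pr v = mu (y i) v - x i &
    forall w, exists v, pc w = mu w v - pr v].
Proof.
move=> act.
have /boolp.choice[pr prP] v : exists r, (forall i, mu (y i) v - x i <= r) /\
    exists i, r = mu (y i) v - x i.
  have [i hi] := ex_max (@Ordinal 3 0 isT) (fun i => mu (y i) v - x i).
  by exists (mu (y i) v - x i); split=> //; exists i.
have /boolp.choice[pc pcP] w : exists r, (forall v, mu w v - pr v <= r) /\
    exists v, r = mu w v - pr v.
  have [v hv] := ex_max w (fun v => mu w v - pr v).
  by exists (mu w v - pr v); split=> //; exists v.
have pcy i : pc (y i) = x i.
  have [h1 [v ev]] := pcP (y i); apply/eqP; rewrite eq_le; apply/andP; split.
    by rewrite ev; have := (prP v).1 i; lra.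
  have [u hu] := act i; apply: le_trans (h1 u); have [_ [k ->]] := prP u.
  by have := hu k; lra.
exists pc, pr; split=> //.
- by move=> s t; have := (pcP s).1 t; lra.
- split=> s.
    by have [_ [v ev]] := pcP s; exists v; rewrite /touch ev subrK.
  have [_ [i ei]] := prP s; exists (y i); rewrite /touch pcy ei.
  by apply/eqP; ring.
- by move=> v; have [_] := prP v.
- by move=> w; have [_] := pcP w.
Qed.

(** The class of a coordinate can be read off its value. With [x] independent, touching coordinates
    necessarily have the same class. *)
Definition classified (pc pr : S -> R) : Prop :=
  (forall s, exists i, combination mu (pc s - x i)) /\
  (forall s, exists i, combination mu (pr s + x i)).

Lemma top_extension_classified pc pr :
  (forall v, exists i, pr v = mu (y i) v - x i) ->
  (forall w, exists v, pc w = mu w v - pr v) -> classified pc pr.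
Proof.
move=> hr hc.
have h2 v : exists i, combination mu (pr v + x i).
  by have [i ->] := hr v; exists i; rewrite subrK; apply: combination_mu.
split=> // w; have [v ->] := hc w; have [i hi] := h2 v; exists i.
rewrite -addrA -opprD; apply: combinationB => //; exact: combination_mu.
Qed.

Lemma classified_touch pc pr cc cr : independent mu x ->
  (forall s, combination mu (pc s - x (cc s))) ->
  (forall s, combination mu (pr s + x (cr s))) ->
  forall s t, touch mu pc pr s t -> cc s = cr t.
Proof.
move=> ind hc hr s t /eqP st; apply: ind.
have := combinationB (combinationD (hc s) (hr t)) (combination_mu mu s t).
move=> /combinationN; rewrite -st; congr combination; ring.
Qed.
End TopExtension.

(** * Sliding a point into the slimmed polytope *)

Section Slide.
Variables (R : realType) (S : finType) (mu : S -> S -> R).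
Hypothesis dmu : directed_distance mu.
Local Notation touch := (touch mu).
Local Notation feasible := (feasible mu).
Local Notation spanned := (spanned mu).
Implicit Types (pc pr : S -> R).

Definition stranded pc pr : {set S} := [set w | ~~ touch pc pr w w &
  [forall u, ~~ touch pc pr u u ==> ~~ touch pc pr w u]].

(** Lexicographic: the number of positive round trips, then the number of stranded rows, which is
    below [#|S|.+1]. *)
Definition slide_measure pc pr : nat :=
  #|~: zero_set mu pc pr| * #|S|.+1 + #|stranded pc pr|.

Definition column_anchored pc pr : Prop :=
  exists w x, [/\ ~~ touch pc pr w w, touch pc pr x x & touch pc pr w x].
Definition row_anchored pc pr : Prop :=
  exists x u, [/\ touch pc pr x x, ~~ touch pc pr u u & touch pc pr x u].

(* A proper fat whose columns of zero_set are unmovable only because of the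
   stranded rows: lower these rows together with the rows of zero_set, and raise
   the columns of zero_set, until a new pair touches. *)
Lemma slide pc pr (x : 'I_3 -> R) w0 : feasible pc pr -> spanned pc pr ->
  classified mu x pc pr -> ~ row_anchored pc pr -> w0 \in stranded pc pr ->
  exists pc' pr', [/\ feasible pc' pr', spanned pc' pr', classified mu x pc' pr',
    column_anchored pc' pr' &
    [/\ forall s, s \notin zero_set mu pc pr :|: stranded pc pr -> pc' s = pc s,
        forall s, s \notin zero_set mu pc pr -> pr' s = pr s &
        row_anchored pc' pr' \/ (slide_measure pc' pr' < slide_measure pc pr)%N]].
Proof.
move=> fe sp [clc clr] nrow w0W.
set X := zero_set mu pc pr; set W := stranded pc pr.
have inX s : (s \in X) = touch pc pr s s by rewrite inE.
have inW s : (s \in W) = (s \notin X) && [forall u, (u \notin X) ==> ~~ touch pc pr s u].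
  by rewrite !inE; congr (_ && _); apply: eq_forallb => u; rewrite !inE.
have WX s : s \in W -> s \notin X by rewrite inW => /andP[].
have XY s u : s \in X -> u \notin X -> ~~ touch pc pr s u.
  by rewrite !inX => ss uu; apply/negP => su; apply: nrow; exists s, u.
have WY s u : s \in W -> u \notin X -> ~~ touch pc pr s u.
  by rewrite inW => /andP[_ /forallP/(_ u)/implyP].
(* Pairs outside the domain get the value of the admissible pair [(w0, w0)]; if one of them is a
   minimiser, [(w0, w0)] is one too. *)
have [k hk] := ex_min (w0, w0) (fun k : S * S =>
  if (k.1 \in X :|: W) && (k.2 \notin X) then pc k.1 + pr k.2 - mu k.1 k.2
  else pc w0 + pr w0 - mu w0 w0).
have [a0 [b0 [a0XW b0X ab]]] : exists a0 b0, [/\ a0 \in X :|: W, b0 \notin X &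
    forall a b, a \in X :|: W -> b \notin X ->
      pc a0 + pr b0 - mu a0 b0 <= pc a + pr b - mu a b].
  case: (boolP ((k.1 \in X :|: W) && (k.2 \notin X))) hk => [/andP[k1 k2]|_] hk.
    by exists k.1, k.2; split=> // a b aX bX; have := hk (a, b); rewrite aX bX.
  exists w0, w0; rewrite in_setU w0W orbT WX //; split=> // a b aX bX.
  by have := hk (a, b); rewrite aX bX.
set e := pc a0 + pr b0 - mu a0 b0 in ab.
have e0 : 0 < e.
  rewrite /e subr_gt0 lt_neqAle fe andbT eq_sym.
  by move: a0XW; rewrite inE => /orP[/XY|/WY] h; apply: h b0X.
pose pc' s := if s \in X :|: W then pc s - e else pc s.
pose pr' s := if s \in X then pr s + e else pr s.
have fe' : feasible pc' pr'.
  move=> s t; rewrite /pc' /pr'; have := fe s t; have := ab s t.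
  by case: (s \in X :|: W) => /=; case: (t \in X) => /= h; try lra; have := h isT isT; lra.
have same1 s t : s \in X :|: W -> t \in X -> touch pc' pr' s t = touch pc pr s t.
  by move=> sX tX; rewrite /touch /pc' /pr' sX tX addrAC addrA addrK addrC.
have same2 s t : s \notin X :|: W -> t \notin X -> touch pc' pr' s t = touch pc pr s t.
  by move=> /negPf sX /negPf tX; rewrite /touch /pc' /pr' sX tX.
have notXW s : s \notin X :|: W -> exists2 u, u \notin X & touch pc pr s u.
  rewrite inE inW negb_or negb_and negbK => /andP[sX].
  rewrite (negPf sX) /= => /forallPn[u]; rewrite negb_imply negbK => /andP[uX su].
  by exists u.
have colY t : t \notin X -> exists2 s, s \notin X :|: W & touch pc pr s t.
  move=> tX; have [s st] := sp.2 t; exists s => //; rewrite inE.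
  by apply: contraL st => /orP[/XY|/WY]; apply.
have rowW s : s \in W -> exists2 t, t \in X & touch pc pr s t.
  move=> sW; have [t st] := sp.1 s; exists t => //.
  by apply: contraLR st; apply: WY.
have XX s : s \in X -> touch pc' pr' s s.
  by move=> sX; rewrite same1 // ?in_setU ?sX // -inX.
have sp' : spanned pc' pr'.
  split=> s.
    case: (boolP (s \in X :|: W)) => [|sXW].
      rewrite inE => /orP[sX|sW]; first by exists s; apply: XX.
      by have [t tX st] := rowW s sW; exists t; rewrite same1 // in_setU sW orbT.
    by have [u uX su] := notXW s sXW; exists u; rewrite same2.
  case: (boolP (s \in X)) => [sX|sX]; first by exists s; apply: XX.
  by have [t tXW ts] := colY s sX; exists t; rewrite same2.
have X'XW s : s \notin X :|: W -> ~~ touch pc' pr' s s.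
  by move=> sXW; have := sXW; rewrite inE negb_or => /andP[sX _]; rewrite same2 // -inX.
have colA : column_anchored pc' pr'.
  case: (boolP (touch pc' pr' w0 w0)) => w0'.
    have [s sXW sw] := colY w0 (WX _ w0W).
    by exists s, w0; rewrite X'XW // w0' same2 // WX.
  have [t tX wt] := rowW w0 w0W.
  by exists w0, t; rewrite w0' XX // same1 // in_setU w0W orbT.
have [j clj] := clr b0.
have [z0 z0X _] := rowW w0 w0W.
have inXz s : s \in X -> pc s = pc z0 /\ pr s = - pc z0.
  move=> sX; have [] := @touch_zero _ _ mu dmu pc pr s z0 fe; rewrite -?inX //.
  move=> /eqP h1 h2; rewrite h2 in h1; move: sX z0X; rewrite !inX !(touch_refl dmu).
  by move=> /eqP h3 /eqP h4; split; lra.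
have XWz s : s \in X :|: W -> combination mu (pc s - pc z0).
  rewrite inE => /orP[/inXz[-> _]|sW]; first by rewrite subrr; apply: combination0.
  have [t /inXz[_ tz] /eqP st] := rowW s sW.
  by rewrite -tz st; apply: combination_mu.
(* All moved rows agree up to combinations, and [e] is chosen such that [a0] touches [b0]; so the
   lowered rows take over the class [j] of [b0]. *)
have low s : s \in X :|: W -> combination mu (pc s - e - x j).
  move=> sXW; have := combinationB (combinationD (combinationB (XWz s sXW) (XWz a0 a0XW))
    (combination_mu mu a0 b0)) clj.
  by congr combination; rewrite /e; ring.
have cl' : classified mu x pc' pr'.
  split=> s.
    rewrite /pc'; case: ifP => [/low h|_]; last exact: clc.
    by exists j.
  rewrite /pr'; case: ifP => [sX|_]; last exact: clr.
  exists j; have := combinationN (low z0 _); rewrite in_setU z0X => /(_ isT).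
  by rewrite (inXz s sX).2; congr combination; ring.
exists pc', pr'; split=> //; split.
- by move=> s /negPf; rewrite /pc' => ->.
- by move=> s /negPf; rewrite /pr' => ->.
have ab' : touch pc' pr' a0 b0.
  by rewrite /touch /pc' /pr' a0XW (negPf b0X) /e; apply/eqP; ring.
set X' := zero_set mu pc' pr'.
(* The zero set can only grow. If it does not, the new touch of [a0] and [b0] is a row anchor for
   [a0] in [X], and frees a stranded row otherwise. *)
have sXX' : X \subset X' by apply/subsetP => s /XX; rewrite inE.
case: (boolP (X' \subset X)) => [X'X|].
  have eqX : X' = X by apply/eqP; rewrite eqEsubset X'X.
  have inX' s : touch pc' pr' s s = (s \in X) by rewrite -eqX inE.
  have [a0X|a0W] := boolP (a0 \in X).
    by left; exists a0, b0; rewrite !inX' a0X b0X.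
  have {}a0W : a0 \in W by move: a0XW; rewrite inE (negPf a0W).
  right; rewrite /slide_measure -/X' eqX ltn_add2l; apply: proper_card.
  apply/properP; split; last first.
    exists a0 => //; rewrite inE inX' negb_and; apply/orP; right.
    by apply/forallPn; exists b0; rewrite negb_imply inX' b0X ab'.
  apply/subsetP => s; rewrite inE inX' => /andP[sX /forallP h].
  apply/negPn/negP => sW; have [|u uX su] := notXW s; first by rewrite in_setU negb_or sX.
  have := h u; rewrite inX' uX same2 ?su //.
  by rewrite in_setU negb_or sX.
move=> X'X; right.
have lt : (#|~: X'| < #|~: X|)%N.
  by apply: proper_card; rewrite properC; apply/properP; split=> //; apply/subsetPn.
have h1 : (#|stranded pc' pr'| <= #|S|)%N by apply: max_card.
rewrite /slide_measure -/X -/X'; apply: (@leq_trans ((#|~: X'|.+1) * #|S|.+1)).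
  by rewrite mulSn [leqRHS]addnC ltn_add2l ltnS.
by apply: leq_trans (leq_mul lt (leqnn _)) _; rewrite leq_addr.
Qed.

(** Sliding moves only stranded rows and the rows and columns of zero round trip. The last
    hypothesis keeps the fixed coordinates out of these sets at every stage. The process ends
    anchored on both sides, or in a degenerate set once no row is stranded. *)
Lemma slim_of_slides pc pr (x : 'I_3 -> R) (fixed_c fixed_r : pred S) :
  feasible pc pr -> spanned pc pr -> classified mu x pc pr ->
  column_anchored pc pr \/ (forall s, ~~ touch pc pr s s) ->
  (forall pc' pr', feasible pc' pr' -> {in fixed_c, pc' =1 pc} ->
    {in fixed_r, pr' =1 pr} ->
    (forall s, fixed_c s -> exists2 u, ~~ touch pc' pr' u u & touch pc' pr' s u) /\
    (forall s, fixed_c s || fixed_r s -> ~~ touch pc' pr' s s)) ->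
  exists pc' pr', [/\ feasible pc' pr', spanned pc' pr', classified mu x pc' pr',
    slim_shape mu pc' pr' & {in fixed_c, pc' =1 pc} /\ {in fixed_r, pr' =1 pr}].
Proof.
move=> fe sp cl anch fixP.
have [n] := ubnP (slide_measure pc pr); elim: n pc pr fe sp cl anch fixP => // n IH.
move=> pc pr fe sp cl anch fixP lt.
have [ra|nra] := boolp.pselect (row_anchored pc pr).
  exists pc, pr; split=> //; apply: Or31; split=> //.
  case: anch => // h; have [z [u [zz _ _]]] := ra.
  by case/negP: (h z).
have rowD z u : touch pc pr z z -> ~~ touch pc pr u u -> ~~ touch pc pr z u.
  by move=> zz uu; apply/negP => zu; apply: nra; exists z, u.
have [no|[w0 w0W]] := set_0Vmem (stranded pc pr).
  exists pc, pr; split=> //; apply: Or32; split=> // w ww.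
  have : w \notin stranded pc pr by rewrite no inE.
  rewrite inE ww /= => /forallPn[u]; rewrite negb_imply negbK => /andP[uu wu].
  by exists u.
have [pc1 [pr1 [fe1 sp1 cl1 ca1 [fc1 fr1 dec]]]] := slide fe sp cl nra w0W.
have [fixP1 fixP2] := fixP pc pr fe (fun _ _ => erefl) (fun _ _ => erefl).
have f1 : {in fixed_c, pc1 =1 pc}.
  move=> s sf; apply: fc1; rewrite !inE negb_or negb_and negbK fixP2 ?[fixed_c s]sf //=.
  have [u uu su] := fixP1 s sf; apply/orP; right; apply/forallPn; exists u.
  by rewrite uu negbK.
have f2 : {in fixed_r, pr1 =1 pr}.
  by move=> s sf; apply: fr1; rewrite inE fixP2 // [fixed_r s]sf orbT.
have fin (pc2 pr2 : S -> R) : {in fixed_c, pc2 =1 pc1} -> {in fixed_r, pr2 =1 pr1} ->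
    {in fixed_c, pc2 =1 pc} /\ {in fixed_r, pr2 =1 pr}.
  by move=> h1 h2; split=> s sf; rewrite ?h1 ?h2 ?f1 ?f2.
case: dec => [ra1|lt1].
  by exists pc1, pr1; split=> //; apply: Or31.
have [|pc2 [pr2 [fe2 sp2 cl2 sl2 [h1 h2]]]] :=
    IH pc1 pr1 fe1 sp1 cl1 (or_introl ca1) _ (leq_trans lt1 lt).
  by move=> pc2 pr2 fe2 h1 h2; have [h1' h2'] := fin _ _ h1 h2; apply: fixP.
by exists pc2, pr2; split=> //; apply: fin.
Qed.

End Slide.

(** * Tropically nonsingular submatrices *)

Section Minors.
Variables (R : realType) (S : finType).

(* A 3x3 tropically nonsingular submatrix of [mu], with a dual solution [x], all
   of whose row and column terminals are certified to have a positive round trip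
   at every extension of [x]. *)
Definition minor (mu : S -> S -> R) (m : R) (y u : 'I_3 -> S) (x : 'I_3 -> R) : Prop :=
  [/\ forall i j, i != j -> mu (y i) (u j) + m < x i + (mu (y j) (u j) - x j),
      forall i, exists k, x k + m < x i + mu (y k) (y i) &
      forall j, let p := mu (y j) (u j) - x j in
        (exists k, mu (y k) (u k) - x k + m < p + mu (u j) (u k)) \/
        (exists i, forall k, mu (y k) (y i) - x k + m < p + mu (u j) (y i))].

Definition minor_free (mu : S -> S -> R) : Prop := forall y u x, ~ minor mu 0 y u x.

Variable mu : S -> S -> R.

Lemma minor_margin y u x : minor mu 0 y u x -> exists m, 0 < m /\ minor mu m y u x.
Proof.
have split_lt (a b : R) : a + 0 < b -> exists m, 0 < m /\ a + m < b.
  by move=> ab; exists ((b - a) / 2); split; lra.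
have anti (a b m m' : R) : m' <= m -> a + m < b -> a + m' < b by lra.
case=> h1 h2 h3.
have [m1 [m1_0 H1]] : exists m, 0 < m /\ forall ij : 'I_3 * 'I_3, ij.1 != ij.2 ->
    mu (y ij.1) (u ij.2) + m < x ij.1 + (mu (y ij.2) (u ij.2) - x ij.2).
  apply: (uniform_margin (Q := fun (ij : 'I_3 * 'I_3) m => ij.1 != ij.2 ->
    mu (y ij.1) (u ij.2) + m < x ij.1 + (mu (y ij.2) (u ij.2) - x ij.2))).
    by move=> i m m' _ mm h /h; apply: anti.
  move=> [i j] /=; case: (eqVneq i j) => [_|/h1/split_lt[m [m0 hm]]].
    by exists 1; split.
  by exists m.
have [m2 [m2_0 H2]] : exists m, 0 < m /\ forall i, exists k, x k + m < x i + mu (y k) (y i).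
  apply: (uniform_margin (Q := fun i m => exists k, x k + m < x i + mu (y k) (y i))).
    by move=> i m m' _ mm [k h]; exists k; apply: anti h.
  by move=> i; have [k /split_lt[m [m0 hm]]] := h2 i; exists m; split=> //; exists k.
have [m3 [m3_0 H3]] : exists m, 0 < m /\ forall j,
    (exists k, mu (y k) (u k) - x k + m < mu (y j) (u j) - x j + mu (u j) (u k)) \/
    (exists i, forall k, mu (y k) (y i) - x k + m < mu (y j) (u j) - x j + mu (u j) (y i)).
  apply: (uniform_margin (Q := fun j m =>
    (exists k, mu (y k) (u k) - x k + m < mu (y j) (u j) - x j + mu (u j) (u k)) \/
    (exists i, forall k, mu (y k) (y i) - x k + m < mu (y j) (u j) - x j + mu (u j) (y i)))).
    by move=> i m m' _ mm [[k h]|[k h]]; [left|right]; exists k;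
      [apply: anti h|move=> l; apply: anti (h l)].
  move=> j; case: (h3 j) => [[k /split_lt[m [m0 hm]]]|[i hi]].
    by exists m; split=> //; left; exists k.
  have [m [m0 hm]] : exists m, 0 < m /\ forall k,
      mu (y k) (y i) - x k + m < mu (y j) (u j) - x j + mu (u j) (y i).
    apply: (uniform_margin (Q := fun k m =>
      mu (y k) (y i) - x k + m < mu (y j) (u j) - x j + mu (u j) (y i))).
      by move=> k m m' _ mm; apply: anti.
    by move=> k; apply: split_lt.
  by exists m; split=> //; right; exists i.
exists (Num.min m1 (Num.min m2 m3)).
have le1 : Num.min m1 (Num.min m2 m3) <= m1 by rewrite ge_min lexx.
have le2 : Num.min m1 (Num.min m2 m3) <= m2 by rewrite !ge_min lexx orbT.
have le3 : Num.min m1 (Num.min m2 m3) <= m3 by rewrite !ge_min lexx !orbT.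
split; first by rewrite !lt_min m1_0 m2_0.
split=> [i j ij|i|j].
- by apply: anti le1 _; apply: (H1 (i, j)).
- by have [k h] := H2 i; exists k; apply: anti le2 h.
- by case: (H3 j) => [[k h]|[k h]]; [left|right]; exists k;
    [apply: anti le3 h|move=> l; apply: anti le3 (h l)].
Qed.

Lemma minor_shift m y u x e : 0 <= e -> 2 * e <= m -> minor mu m y u x ->
  minor mu 0 y u (shifted x e).
Proof.
move=> e0 em [h1 h2 h3].
have bd (i : 'I_3) : 0 <= (val i)%:R * e <= m.
  by case: i => -[|[|[|//]]] /= _; apply/andP; split; lra.
rewrite /shifted; split=> [i j /h1|i|j].
- by have /andP[] := bd i; have /andP[] := bd j; lra.
- have [k hk] := h2 i; exists k; move: hk; have /andP[] := bd i; have /andP[] := bd k.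
  by lra.
- case: (h3 j) => [[k hk]|[i hi]]; [left; exists k|right; exists i => k; have hk := hi k];
    by move: hk; have /andP[] := bd j; have /andP[] := bd k; lra.
Qed.

Hypothesis dmu : directed_distance mu.

(** Feasibility turns the certificates into lower bounds for round trips. They involve only the rows
    [y] and the columns [u] and [y], where a column [y i] keeps the maximum assigned by the
    extension; so they survive the slides. *)
Theorem minor_free_of_no_three_classes : no_three_classes mu -> minor_free mu.
Proof.
move=> nthree y u x0 /minor_margin[m [m0 mn]].
have [e [/andP[e0 em] ind]] : exists e, 0 < e < m / 2 /\ independent mu (shifted x0 e).
  by apply: independent_shift; lra.
have {mn} [] : minor mu 0 y u (shifted x0 e) by apply: minor_shift mn; lra.
move: (shifted x0 e) ind => x ind h1 h2 h3.
have [|pc [pr [fe sp pcy prP pcP]]] := @top_extension _ _ mu y x.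
  move=> j; exists (u j) => i; case: (eqVneq i j) => [->//|/h1]; lra.
have pru j : pr (u j) = mu (y j) (u j) - x j.
  have [k ek] := prP (u j); case: (eqVneq k j) => [kj|/h1]; first by rewrite ek kj.
  by have := fe (y j) (u j); rewrite pcy; lra.
have prU i v : (forall k, mu (y k) (y i) - x k < v) -> pr (y i) < v.
  by have [k ->] := prP (y i).
have pos pc' pr' : feasible mu pc' pr' -> (forall i, pc' (y i) = x i) ->
    (forall j, pr' (u j) = pr (u j)) -> (forall i, pr' (y i) = pr (y i)) ->
    (forall i, ~~ touch mu pc' pr' (y i) (y i)) /\
    (forall i, ~~ touch mu pc' pr' (u i) (u i)).
  move=> fe' py pu puy; split=> i; rewrite touch_refl //; apply/negP => /eqP.
    have [k hk] := h2 i; have := fe' (y k) (y i); rewrite !py; lra.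
  rewrite pu pru; case: (h3 i) => [[k hk]|[k hk]].
    by have := fe' (u i) (u k); rewrite pu pru; lra.
  have lt : pr (y k) < mu (y i) (u i) - x i + mu (u i) (y k).
    by apply: prU => l; have := hk l; lra.
  by have := fe' (u i) (y k); rewrite puy; lra.
have [posy posu] := pos pc pr fe pcy (fun=> erefl) (fun=> erefl).
pose fc := [pred s | [exists i, s == y i]].
pose fr := [pred s | [exists i, (s == y i) || (s == u i)]].
have fcy i : y i \in fc by apply/existsP; exists i.
have fry i : y i \in fr by apply/existsP; exists i; rewrite eqxx.
have fru i : u i \in fr by apply/existsP; exists i; rewrite eqxx orbT.
have [|||pc' [pr' [fe' sp' cl' sl' [agc agr]]]] :=
    @slim_of_slides _ _ mu dmu pc pr x fc fr fe sp.
- exact: top_extension_classified prP pcP.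
- case: (boolP [exists s, touch mu pc pr s s]) => [/existsP[s ss]|/existsPn no]; last by right.
  left; have [i ei] := prP s; exists (y i), s; split=> //.
  by rewrite /touch pcy ei; apply/eqP; ring.
- move=> pc' pr' fe' agc agr.
  have [posy' posu'] := pos pc' pr' fe' (fun i => etrans (agc _ (fcy i)) (pcy i))
    (fun j => agr _ (fru j)) (fun j => agr _ (fry j)).
  split=> [s /existsP[i /eqP ->]|s /orP[/existsP[i /eqP ->]//|/existsP[i]]].
    exists (u i) => //; rewrite /touch agc // agr // pcy pru; apply/eqP; ring.
  by case/orP => /eqP ->.
have /boolp.choice[cc ccP] := cl'.1; have /boolp.choice[cr crP] := cl'.2.
apply: (nthree pc' pr' cc cr fe' sp' sl'); split.
  exact: classified_touch ind ccP crP.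
have [posy' _] := pos pc' pr' fe' (fun i => etrans (agc _ (fcy i)) (pcy i))
  (fun j => agr _ (fru j)) (fun j => agr _ (fry j)).
move=> i; exists (y i); split=> //; left; apply: ind.
by have := combinationN (ccP (y i)); rewrite agc // pcy; congr combination; ring.
Qed.

End Minors.

Definition of3 (T : Type) (a b c : T) (i : 'I_3) : T :=
  match val i with 0%N => a | 1%N => b | _ => c end.

Lemma forall3 (Q : 'I_3 -> Prop) :
  Q (@Ordinal 3 0 isT) -> Q (@Ordinal 3 1 isT) -> Q (@Ordinal 3 2 isT) ->
  forall i, Q i.
Proof.
move=> h0 h1 h2 [[|[|[|//]]] lti]; [move: h0|move: h1|move: h2];
  by congr Q; apply: val_inj.
Qed.

(** * Proper terminals *)

Section ProperTerminals.
Variables (R : realType) (S : finType) (mu : S -> S -> R).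
Hypothesis dmu : directed_distance mu.

(** Rows [s, r, z] dominating in columns [s, z, r] extend to a point with [p(s^c) = p(s^r) = 0]. As
    [s] is proper the point is no fat, hence anchored on both sides. The row anchor supplies the
    terminal of positive round trip in the class of [s]. *)
Lemma proper_terminal_one_way s r z : no_three_classes mu -> proper_terminal mu s ->
  mu r s + mu s z < mu r z -> mu z s + mu s r < mu z r -> False.
Proof.
move=> nthree prs h1 h2.
have [mu0 muss] := dmu.
pose n1 := mu r z - (mu r s + mu s z); pose n2 := mu z r - (mu z s + mu s r).
pose y := of3 s r z; pose u := of3 s z r.
(* Half of each gain keeps all the maxima strict; an eighth of the smaller one leaves room for the
   shifts [e] and [2 * e]. *)
pose x0 := of3 0 (mu r s + n1 / 2) (mu z s + n2 / 2).
have [e [/andP[e0 em] ind]] : exists e, 0 < e < Num.min n1 n2 / 8 /\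
    independent mu (shifted x0 e).
  by apply: independent_shift; rewrite divr_gt0 // lt_min /n1 /n2 !subr_gt0 h1 h2.
have /andP[en1 en2] : (e * 8 < n1) && (e * 8 < n2).
  by rewrite -lt_min -ltr_pdivlMr.
pose x := shifted x0 e.
have xE : [/\ x (@Ordinal 3 0 isT) = 0, x (@Ordinal 3 1 isT) = mu r s + n1 / 2 + e &
    x (@Ordinal 3 2 isT) = mu z s + n2 / 2 + 2 * e].
  by rewrite /x /shifted /x0 /of3 /=; split; ring.
have [x_0 x_1 x_2] := xE.
have m1 := mu0 r s; have m2 := mu0 s z; have m3 := mu0 z s; have m4 := mu0 s r.
have m5 := muss s; have m6 := muss r; have m7 := muss z.
have [|pc [pr [fe sp pcy prP pcP]]] := @top_extension _ _ mu y x.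
  apply: forall3; [exists s|exists z|exists r]; apply: forall3;
    rewrite ?x_0 ?x_1 ?x_2 /y /u /of3 /=; move: en1 en2; rewrite /n1 /n2; lra.
have pcs : pc s = 0 by have := pcy (@Ordinal 3 0 isT); rewrite -/x x_0.
have pcr : pc r = mu r s + n1 / 2 + e by have := pcy (@Ordinal 3 1 isT); rewrite -/x x_1.
have pcz : pc z = mu z s + n2 / 2 + 2 * e.
  by have := pcy (@Ordinal 3 2 isT); rewrite -/x x_2.
have prs0 : pr s = 0.
  apply/eqP; rewrite eq_le; apply/andP; split; last by have := fe s s; lra.
  have [i ->] := prP s; move: i; apply: forall3;
    rewrite ?x_0 ?x_1 ?x_2 /y /of3 /=; move: en1 en2; rewrite /n1 /n2; lra.
have ss : touch mu pc pr s s by rewrite touch_refl // pcs prs0 addr0.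
have rr : ~~ touch mu pc pr r r.
  rewrite touch_refl //; apply/negP => /eqP; have := fe s r; lra.
have zz : ~~ touch mu pc pr z z.
  rewrite touch_refl //; apply/negP => /eqP; have := fe s z; lra.
have atX : Q_at mu (zero_set mu pc pr) (glue pc pr).
  by split=> [|w]; [exact: glue_Q|rewrite K_glue inE].
have nofat : ~ fat mu (zero_set mu pc pr) (glue pc pr).
  apply: prs; [exact: zero_on_zero_set|exact: glue_Q|].
  by rewrite !glueE pcs prs0 addr0.
have ra : row_anchored mu pc pr.
  apply: boolp.contrapT => no; apply: nofat; split=> //; right.
  apply/subsetP => -[w|w]; rewrite nbrs_copyr // copyE !inE.
  case/exists_inP => v; rewrite inE inE => vv wv; apply/negP => ww; apply: no.
  by exists w, v.
have ca : column_anchored mu pc pr.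
  apply: boolp.contrapT => no; apply: nofat; split=> //; left.
  apply/subsetP => -[w|w]; rewrite nbrs_copyc // copyE !inE.
  case/exists_inP => v; rewrite inE inE => vv vw; apply/negP => ww; apply: no.
  by exists v, w.
have [clc clr] := top_extension_classified prP pcP.
have /boolp.choice[cc ccP] := clc; have /boolp.choice[cr crP] := clr.
have same := classified_touch ind ccP crP.
have ccy i : cc (y i) = i.
  apply: ind; have := combinationN (ccP (y i)); rewrite pcy /x; congr combination; ring.
apply: (nthree pc pr cc cr fe sp _ _); first exact: Or31.
split=> // i; move: i; apply: forall3; [|exists r; split=> //|exists z; split=> //].
- have [a [b [aa bb ab]]] := ra; exists b; split=> //; right.
  have [sa _] := touch_zero dmu fe ss aa.
  by rewrite -(same _ _ ab) (same _ _ aa) -(same _ _ sa) -(ccy (@Ordinal 3 0 isT)).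
- by left; rewrite -[in RHS](ccy (@Ordinal 3 1 isT)).
- by left; rewrite -[in RHS](ccy (@Ordinal 3 2 isT)).
Qed.
End ProperTerminals.

Lemma small2 (R : realType) (a b : R) : 0 < a -> 0 < b ->
  exists e, [/\ 0 < e, e < a & e < b].
Proof.
move=> a0 b0; exists (Num.min a b / 2); have m0 : 0 < Num.min a b by rewrite lt_min a0.
have : Num.min a b / 2 < Num.min a b by lra.
by rewrite lt_min => /andP[? ?]; split=> //; lra.
Qed.

Lemma small3 (R : realType) (a b c : R) : 0 < a -> 0 < b -> 0 < c ->
  exists e, [/\ 0 < e, e < a, e < b & e < c].
Proof.
move=> a0 b0 c0; have [e [e0 ea eb]] := small2 a0 b0.
by have [f [f0 fe fc]] := small2 e0 c0; exists f; split=> //; lra.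
Qed.

(** * Inequalities on few terminals forced by the absence of minors *)

Section Laws.
Variables (R : realType) (S : finType) (mu : S -> S -> R).

Definition certified (p1 p2 p3 : R) (y1 y2 y3 : S) (x1 x2 x3 : R) (u1 u2 u3 : S) : Prop :=
  let bypass v := [/\ mu y1 v - x1 < p1 + mu u1 v, mu y2 v - x2 < p1 + mu u1 v &
    mu y3 v - x3 < p1 + mu u1 v] in
  [\/ p2 < p1 + mu u1 u2, p3 < p1 + mu u1 u3 |
      [\/ bypass y1, bypass y2 | bypass y3]].

Lemma minor_free3 (y1 y2 y3 u1 u2 u3 : S) (x1 x2 x3 : R) (p1 := mu y1 u1 - x1)
    (p2 := mu y2 u2 - x2) (p3 := mu y3 u3 - x3) : minor_free mu ->
  [/\ mu y1 u2 < x1 + p2, mu y1 u3 < x1 + p3, mu y2 u1 < x2 + p1 &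
    [/\ mu y2 u3 < x2 + p3, mu y3 u1 < x3 + p1 & mu y3 u2 < x3 + p2]] /\
  [/\ x2 < x1 + mu y2 y1 \/ x3 < x1 + mu y3 y1,
      x1 < x2 + mu y1 y2 \/ x3 < x2 + mu y3 y2 &
      x1 < x3 + mu y1 y3 \/ x2 < x3 + mu y2 y3] /\
  [/\ certified p1 p2 p3 y1 y2 y3 x1 x2 x3 u1 u2 u3,
      certified p2 p1 p3 y1 y2 y3 x1 x2 x3 u2 u1 u3 &
      certified p3 p1 p2 y1 y2 y3 x1 x2 x3 u3 u1 u2] -> False.
Proof.
move=> mf [[c12 c13 c21 [c23 c31 c32]] [[r1 r2 r3] [k1 k2 k3]]].
apply: (mf (of3 y1 y2 y3) (of3 u1 u2 u3) (of3 x1 x2 x3)).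
set o0 := @Ordinal 3 0 isT; set o1 := @Ordinal 3 1 isT; set o2 := @Ordinal 3 2 isT.
split.
- apply: forall3; apply: forall3; rewrite /of3 /= ?addr0 //; lra.
- apply: forall3; rewrite /of3 /=.
  + by case: r1 => h; [exists o1|exists o2]; rewrite /= addr0.
  + by case: r2 => h; [exists o0|exists o2]; rewrite /= addr0.
  + by case: r3 => h; [exists o0|exists o1]; rewrite /= addr0.
- apply: forall3; rewrite /of3 /=.
  + case: k1 => [h|h|[] [h1 h2 h3]];
      [left; exists o1|left; exists o2|right; exists o0|right; exists o1|right; exists o2];
      rewrite /= ?addr0 //; apply: forall3; rewrite /= addr0 //.
  + case: k2 => [h|h|[] [h1 h2 h3]];
      [left; exists o0|left; exists o2|right; exists o0|right; exists o1|right; exists o2];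
      rewrite /= ?addr0 //; apply: forall3; rewrite /= addr0 //.
  + case: k3 => [h|h|[] [h1 h2 h3]];
      [left; exists o0|left; exists o1|right; exists o0|right; exists o1|right; exists o2];
      rewrite /= ?addr0 //; apply: forall3; rewrite /= addr0 //.
Qed.

Hypothesis dmu : directed_distance mu.
Hypothesis mf : minor_free mu.

Let mu0 s t : 0 <= mu s t. Proof. by have [+ _] := dmu; apply. Qed.
Let mus s : mu s s = 0. Proof. by have [_ +] := dmu; apply. Qed.

Ltac facts2 a b := have := mu0 a b; have := mu0 b a; have := mus a; have := mus b.
Ltac facts3 a b c := facts2 a b; facts2 b c; have := mu0 a c; have := mu0 c a.
Ltac facts4 a b c d := facts3 a b c; facts2 a d; facts2 b d; have := mu0 c d; have := mu0 d c.
Ltac cert := solve [apply: Or31; lra | apply: Or32; lra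
  | apply: Or33; apply: Or31; split; lra
  | apply: Or33; apply: Or32; split; lra
  | apply: Or33; apply: Or33; split; lra].
Ltac minor_tac := split; [split; [lra|lra|lra|split; lra] |
  split; [split; solve [left; lra|right; lra] | split; cert]].

(** In a tree with directed lengths the extra cost of a detour via [s] is the round trip along a
    branch, the same for [a -> b] and [b -> a]. *)
Lemma detour_excess (a b s : S) :
  0 < mu a s + mu s b - mu a b -> mu b s + mu s a - mu b a < mu a s + mu s b - mu a b ->
  0 < mu a b + mu b a -> mu b s < mu b a + mu a s -> mu s a < mu s b + mu b a -> False.
Proof.
move=> h1 h2 h3 h4 h5.
(* The entries are [x] for row [a], 0 for row [b], and for row [s] the one that sets column [b] at
   [e] above the demand of row [a]. Strictness of the minor leaves an open interval for [x]. *)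
have [x [lo1 lo2 hi1 hi2]] : exists x, [/\ mu s a - mu b a + mu a b - mu s b < x,
    - mu b a < x, x < mu a s - mu b s & x < mu a b].
  pose lo := Num.max (mu s a - mu b a + mu a b - mu s b) (- mu b a).
  pose hi := Num.min (mu a s - mu b s) (mu a b).
  have lohi : lo < hi.
    by rewrite /lo /hi gt_max !lt_min; apply/andP; split; apply/andP; split; lra.
  exists ((lo + hi) / 2).
  have : lo < (lo + hi) / 2 by lra.
  have : (lo + hi) / 2 < hi by lra.
  by rewrite {2}/hi lt_min {3}/lo gt_max => /andP[? ?] /andP[? ?].
have [e [e0 e1 e2]] : exists e, [/\ 0 < e, e < mu a s + mu s b - mu a b &
    e < x - (mu s a - mu b a + mu a b - mu s b)].
  pose m := Num.min (mu a s + mu s b - mu a b) (x - (mu s a - mu b a + mu a b - mu s b)).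
  have m0 : 0 < m by rewrite /m lt_min; apply/andP; split; lra.
  exists (m / 2); have : m / 2 < m by lra.
  by rewrite {2}/m lt_min => /andP[? ?]; split=> //; lra.
facts3 a b s => *.
apply: (@minor_free3 a b s s a b x 0 (mu s b - mu a b + x - e) mf); minor_tac.
Qed.
(** The degenerate case of [through_sym], a zero round trip between the two ends, which
    [detour_excess] does not cover. *)
Lemma disjoint_detours (r t u : S) : mu t r = 0 -> mu r u = 0 -> mu t u = 0 ->
  mu u t = 0 -> 0 < mu r t -> 0 < mu u r -> False.
Proof.
move=> h1 h2 h3 h4 h5 h6; have [e [e0 e1 e2]] := small2 h5 h6.
facts3 r t u => *.
apply: (@minor_free3 r u t t r u e e 0 mf); minor_tac.
Qed.

Lemma through_sym (r y u : S) : 0 < mu y r + mu r y -> 0 < mu u r + mu r u ->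
  mu y r + mu r u <= mu y u -> mu u r + mu r y <= mu u y.
Proof.
move=> yr ur h; rewrite leNgt; apply/negP => h'.
have [d0|d0] := ltP 0 (mu u y + mu y u).
  by facts3 r y u => *; apply: (@detour_excess u y r); lra.
facts3 r y u => *.
by apply: (@disjoint_detours r y u); lra.
Qed.

(** In a tree, if [r] lies between [y] and [u], then [t] is beyond [r] as seen from one of them. *)
Lemma no_branch_at_passage (r t y u : S) : 0 < mu y r + mu r y -> 0 < mu u r + mu r u ->
  0 < mu t r + mu r t -> mu y r + mu r u <= mu y u -> mu u r + mu r y <= mu u y ->
  mu y t < mu y r + mu r t -> mu u t < mu u r + mu r t -> False.
Proof.
move=> yr ur tr h1 h2 h3 h4.
have [e [e0 e1 e2 e3]] : exists e, [/\ 0 < e, e < mu y r + mu r t - mu y t,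
    e < mu u r + mu r t - mu u t & e < Num.min (mu y r + mu r y) (Num.min
      (mu u r + mu r u) (mu t r + mu r t))].
  by apply: small3; rewrite ?lt_min ?subr_gt0 ?h3 ?h4 ?yr ?ur ?tr.
move: e3; rewrite !lt_min => /and3P[e3 e4 e5].
facts4 r t y u => *.
apply: (@minor_free3 y u r u y t (mu y r) (mu u r) e mf); minor_tac.
Qed.

(** This and the next two laws concern terminals at distance zero from and to [r]. These need not be
    twins of [r], since their distances to the rest may differ. *)
Lemma no_gap_at_zero (r t y u : S) : mu y r = 0 -> mu r y = 0 ->
  0 < mu t r + mu r t -> mu r u < mu y u -> mu y t <= mu r t ->
  mu t u < mu t r + mu y u -> False.
Proof.
move=> yr ry tr h1 h2 h3.
have [x [x0 x1 x2 x3]] : exists x, [/\ 0 < x, x < mu y u - mu r u,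
    x < mu t r + mu y u - mu t u & x < mu t r + mu r t].
  by apply: small3; rewrite ?subr_gt0.
facts4 r t y u => *.
apply: (@minor_free3 y r t u t r x (x / 2) (mu t r) mf); minor_tac.
Qed.

Lemma zero_pair_split (r y u u' v : S) : mu y r = 0 -> mu r y = 0 ->
  mu y u = mu r u -> mu u' y = mu u' r -> mu y v < mu r v ->
  0 < mu u r + mu r u -> 0 < mu u' r + mu r u' ->
  mu u' u < mu u' r + mu r u -> mu u' v < mu u' r + mu r v -> False.
Proof.
move=> yr ry h1 h2 h3 d1 d2 h4 h5.
have [e [e0 e1 e2 e3]] : exists e, [/\ 0 < e, e < mu r v - mu y v,
   e < Num.min (mu u r + mu r u) (mu u' r + mu r u')  &
   e < Num.min (mu u' r + mu r u - mu u' u) (mu u' r + mu r v - mu u' v)].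
  by apply: small3; rewrite ?lt_min ?subr_gt0 ?h3 ?h4 ?h5 ?d1 ?d2.
move: e2 e3; rewrite !lt_min => /andP[e2 e3] /andP[e4 e5].
facts4 r y u u' => *; facts2 r v => *; facts2 y v => *; facts2 u' v => *.
apply: (@minor_free3 r y u' v u r e (e / 2) (mu u' r) mf); minor_tac.
Qed.

Lemma zero_pairs_cross (r y y' u u' : S) : mu y r = 0 -> mu r y = 0 ->
  mu y' r = 0 -> mu r y' = 0 -> mu y y' = 0 -> mu y' y = 0 ->
  mu y u = mu r u -> mu u' y' = mu u' r ->
  mu u' y < mu u' r -> mu y' u < mu r u -> mu u' u < mu u' r + mu r u -> False.
Proof.
move=> yr ry y'r ry' yy' y'y h1 h2 h3 h4 h5.
have [e [e0 e1 e2 e3]] : exists e, [/\ 0 < e, e < mu u' r - mu u' y,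
    e < mu r u - mu y' u & e < (mu u' r + mu r u - mu u' u) / 2].
  by apply: small3; lra.
facts4 r y u u' => *; facts2 y' u => *; facts2 u' y' => *.
apply: (@minor_free3 y u' y' u y' y e (mu u' r - e) 0 mf); minor_tac.
Qed.
End Laws.

(** * Decomposition into cuts by peeling leaves *)

Section Leaves.
Variables (R : realType) (S : finType).
Implicit Types mu : S -> S -> R.

Definition transpose mu : S -> S -> R := fun s t => mu t s.

Lemma directed_distance_transpose mu : directed_distance mu -> directed_distance (transpose mu).
Proof. by case=> h1 h2; split=> [s t|s]; [apply: h1|apply: h2]. Qed.

Lemma no_three_classes_transpose mu : no_three_classes mu -> no_three_classes (transpose mu).
Proof.
move=> h pc pr cc cr fe [sp1 sp2] sl [cl1 cl2].
have T s t : touch mu pr pc s t = touch (transpose mu) pc pr t s.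
  by rewrite /touch addrC.
apply: (h pr pc cr cc).
- by move=> s t; rewrite addrC; apply: fe.
- by split=> s; [have [t st] := sp2 s|have [t st] := sp1 s]; exists t; rewrite T.
- case: sl => -[h1 h2]; [apply: Or31|apply: Or33|apply: Or32]; split.
  + by have [w [x [ww xx wx]]] := h2; exists x, w; rewrite !T.
  + by have [x [u [xx uu xu]]] := h1; exists u, x; rewrite !T.
  + by move=> w x ww xx; rewrite !T in ww xx *; apply: h1.
  + by move=> u; rewrite T => /h2[w ww wu]; exists w; rewrite T.
  + by move=> x u xx uu; rewrite !T in xx uu *; apply: h1.
  + by move=> w; rewrite T => /h2[u uu wu]; exists u; rewrite T.
- split=> [s t|i]; first by rewrite T => /cl1.
  by have [s [ss h']] := cl2 i; exists s; rewrite T; split=> //; apply/or_comm.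
Qed.

Definition farthest mu (r t : S) : Prop :=
  (forall a b, mu a b + mu b a <= mu r t + mu t r) /\ 0 < mu r t + mu t r.

Lemma farthest_transpose mu r t : farthest mu r t -> farthest (transpose mu) r t.
Proof.
case=> h1 h2; split=> [a b|]; rewrite /transpose.
  by rewrite [leLHS]addrC [leRHS]addrC.
by rewrite addrC.
Qed.

(** A passage between [u] and [t] through [r] would be two-way and beat the maximal round trip. So
    [t] branches off before [r] from everywhere, and a passage between [y] and [u] contradicts
    [no_branch_at_passage]. *)
Lemma farthest_detour mu r t : directed_distance mu -> minor_free mu -> farthest mu r t ->
  forall y u, 0 < mu y r + mu r y -> 0 < mu u r + mu r u -> mu y u < mu y r + mu r u.
Proof.
move=> dmu mf [maxd d0].
have tr : 0 < mu t r + mu r t by rewrite addrC.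
have toT u : 0 < mu u r + mu r u -> mu u t < mu u r + mu r t.
  move=> ur; rewrite ltNge; apply/negP => h.
  have h' := through_sym dmu mf ur tr h.
  have := maxd u t; lra.
move=> y u yr ur; rewrite ltNge; apply/negP => h.
have h' := through_sym dmu mf yr ur h.
exact: (no_branch_at_passage dmu mf yr ur tr h h' (toT y yr) (toT u ur)).
Qed.

Lemma farthest_zero_to mu r t y : directed_distance mu -> minor_free mu ->
  farthest mu r t -> mu y r = 0 -> mu r y = 0 -> mu y t <= mu r t.
Proof.
move=> dmu mf [maxd d0] yr ry; rewrite leNgt; apply/negP => h.
have h1 := maxd y t; have [h2 _] := dmu; have h3 := h2 t y; have h4 := h2 t r.
have h5 := h2 r t.
by apply: (detour_excess dmu mf (a := t) (b := y) (s := r)); lra.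
Qed.

Lemma farthest_zero mu r t y : directed_distance mu -> minor_free mu ->
  minor_free (transpose mu) -> farthest mu r t -> mu y r = 0 -> mu r y = 0 ->
  forall u, mu y u <= mu r u.
Proof.
move=> dmu mf mfT far yr ry u; rewrite leNgt; apply/negP => h.
have [maxd d0] := far.
have tr : 0 < mu t r + mu r t by rewrite addrC.
have yt := farthest_zero_to dmu mf far yr ry.
apply: (no_gap_at_zero dmu mf yr ry tr h yt).
have [h2 _] := dmu; have ur := h2 u r; have ru := h2 r u.
have [u0|u0] := ltP 0 (mu u r + mu r u).
  by have := farthest_detour dmu mf far tr u0; lra.
have ur0 : mu u r = 0 by lra.
have ru0 : mu r u = 0 by lra.
have := farthest_zero_to (directed_distance_transpose dmu) mfT
  (farthest_transpose far) ru0 ur0.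
by rewrite /transpose; lra.
Qed.

Definition twin mu (r y : S) : bool := [forall v, (mu y v == mu r v) && (mu v y == mu v r)].

Lemma twinP mu r y : reflect (forall v, mu y v = mu r v /\ mu v y = mu v r) (twin mu r y).
Proof.
apply: (iffP forallP) => h v; have := h v.
  by case/andP => /eqP -> /eqP ->.
by case=> -> ->; rewrite !eqxx.
Qed.

(* At a leaf [r] only finitely many things bound the length that can be cut off
   its pendant edge in each direction; not both bounds vanish. *)
Lemma farthest_open mu r t y y' u u' : directed_distance mu -> minor_free mu ->
  minor_free (transpose mu) -> farthest mu r t ->
  0 < mu u r + mu r u -> 0 < mu u' r + mu r u' ->
  mu r u = 0 \/ [/\ mu y r = 0, mu r y = 0, ~~ twin mu r y & mu y u = mu r u] ->
  mu u' r = 0 \/ [/\ mu y' r = 0, mu r y' = 0, ~~ twin mu r y' & mu u' y' = mu u' r] ->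
  False.
Proof.
move=> dmu mf mfT far ur u'r.
have farT := farthest_transpose far; have dmuT := directed_distance_transpose dmu.
have [mu0 _] := dmu.
have det a b : 0 < mu a r + mu r a -> 0 < mu b r + mu r b -> mu a b < mu a r + mu r b.
  exact: farthest_detour dmu mf far a b.
have le1 z : mu z r = 0 -> mu r z = 0 -> forall v, mu z v <= mu r v.
  exact: farthest_zero dmu mf mfT far.
have le2 z : mu z r = 0 -> mu r z = 0 -> forall v, mu v z <= mu v r.
  move=> zr rz v; apply: (@farthest_zero (transpose mu) r t z dmuT mfT _ farT) => //.
have same z : mu z r = 0 -> mu r z = 0 -> ~~ twin mu r z ->
    mu z u = mu r u -> mu u' z = mu u' r -> False.
  move=> zr rz /forallPn[v]; rewrite negb_and => /orP[] ne h1 h2.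
    have lt : mu z v < mu r v by rewrite lt_neqAle ne le1.
    have vr : 0 < mu v r + mu r v by have := mu0 z v; have := mu0 v r; lra.
    exact: (zero_pair_split dmu mf zr rz h1 h2 lt ur u'r (det _ _ u'r ur) (det _ _ u'r vr)).
  have lt : mu v z < mu v r by rewrite lt_neqAle ne le2.
  have vr : 0 < mu v r + mu r v by have := mu0 v z; have := mu0 r v; lra.
  have ru' : 0 < mu r u + mu u r by rewrite addrC.
  have r'u : 0 < mu r u' + mu u' r by rewrite addrC.
  have d1 : mu u' u < mu r u + mu u' r by rewrite addrC det.
  have d2 : mu v u < mu r u + mu v r by rewrite addrC det.
  exact: (zero_pair_split dmuT mfT rz zr h2 h1 lt r'u ru' d1 d2).
move=> [ru|[yr ry ny yu]] [u'r0|[y'r ry' ny' uy']].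
- by have := det u' u u'r ur; rewrite ru u'r0 addr0; have := mu0 u' u; lra.
- by apply: (same y') => //; have := le1 y' y'r ry' u; have := mu0 y' u; lra.
- by apply: (same y) => //; have := le2 y yr ry u'; have := mu0 u' y; lra.
have [e1|ne1] := eqVneq (mu u' y) (mu u' r); first exact: (same y).
have [e2|ne2] := eqVneq (mu y' u) (mu r u); first exact: (same y').
apply: (zero_pairs_cross dmu mf yr ry y'r ry' _ _ yu uy' _ _ (det _ _ u'r ur)).
- by have := le1 y yr ry y'; have := mu0 y y'; lra.
- by have := le1 y' y'r ry' y; have := mu0 y' y; lra.
- by rewrite lt_neqAle ne1 le2.
- by rewrite lt_neqAle ne2 le1.
Qed.

(** * Minors under the removal of a pendant edge *)

Section Peel.
Variables (mu mu' : S -> S -> R) (A B : {set S}) (wo wi : R).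
Hypotheses (dmu' : directed_distance mu') (wo0 : 0 <= wo) (wi0 : 0 <= wi).
Hypothesis disAB : [disjoint A & B].
Hypothesis muE : forall y u, mu y u =
  mu' y u + wo * ((y \in A) && (u \in B))%:R + wi * ((y \in B) && (u \in A))%:R.
Hypothesis below : forall a f u, a \in A -> f \notin B ->
  mu' f u <= mu' a u /\ mu' u f <= mu' u a.

(** A minor of [mu'] lifts to [mu] by raising [x] by [wo] on the rows in [A]. Its certificates force
    [u j \in B] if [y j \in A], and [y j \in B] if [u j \in A]; so the diagonal entries absorb the
    whole added length, and the others gain no more than their bounds do. *)
Lemma peel_minor_free : minor_free mu -> minor_free mu'.
Proof.
move=> mf y u x [h1 h2 h3]; have [mu0 muss] := dmu'.
have Wo := wo0; have Wi := wi0.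
have AB s : s \in A -> s \in B = false by move=> sA; apply: (disjointFr disAB).
have h1' i j : mu' (y i) (u j) <= x i + (mu' (y j) (u j) - x j).
  by case: (eqVneq i j) => [->|/h1]; lra.
have yA j : y j \in A -> u j \in B.
  move=> yjA; apply/negPn/negP => ujB.
  have [e1 _] := below (u j) yjA ujB; rewrite muss in e1.
  have [_ e2] := below (y j) yjA ujB; rewrite muss in e2.
  have e3 := mu0 (y j) (u j).
  case: (h3 j) => [[k hk]|[i hi]].
    have [e4 _] := below (u k) yjA ujB; have := h1' j k; lra.
  have [e4 _] := below (y i) yjA ujB; have := hi j; lra.
have uA j : u j \in A -> y j \in B.
  move=> ujA; apply/negPn/negP => yjB.
  have [_ e2] := below (u j) ujA yjB; have [k hk] := h2 j.
  have [_ e4] := below (y k) ujA yjB; have := h1' k j.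
  have := mu0 (y j) (u j); have [e5 _] := below (u j) ujA yjB; rewrite muss in e5.
  lra.
pose x' i := x i + wo * (y i \in A)%:R.
have pE j : mu (y j) (u j) - x' j = mu' (y j) (u j) - x j + wi * (u j \in A)%:R.
  rewrite muE /x'; case: (boolP (y j \in A)) => [yj|yj].
    by rewrite (yA j yj) AB //=; case: (boolP (u j \in A)) => [/AB|_];
      rewrite ?yA //= ?mulr0 ?mulr1; lra.
  by case: (boolP (u j \in A)) => [/uA ->|_]; rewrite ?andbF /= ?mulr0 ?mulr1; lra.
have cases (s : S) : [\/ (s \in A) /\ (s \in B) = false, (s \in A) = false /\ s \in B
   | (s \in A) = false /\ (s \in B) = false].
  case: (boolP (s \in A)) => [sA|_]; first by apply: Or31; rewrite AB.
  by case: (boolP (s \in B)) => _; [apply: Or32|apply: Or33].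
apply: (mf y u x'); split=> [i j ij|i|j /=].
- rewrite pE muE /x'; have := h1 i j ij.
  case: (cases (y i)) => -[-> ->]; case: (cases (u j)) => -[-> ->]; rewrite /= ?mulr0 ?mulr1; lra.
- have [k hk] := h2 i; exists k; rewrite muE /x'.
  have [yk|yk] := boolP (y k \in A).
    have [yi|yi] := boolP (y i \in B).
      by rewrite (AB _ yk) /=; case: (y i \in A); rewrite /= ?mulr0 ?mulr1; lra.
    have [yiA|yiA] := boolP (y i \in A).
      by rewrite (AB _ yk) /= ?mulr1 ?mulr0; lra.
    have [e1 _] := below (u i) yk yi; have := h1' k i.
    have [_ e2] := below (y k) yk yi; rewrite muss in e2; have := mu0 (y k) (y i).
    lra.
  by case: (y i \in A); case: (y i \in B); case: (y k \in B);
    rewrite /= ?mulr0 ?mulr1; lra.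
- rewrite pE; have peq k : mu (y k) (u k) - x' k = _ := pE k.
  case: (h3 j) => [[k hk]|[i hi]].
    left; exists k; rewrite peq muE.
    have [uk|uk] := boolP (u k \in A); last first.
      by case: (u j \in A); case: (u j \in B); case: (u k \in B);
        rewrite /= ?mulr0 ?mulr1; lra.
    have [uj|uj] := boolP (u j \in B).
      by rewrite (AB _ uk) /= ?andbF; case: (u j \in A); rewrite /= ?mulr0 ?mulr1; lra.
    have [ujA|ujA] := boolP (u j \in A).
      by rewrite (AB _ uk) /= ?mulr1 ?mulr0; lra.
    have [_ e1] := below (y j) uk uj; have := h1' j k.
    have [e2 _] := below (u k) uk uj; rewrite muss in e2; have := mu0 (u j) (u k).
    lra.
  right; exists i => k; have := hi k; rewrite !muE /x'.
  have [yi|yi] := boolP (y i \in A); last first.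
    case: (y k \in A); case: (y k \in B); case: (y i \in B); case: (u j \in A);
      case: (u j \in B); rewrite /= ?mulr0 ?mulr1; lra.
  rewrite (AB _ yi).
  have [uj|uj] := boolP (u j \in B).
    by case: (y k \in A); case: (y k \in B); case: (u j \in A);
      rewrite /= ?mulr0 ?mulr1; lra.
  have [ujA|ujA] := boolP (u j \in A).
    by case: (y k \in A); case: (y k \in B); rewrite /= ?mulr0 ?mulr1; lra.
  have [_ e1] := below (y j) yi uj; have := hi j.
  have [e2 _] := below (y i) yi uj; rewrite muss in e2; have := mu0 (u j) (y i).
  lra.
Qed.

End Peel.
End Leaves.

(** * Compatible cut decompositions *)

Section Decomposition.
Variables (R : realType) (S : finType).
Implicit Types mu : S -> S -> R.
Local Notation cut := ({set S} * {set S} * R)%type.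
Variable Pi : {set S}.

Definition compatible_up_to (e f : cut) : bool :=
  [|| (e.1.1 \subset f.1.1) && (f.1.2 \subset e.1.2),
      (f.1.1 \subset e.1.1) && (e.1.2 \subset f.1.2),
      [&& e.1.1 \subset f.1.2, f.1.1 \subset e.1.2 & Pi \subset e.1.2 :|: f.1.2]
    | [&& e.1.2 \subset f.1.1, f.1.2 \subset e.1.1 & Pi \subset e.1.1 :|: f.1.1]].

Lemma compatible_up_to_sym e f : compatible_up_to e f = compatible_up_to f e.
Proof.
rewrite /compatible_up_to orbCA; congr [|| _, _, _ | _].
  by rewrite setUC; case: (e.1.1 \subset _); case: (f.1.1 \subset _).
by rewrite setUC; case: (e.1.2 \subset _); case: (f.1.2 \subset _).
Qed.

Definition pointlike mu s : Prop := forall y u, mu y u <= mu y s + mu s u.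

Definition cut_value (E : seq cut) s t : R :=
  \sum_(e <- E) e.2 * ((s \in e.1.1) && (t \in e.1.2))%:R.

(** The clause on pointlike terminals strengthens the induction: it puts the next leaf and its twins
    on a side of every cut found for the peeled distance. *)
Record decomposes mu (E : seq cut) : Prop := Decomposes {
  dec_pos : forall e, e \in E -> [/\ 0 < e.2, [disjoint e.1.1 & e.1.2],
    e.1.1 != set0 & e.1.2 != set0];
  dec_value : forall s t, mu s t = cut_value E s t;
  dec_point : forall s, pointlike mu s -> forall e, e \in E ->
    (s \in e.1.1) || (s \in e.1.2);
  dec_compat : forall e f, e \in E -> f \in E -> compatible_up_to e f }.

Definition one_way mu : Prop := forall s, s \in Pi -> forall r z,
  mu r s + mu s z < mu r z -> mu z s + mu s r < mu z r -> False.

Lemma cut_value_gt0 mu E e s t : decomposes mu E -> e \in E ->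
  s \in e.1.1 -> t \in e.1.2 -> 0 < mu s t.
Proof.
move=> dec eE sA tB; rewrite (dec_value dec) /cut_value (big_rem e eE) /= sA tB mulr1.
have [e0 _ _ _] := dec_pos dec eE; apply: ltr_wpDr => //.
rewrite big_seq; apply: sumr_ge0 => f /mem_rem fE.
by have [f0 _ _ _] := dec_pos dec fE; rewrite mulr_ge0 // ltW.
Qed.

Lemma cut_value_lt mu E e (a b c d : S) : decomposes mu E -> e \in E ->
  (forall f, f \in E -> a \in f.1.1 -> b \in f.1.2 -> (c \in f.1.1) && (d \in f.1.2)) ->
  ~~ ((a \in e.1.1) && (b \in e.1.2)) -> (c \in e.1.1) && (d \in e.1.2) ->
  mu a b < mu c d.
Proof.
move=> dec eE h ne ce; rewrite !(dec_value dec) /cut_value !(big_rem e eE) /= (negPf ne) ce.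
have [e0 _ _ _] := dec_pos dec eE; rewrite mulr0 mulr1; apply: ltr_leD => //.
rewrite !big_seq; apply: ler_sum => f /mem_rem fE.
have [f0 _ _ _] := dec_pos dec fE; apply: ler_wpM2l; first exact: ltW.
rewrite ler_nat; case: (boolP ((a \in f.1.1) && (b \in f.1.2))) => // /andP[h1 h2].
by rewrite h.
Qed.

Section Step.
Variables (mu : S -> S -> R) (r t : S).
Hypotheses (dmu : directed_distance mu) (mf : minor_free mu).
Hypotheses (mfT : minor_free (transpose mu)) (far : farthest mu r t).

Let mu0 s u : 0 <= mu s u. Proof. by have [+ _] := dmu; apply. Qed.
Let mus s : mu s s = 0. Proof. by have [_ +] := dmu; apply. Qed.

(** Terminals neither here nor in [leaf_twins] have round trip zero to [r] but are not its twins;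
    they limit the length that can be cut off. *)
Definition off_leaf : {set S} := [set u | 0 < mu u r + mu r u].
Definition leaf_twins : {set S} := [set y | twin mu r y].
Let B := off_leaf.
Let A := leaf_twins.

Lemma detB y u : y \in B -> u \in B -> mu y u < mu y r + mu r u.
Proof. by rewrite !inE => yB uB; apply: farthest_detour dmu mf far y u yB uB. Qed.

Lemma zeroF f : f \notin B -> mu f r = 0 /\ mu r f = 0.
Proof. by rewrite inE -leNgt; have := mu0 f r; have := mu0 r f; split; lra. Qed.

Lemma le_out f u : f \notin B -> mu f u <= mu r u.
Proof. by case/zeroF => h1 h2; apply: farthest_zero dmu mf mfT far h1 h2 u. Qed.

Lemma le_in f u : f \notin B -> mu u f <= mu u r.
Proof.
case/zeroF => h1 h2; apply: (@farthest_zero _ _ (transpose mu) r t f _ _ _ _ h2 h1 u) => //.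
  exact: directed_distance_transpose.
exact: farthest_transpose.
Qed.

Lemma twinA a : a \in A -> forall v, mu a v = mu r v /\ mu v a = mu v r.
Proof. by rewrite inE => /twinP. Qed.

Lemma disjoint_leaf a : a \in A -> a \in B = false.
Proof.
move=> aA; have [h1 _] := twinA aA r; have [h2 _] := twinA aA a.
by rewrite inE h1 -h2 !mus addr0 ltxx.
Qed.

Lemma leafA : r \in A.
Proof. by rewrite inE; apply/twinP. Qed.

Lemma farB : t \in B.
Proof. by rewrite inE addrC; have [_] := far. Qed.

Lemma leaf_pointlike a : a \in A -> pointlike mu a.
Proof.
move=> aA y u; have [-> _] := twinA aA u; have [_ ->] := twinA aA y.
have [yB|yB] := boolP (y \in B); last by rewrite (zeroF yB).1 add0r le_out.
have [uB|uB] := boolP (u \in B); first exact/ltW/detB.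
by rewrite (zeroF uB).2 addr0 le_in.
Qed.

Lemma pointlike_leaf s : pointlike mu s -> (s \in A) || (s \in B).
Proof.
move=> ps; have [sB|sB] := boolP (s \in B); first by rewrite orbT.
rewrite orbF inE; apply/twinP => v; have [sr rs] := zeroF sB; split; apply/eqP.
  by rewrite eq_le le_out //=; have := ps r v; rewrite rs add0r.
by rewrite eq_le le_in //=; have := ps v r; rewrite sr addr0.
Qed.

(** The slacks [Fo] and [Fi] bound the two lengths separately, and [Fs] bounds their sum. Maximal
    lengths create a new equality, which drives the induction; by [farthest_open] the separate
    bounds do not both vanish. *)
Lemma ex_peel : exists wo wi, [/\ 0 <= wo, 0 <= wi, 0 < wo + wi &
  [/\ {in B, forall u, wo <= mu r u /\ forall f, f \notin A -> f \notin B ->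
          wo <= mu r u - mu f u},
      {in B, forall u, wi <= mu u r /\ forall f, f \notin A -> f \notin B ->
          wi <= mu u r - mu u f},
      {in B &, forall y u, wo + wi <= mu y r + mu r u - mu y u} &
      [\/ exists y u, [/\ y \in B, u \in B & wo + wi = mu y r + mu r u - mu y u],
        0 < wo /\ exists2 u, u \in B & mu r u = wo \/
          exists f, [/\ f \notin A, f \notin B & wo = mu r u - mu f u] |
        0 < wi /\ exists2 u, u \in B & mu u r = wi \/
          exists f, [/\ f \notin A, f \notin B & wi = mu u r - mu u f]]]].
Proof.
have rB : r \notin B by rewrite disjoint_leaf // leafA.
have minim (F : S * S -> R) (Q : pred (S * S)) k0 : Q k0 ->
    exists k, Q k /\ forall l, Q l -> F k <= F l.
  by move=> Qk0; case: (Order.TotalTheory.arg_minP F Qk0) => k Qk h; exists k.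
pose Fo (k : S * S) := mu r k.1 - (if k.2 \in A then 0 else mu k.2 k.1).
pose Fi (k : S * S) := mu k.1 r - (if k.2 \in A then 0 else mu k.1 k.2).
pose Fs (k : S * S) := mu k.1 r + mu r k.2 - mu k.1 k.2.
have [[u0 f0] [/andP[/= u0B f0B] mo]] : exists k, (k.1 \in B) && (k.2 \notin B) /\
    forall l, (l.1 \in B) && (l.2 \notin B) -> Fo k <= Fo l.
  by apply: (minim Fo (fun k => (k.1 \in B) && (k.2 \notin B)) (t, r)); rewrite /= farB rB.
have [[u1 f1] [/andP[/= u1B f1B] mi]] : exists k, (k.1 \in B) && (k.2 \notin B) /\
    forall l, (l.1 \in B) && (l.2 \notin B) -> Fi k <= Fi l.
  by apply: (minim Fi (fun k => (k.1 \in B) && (k.2 \notin B)) (t, r)); rewrite /= farB rB.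
have [[y2 u2] [/andP[/= y2B u2B] ms]] : exists k, (k.1 \in B) && (k.2 \in B) /\
    forall l, (l.1 \in B) && (l.2 \in B) -> Fs k <= Fs l.
  by apply: (minim Fs (fun k => (k.1 \in B) && (k.2 \in B)) (t, t)); rewrite /= farB.
have Fo0 : 0 <= Fo (u0, f0).
  by rewrite /Fo /=; case: ifP => _; rewrite ?subr0 // subr_ge0 le_out.
have Fi0 : 0 <= Fi (u1, f1).
  by rewrite /Fi /=; case: ifP => _; rewrite ?subr0 // subr_ge0 le_in.
have Fs0 : 0 < Fs (y2, u2) by rewrite subr_gt0 detB.
have open : ~ (Fo (u0, f0) = 0 /\ Fi (u1, f1) = 0).
  rewrite /Fo /Fi /= => -[h1 h2].
  apply: (@farthest_open _ _ mu r t f0 f1 u0 u1 dmu mf mfT far).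
  - by move: u0B; rewrite inE.
  - by move: u1B; rewrite inE.
  - move: h1; case: (boolP (f0 \in A)) => [_|fA] h; [left|right]; first by lra.
    by have [? ?] := zeroF f0B; split=> //; [rewrite inE in fA|lra].
  - move: h2; case: (boolP (f1 \in A)) => [_|fA] h; [left|right]; first by lra.
    by have [? ?] := zeroF f1B; split=> //; [rewrite inE in fA|lra].
have [wo [wi [wo0 wi0 pos [leo lei les tight]]]] : exists wo wi, [/\ 0 <= wo, 0 <= wi,
    0 < wo + wi & [/\ wo <= Fo (u0, f0), wi <= Fi (u1, f1), wo + wi <= Fs (y2, u2) &
    wo + wi = Fs (y2, u2) \/ wo = Fo (u0, f0) /\ wi = Fi (u1, f1)]].
  have [h1|h1] := leP (Fs (y2, u2)) (Fo (u0, f0)).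
    exists (Fs (y2, u2)), 0; rewrite addr0; split=> //; first exact: ltW.
    by split=> //; left.
  have [h2|h2] := leP (Fs (y2, u2) - Fo (u0, f0)) (Fi (u1, f1)).
    exists (Fo (u0, f0)), (Fs (y2, u2) - Fo (u0, f0)); split=> //; try lra.
    by split=> //; try lra; left; lra.
  exists (Fo (u0, f0)), (Fi (u1, f1)); split=> //; last by split=> //; [lra|right].
  rewrite lt_neqAle addr_ge0 // andbT eq_sym paddr_eq0 //.
  by apply/negP => /andP[/eqP e1 /eqP e2]; apply: open.
exists wo, wi; split=> //; split.
- move=> u uB; split=> [|f fA fB].
    have := mo (u, r); rewrite /= uB rB => /(_ isT); rewrite {2}/Fo /= leafA; lra.
  have := mo (u, f); rewrite /= uB fB => /(_ isT); rewrite {2}/Fo /= (negPf fA); lra.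
- move=> u uB; split=> [|f fA fB].
    have := mi (u, r); rewrite /= uB rB => /(_ isT); rewrite {2}/Fi /= leafA; lra.
  have := mi (u, f); rewrite /= uB fB => /(_ isT); rewrite {2}/Fi /= (negPf fA); lra.
- move=> y u yB uB; have := ms (y, u); rewrite /= yB uB => /(_ isT).
  rewrite {2}/Fs /=; lra.
case: tight => [e|[e1 e2]]; first by apply: Or31; exists y2, u2.
have [wop|wop] := ltP 0 wo.
  apply: Or32; split=> //; exists u0 => //; move: e1; rewrite /Fo /=.
  case: (boolP (f0 \in A)) => [_|fA] e; [left; lra|right].
  by exists f0.
apply: Or33; split; first by lra.
exists u1 => //; move: e2; rewrite /Fi /=.
case: (boolP (f1 \in A)) => [_|fA] e; [left; lra|right].
by exists f1.
Qed.

Section Peeled.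
Variables (wo wi : R).
Hypotheses (wo0 : 0 <= wo) (wi0 : 0 <= wi) (pos : 0 < wo + wi).
Hypothesis wo_le : {in B, forall u, wo <= mu r u /\ forall f, f \notin A -> f \notin B ->
          wo <= mu r u - mu f u}.
Hypothesis wi_le : {in B, forall u, wi <= mu u r /\ forall f, f \notin A -> f \notin B ->
          wi <= mu u r - mu u f}.
Hypothesis w_le : {in B &, forall y u, wo + wi <= mu y r + mu r u - mu y u}.

Definition peeled : S -> S -> R := fun y u => mu y u -
  wo * ((y \in A) && (u \in B))%:R - wi * ((y \in B) && (u \in A))%:R.

Lemma peeledE y u : mu y u = peeled y u +
  wo * ((y \in A) && (u \in B))%:R + wi * ((y \in B) && (u \in A))%:R.
Proof. by rewrite /peeled; ring. Qed.

Lemma peeled_le y u : peeled y u <= mu y u.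
Proof.
rewrite /peeled -addrA gerDl -opprD oppr_le0.
by rewrite addr_ge0 // mulr_ge0.
Qed.

Lemma peeled_out f u : f \notin A -> f \notin B -> peeled f u = mu f u.
Proof. by move=> /negPf fA /negPf fB; rewrite /peeled fA fB /= !mulr0 !subr0. Qed.

Lemma peeled_in f u : f \notin A -> f \notin B -> peeled u f = mu u f.
Proof. by move=> /negPf fA /negPf fB; rewrite /peeled fA fB !andbF /= !mulr0 !subr0. Qed.

Lemma peeled_A a u : a \in A ->
  peeled a u = mu r u - wo * (u \in B)%:R /\ peeled u a = mu u r - wi * (u \in B)%:R.
Proof.
move=> aA; have [e1 e2] := twinA aA u.
by rewrite /peeled aA (disjoint_leaf aA) e1 e2 !andbF !andbT /= !mulr0 !subr0.
Qed.

Lemma peeled_BB y u : y \in B -> u \in B -> peeled y u = mu y u.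
Proof.
move=> yB uB; have nA s : s \in B -> s \in A = false.
  by move=> sB; apply/negP => /disjoint_leaf; rewrite sB.
by rewrite /peeled !nA // andbF /= !mulr0 !subr0.
Qed.

Lemma peeled_distance : directed_distance peeled.
Proof.
split=> [y u|s]; last first.
  have [sA|sA] := boolP (s \in A).
    by rewrite (peeled_A _ sA).1 (disjoint_leaf sA) mulr0 subr0 -(mus s) (twinA sA s).1.
  have [sB|sB] := boolP (s \in B); first by rewrite peeled_BB.
  by rewrite peeled_out.
have [yA|yA] := boolP (y \in A).
  rewrite (peeled_A _ yA).1; have [uB|uB] := boolP (u \in B).
    by rewrite mulr1 subr_ge0 (wo_le uB).1.
  by rewrite mulr0 subr0.
have [yB|yB] := boolP (y \in B); last by rewrite peeled_out.
have [uA|uA] := boolP (u \in A).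
  by rewrite (peeled_A _ uA).2 yB mulr1 subr_ge0 (wi_le yB).1.
have [uB|uB] := boolP (u \in B); first by rewrite peeled_BB.
by rewrite peeled_in.
Qed.

Lemma peeled_below a f u : a \in A -> f \notin B ->
  peeled f u <= peeled a u /\ peeled u f <= peeled u a.
Proof.
move=> aA fB; have [-> ->] := peeled_A u aA.
have [fA|fA] := boolP (f \in A); first by have [-> ->] := peeled_A u fA.
rewrite peeled_out // peeled_in //; have [uB|uB] := boolP (u \in B).
  rewrite !mulr1; have := (wo_le uB).2 f fA fB; have := (wi_le uB).2 f fA fB.
  by split; lra.
by rewrite !mulr0 !subr0 le_out // le_in.
Qed.

Lemma peeled_minor_free : minor_free peeled.
Proof.
apply: (@peel_minor_free _ _ mu peeled A B wo wi peeled_distance wo0 wi0) => //.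
- by apply/pred0P => s /=; apply/negP => /andP[/disjoint_leaf ->].
- exact: peeledE.
- exact: peeled_below.
Qed.

Lemma peeled_minor_freeT : minor_free (transpose peeled).
Proof.
apply: (@peel_minor_free _ _ (transpose mu) (transpose peeled) A B wi wo _ wi0 wo0) => //.
- exact/directed_distance_transpose/peeled_distance.
- by apply/pred0P => s /=; apply/negP => /andP[/disjoint_leaf ->].
- move=> y u; rewrite /transpose peeledE [(u \in A) && _]andbC [(u \in B) && _]andbC.
  ring.
- by move=> a f u aA fB; have [h1 h2] := peeled_below u aA fB.
Qed.

Definition excess (nu : S -> S -> R) y s u : R := nu y s + nu s u - nu y u.

Lemma excess_A y s u : s \in A -> 0 <= excess peeled y s u.
Proof.
move=> sA; rewrite /excess (peeled_A y sA).2 (peeled_A u sA).1.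
have [yA|yA] := boolP (y \in A).
  rewrite (peeled_A u yA).1 (disjoint_leaf yA) mulr0.
  by have := mu0 y r; have [-> _] := twinA yA r; lra.
have [uA|uA] := boolP (u \in A).
  rewrite (peeled_A y uA).2 (disjoint_leaf uA) mulr0.
  by have := mu0 r u; have [_ ->] := twinA uA r; lra.
have [yB|yB] := boolP (y \in B); have [uB|uB] := boolP (u \in B).
- by rewrite peeled_BB // !mulr1; have := w_le yB uB; lra.
- rewrite peeled_in // mulr1 mulr0; have := (wi_le yB).2 u uA uB; have := mu0 r u; lra.
- rewrite peeled_out // mulr1 mulr0; have := (wo_le uB).2 y yA yB; have := mu0 y r; lra.
- rewrite peeled_out // !mulr0; have := le_out u yB; have := mu0 y r; lra.
Qed.

Lemma peeled_zero y u : y \notin B -> u \notin B -> (y \in A) || (u \in A) -> peeled y u = 0.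
Proof.
move=> yB uB /orP[yA|uA].
  by rewrite (peeled_A u yA).1 (negPf uB) mulr0 subr0 (zeroF uB).2.
by rewrite (peeled_A y uA).2 (negPf yB) mulr0 subr0 (zeroF yB).1.
Qed.

(** Together with [excess_le]: peeling moves every excess towards 0 without crossing it. Hence
    pointlike terminals stay pointlike, nonpositive excesses stay nonpositive, and [one_way] is
    inherited. *)
Lemma excess_ge y s u : 0 <= excess peeled y s u \/ excess mu y s u <= excess peeled y s u.
Proof.
have [p0 _] := peeled_distance; have h1 := p0 y s; have h2 := p0 s u.
have [sA|sA] := boolP (s \in A); first by left; apply: excess_A.
have [/andP[/andP[yB uB] yuA]|c] :=
  boolP ((y \notin B) && (u \notin B) && ((y \in A) || (u \in A))).
  by left; rewrite /excess (peeled_zero yB uB yuA); lra.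
right; move: wo0 wi0 c; rewrite /excess /peeled (negPf sA).
have [yA|yA] := boolP (y \in A); have [uA|uA] := boolP (u \in A);
  rewrite ?(disjoint_leaf yA) ?(disjoint_leaf uA); case: (y \in B); case: (u \in B);
  case: (s \in B) => //=; rewrite ?mulr0 ?mulr1 => *; lra.
Qed.

Lemma excess_le y s u : excess peeled y s u <= 0 \/ excess peeled y s u <= excess mu y s u.
Proof.
have [sA|sA] := boolP (s \in A).
  right; move: wo0 wi0; rewrite /excess /peeled sA (disjoint_leaf sA).
  have [yA|yA] := boolP (y \in A); have [uA|uA] := boolP (u \in A);
  rewrite ?(disjoint_leaf yA) ?(disjoint_leaf uA); case: (y \in B); case: (u \in B);
  rewrite /= ?mulr0 ?mulr1 => *; lra.
have [sB|sB] := boolP (s \in B).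
  right; move: wo0 wi0; rewrite /excess /peeled (negPf sA) sB.
  have [yA|yA] := boolP (y \in A); have [uA|uA] := boolP (u \in A);
  rewrite ?(disjoint_leaf yA) ?(disjoint_leaf uA); case: (y \in B); case: (u \in B);
  rewrite /= ?mulr0 ?mulr1 => *; lra.
rewrite /excess peeled_in // peeled_out //.
have [yA|yA] := boolP (y \in A).
  left; have [h _] := peeled_below u yA sB; rewrite peeled_out // in h.
  have [-> _] := twinA yA s; rewrite (zeroF sB).2; lra.
have [uA|uA] := boolP (u \in A).
  left; have [_ h] := peeled_below y uA sB; rewrite peeled_in // in h.
  have [_ ->] := twinA uA s; rewrite (zeroF sB).1; lra.
by right; rewrite /peeled (negPf yA) (negPf uA) !andbF /= !mulr0 !subr0.
Qed.

Lemma pointlike_peeled s : pointlike mu s -> pointlike peeled s.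
Proof.
move=> ps y u; have := ps y u; case: (excess_ge y s u); rewrite /excess; lra.
Qed.

Lemma one_way_peeled : one_way mu -> one_way peeled.
Proof.
move=> ow s sPi a z h1 h2; apply: (ow s sPi a z).
  by case: (excess_ge a s z); rewrite /excess; lra.
by case: (excess_ge z s a); rewrite /excess; lra.
Qed.

(** A cut of weight 0 has to go, since compatibility of opposed cuts is derived from positive
    weights. *)
Definition leaf_cuts : seq cut := [seq e <- [:: (A, B, wo); (B, A, wi)] | 0 < e.2].

Lemma leaf_cutsP (e : cut) : e \in leaf_cuts ->
  (e = (A, B, wo) /\ 0 < wo) \/ (e = (B, A, wi) /\ 0 < wi).
Proof.
by rewrite mem_filter !inE => /andP[e0 /orP[] /eqP eE]; rewrite eE /= in e0 *;
  [left|right].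
Qed.

(** Every earlier cut has all of [A] on the side of [r] and its other side inside [B]. It is thus
    nested with one of the leaf cuts and opposed to the other; only opposed pairs involve [Pi]. *)
Lemma decomposes_peeled E : decomposes peeled E -> one_way mu ->
  decomposes mu (E ++ leaf_cuts).
Proof.
move=> dec ow; have [p0 ps] := peeled_distance.
have rA := leafA; have tB := farB.
have rB : r \notin B by rewrite disjoint_leaf.
have disAB : [disjoint A & B].
  by apply/pred0P => s /=; apply/negP => /andP[/disjoint_leaf ->].
have notB s e : e \in E -> s \notin B ->
    (r \in e.1.1 -> s \notin e.1.2) /\ (r \in e.1.2 -> s \notin e.1.1).
  move=> eE sB; split=> re; apply/negP => se.
    have e0 : peeled r s = 0 by apply: peeled_zero; rewrite ?rA.
    by have := cut_value_gt0 dec eE re se; rewrite e0 ltxx.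
  have e0 : peeled s r = 0 by apply: peeled_zero; rewrite ?rA ?orbT.
  by have := cut_value_gt0 dec eE se re; rewrite e0 ltxx.
have rE e : e \in E -> (r \in e.1.1) || (r \in e.1.2).
  by move=> eE; apply: (dec_point dec) => //; apply/pointlike_peeled/leaf_pointlike.
have Aside e : e \in E ->
    (r \in e.1.1 -> A \subset e.1.1 /\ e.1.2 \subset B) /\
    (r \in e.1.2 -> A \subset e.1.2 /\ e.1.1 \subset B).
  move=> eE; split=> re; split; apply/subsetP => s se.
  - have := dec_point dec (pointlike_peeled (leaf_pointlike se)) eE.
    by rewrite (negPf ((notB s e eE _).1 re)) ?orbF // disjoint_leaf.
  - by apply: contraLR se => sB; apply: (notB s e eE sB).1.
  - have := dec_point dec (pointlike_peeled (leaf_pointlike se)) eE.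
    by rewrite (negPf ((notB s e eE _).2 re)) // disjoint_leaf.
  - by apply: contraLR se => sB; apply: (notB s e eE sB).2.
have leafE s e : e \in E -> s \notin B ->
    (s \in e.1.1 -> r \in e.1.1) /\ (s \in e.1.2 -> r \in e.1.2).
  move=> eE sB; split=> se; have := rE e eE; case: (boolP (r \in _)) => //= h1 h2.
    by have := (notB s e eE sB).2 h2; rewrite se.
  by have := (notB s e eE sB).1 h1; rewrite se.
have zF s : s \notin B -> mu s r = 0 /\ mu r s = 0 := @zeroF s.
(* A terminal [s] of [Pi] missed by both target sets has round trip zero to [r]. For [z] in [e.1.1],
   a stop at [s] shortens [r -> z] by at least [wo], and shortens [z -> r] because [e] separates [z]
   from [r] but not from [s]. *)
have towards e : e \in E -> r \in e.1.2 -> 0 < wo -> Pi \subset B :|: e.1.2.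
  move=> eE re wop; apply/subsetP => s sPi; rewrite inE; apply/orP.
  have [sB|sB] := boolP (s \in B); [by left|right].
  apply/negPn/negP => se; have [_ _ /set0Pn[z ze] _] := dec_pos dec eE.
  have [[_ hB] [sr rs]] := ((Aside e eE).2 re, zF s sB).
  have zB : z \in B by apply: (subsetP hB).
  have sA : s \notin A by apply: contraNN se; apply: subsetP (((Aside e eE).2 re).1) s.
  apply: (ow s sPi r z); first by have := (wo_le zB).2 s sA sB; lra.
  rewrite sr addr0 -(peeled_in z sA sB); apply: lt_le_trans (peeled_le z r).
  apply: (cut_value_lt dec eE) => [f fE -> h| |]; last by rewrite ze.
    by rewrite (leafE s f fE sB).2.
  by rewrite (negPf se) andbF.
have backwards e : e \in E -> r \in e.1.1 -> 0 < wi -> Pi \subset B :|: e.1.1.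
  move=> eE re wip; apply/subsetP => s sPi; rewrite inE; apply/orP.
  have [sB|sB] := boolP (s \in B); [by left|right].
  apply/negPn/negP => se; have [_ _ _ /set0Pn[z ze]] := dec_pos dec eE.
  have [[_ hB] [sr rs]] := ((Aside e eE).1 re, zF s sB).
  have zB : z \in B by apply: (subsetP hB).
  have sA : s \notin A by apply: contraNN se; apply: subsetP (((Aside e eE).1 re).1) s.
  apply: (ow s sPi r z); last by have := (wi_le zB).2 s sA sB; lra.
  rewrite rs add0r -(peeled_out z sA sB); apply: lt_le_trans (peeled_le r z).
  apply: (cut_value_lt dec eE) => [f fE h ->| |]; last by rewrite re ze.
    by rewrite (leafE s f fE sB).1.
  by rewrite (negPf se).
have both : 0 < wo -> 0 < wi -> Pi \subset B :|: A.
  move=> wop wip; apply/subsetP => s sPi; rewrite inE; apply/orP.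
  have [sB|sB] := boolP (s \in B); [by left|right].
  apply/negPn/negP => sA; have [sr rs] := zF s sB.
  apply: (ow s sPi r t); first by have := (wo_le tB).2 s sA sB; lra.
  by have := (wi_le tB).2 s sA sB; lra.
have compEL e f : e \in E -> f \in leaf_cuts -> compatible_up_to f e.
  move=> eE /leaf_cutsP[[-> wop]|[-> wip]]; rewrite /compatible_up_to /=;
    have /orP[re|re] := rE e eE.
  - by have [-> ->] := (Aside e eE).1 re.
  - by have [-> ->] := (Aside e eE).2 re; rewrite (towards e) ?orbT.
  - by have [-> ->] := (Aside e eE).1 re; rewrite (backwards e) ?orbT.
  - by have [-> ->] := (Aside e eE).2 re; rewrite orbT.
split.
- move=> e; rewrite mem_cat => /orP[/(dec_pos dec)//|/leaf_cutsP[[-> ?]|[-> ?]]] /=.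
    by split=> //; apply/set0Pn; [exists r|exists t].
  split=> //; first by rewrite disjoint_sym.
    by apply/set0Pn; exists t.
  by apply/set0Pn; exists r.
- move=> s u; rewrite peeledE (dec_value dec) /cut_value big_cat -addrA; congr (_ + _).
  rewrite big_filter big_mkcond !big_cons big_nil /= addr0.
  move: wo0 wi0; rewrite !le0r => /orP[/eqP ->|->] /orP[/eqP ->|->];
    by rewrite ?ltxx ?mul0r.
- move=> s psl e; rewrite mem_cat => /orP[eE|]; first exact: (dec_point dec (pointlike_peeled psl)).
  by have := pointlike_leaf psl => sAB /leaf_cutsP[[-> _]|[-> _]] //=; rewrite orbC.
move=> e f; rewrite !mem_cat => /orP[eE|eL] /orP[fE|fL].
- exact: (dec_compat dec).
- by rewrite compatible_up_to_sym; apply: compEL.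
- exact: compEL.
- case: (leaf_cutsP eL) => -[-> w1]; case: (leaf_cutsP fL) => -[-> w2];
    rewrite /compatible_up_to /= ?subxx ?orbT //=.
    by rewrite both ?orbT.
  by rewrite [A :|: B]setUC both ?orbT.
Qed.

End Peeled.
End Step.

(** Peeling loses no element of either set, and with the maximal lengths of [ex_peel] it gains
    one. *)
Definition tight_count mu : nat :=
  #|[set k : S * S * S | excess mu k.1.1 k.1.2 k.2 <= 0]| +
  #|[set k : S * S | mu k.1 k.2 == 0]|.

Theorem cut_decomposition mu : directed_distance mu -> minor_free mu ->
  minor_free (transpose mu) -> one_way mu -> exists E, decomposes mu E.
Proof.
have [n] := ubnP (#|{: S * S * S}| + #|{: S * S}| - tight_count mu).
elim: n mu => // n IH mu ltn dmu mf mfT ow.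
have [mu0 mus] := dmu.
have [[s0 [u0 ne]]|zero] := boolp.pselect (exists s u, mu s u != 0); last first.
  exists [::]; split=> // s u; rewrite /cut_value big_nil.
  by apply/eqP/negPn/negP => h; apply: zero; exists s, u.
have [[r t] /= far0] := ex_max (s0, u0) (fun k : S * S => mu k.1 k.2 + mu k.2 k.1).
have far : farthest mu r t.
  split=> [a b|]; first exact: (far0 (a, b)).
  apply: lt_le_trans (far0 (s0, u0)) => /=; apply: ltr_pwDl => //.
  by rewrite lt_neqAle eq_sym ne mu0.
have [wo [wi [wo0 wi0 pos [h1 h2 h3 gain]]]] := ex_peel dmu mf mfT far.
pose nu := peeled mu r wo wi.
have dnu : directed_distance nu by apply: peeled_distance.
have [nu0 _] := dnu.
have sub1 : [set k : S * S * S | excess mu k.1.1 k.1.2 k.2 <= 0] \subset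
    [set k : S * S * S | excess nu k.1.1 k.1.2 k.2 <= 0].
  apply/subsetP => -[[y s] u]; rewrite !inE /= => h.
  have [//|h'] := excess_le dmu mf mfT far wo0 wi0 h1 h2 y s u.
  exact: le_trans h' h.
have sub2 : [set k : S * S | mu k.1 k.2 == 0] \subset [set k : S * S | nu k.1 k.2 == 0].
  apply/subsetP => -[y u]; rewrite !inE /= => /eqP h; rewrite eq_le nu0 andbT -h.
  exact: peeled_le.
have rA : r \in leaf_twins mu r := leafA mu r.
have rr s : s \in off_leaf mu r ->
    nu r s = mu r s - wo /\ nu s r = mu s r - wi.
  by move=> sB; rewrite /nu; have [-> ->] := peeled_A dmu wo wi s rA; rewrite sB !mulr1.
have newtriple y s u : 0 < excess mu y s u -> excess nu y s u <= 0 ->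
    (tight_count mu < tight_count nu)%N.
  move=> g1 g2; rewrite /tight_count -addSn leq_add ?subset_leq_card //.
  apply: proper_card; apply/properP; split=> //; exists (y, s, u); rewrite inE //=.
  by rewrite -ltNge.
have newpair y u : mu y u != 0 -> nu y u = 0 -> (tight_count mu < tight_count nu)%N.
  move=> g1 g2; rewrite /tight_count -addnS leq_add ?subset_leq_card //.
  apply: proper_card; apply/properP; split=> //; exists (y, u); rewrite inE //=.
  by rewrite g2.
have more : (tight_count mu < tight_count nu)%N.
  case: gain => [[y [u [yB uB e]]]|[wop [u uB [e|[f [fA fB e]]]]]|[wip [u uB [e|[f [fA fB e]]]]]].
  - apply: (newtriple y r u); first by rewrite /excess -e.
    rewrite /excess (rr y yB).2 (rr u uB).1 /nu (peeled_BB dmu) //; lra.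
  - by apply: (newpair r u); [rewrite e gt_eqF|rewrite (rr u uB).1 e subrr].
  - have [fr rf] := zeroF dmu fB.
    apply: (newtriple f r u); first by rewrite /excess fr add0r -e.
    by rewrite /excess /nu !(peeled_out _ _ _ fA fB) fr -/nu (rr u uB).1; lra.
  - by apply: (newpair u r); [rewrite e gt_eqF|rewrite (rr u uB).2 e subrr].
  - have [fr rf] := zeroF dmu fB.
    apply: (newtriple u r f); first by rewrite /excess rf addr0 -e.
    by rewrite /excess /nu !(peeled_in _ _ _ fA fB) rf -/nu (rr u uB).2; lra.
have bound : (tight_count nu <= #|{: S * S * S}| + #|{: S * S}|)%N.
  by rewrite leq_add ?max_card.
have [||||E dec] := IH nu _ dnu.
- by move: ltn more bound; lia.
- exact: (peeled_minor_free dmu mf mfT far wo0 wi0 h1 h2).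
- exact: (peeled_minor_freeT dmu mf mfT far wo0 wi0 h1 h2).
- exact: (one_way_peeled dmu mf mfT far wo0 wi0 h1 h2 h3 ow).
by exists (E ++ leaf_cuts mu r wo wi); apply: (decomposes_peeled (t := t)).
Qed.
End Decomposition.

(** * One-dimensional tight spans *)

Section TightSpan.
Variables (R : realType) (S : finType) (mu : S -> S -> R).
Hypothesis dmu : directed_distance mu.

(* Nonnegativity constraints become ordinary ones for an extra terminal at
   distance zero from and to everything. *)
Definition add_zero (o o' : S + unit) : R :=
  match o, o' with inl s, inl t => mu s t | _, _ => 0 end.

Lemma sum_add_unit (F : S + unit -> R) :
  \sum_o F o = \sum_s F (inl s) + F (inr tt).
Proof. by rewrite big_sumType /= (big_pred1 tt) //; case. Qed.

Section Face.
Variables (pc pr : S + unit -> R) (cc cr : S + unit -> 'I_3).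
Hypotheses (fe : feasible add_zero pc pr) (sp : spanned add_zero pc pr).
Hypotheses (pc0 : pc (inr tt) = 0) (pr0 : pr (inr tt) = 0).
Hypotheses (cc0 : val (cc (inr tt)) = 0%N) (cr0 : val (cr (inr tt)) = 0%N).
Hypothesis cl : forall s t, touch add_zero pc pr s t -> cc s = cr t.
Variables s1 s2 : S.
Hypotheses (cc1 : val (cc (inl s1)) = 1%N) (cc2 : val (cc (inl s2)) = 2%N).
Local Notation T := (touch add_zero pc pr).

Let w : Defs.point R S := [ffun v => match v with
  | inl s => \sum_o (T (inl s) o)%:R | inr t => \sum_o (T o (inl t))%:R end].
Let b0 := \sum_o \sum_o' (T o o')%:R * add_zero o o'.
Let extc (p : Defs.point R S) (o : S + unit) : R := if o is inl s then p (inl s) else 0.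
Let extr (p : Defs.point R S) (o : S + unit) : R := if o is inl s then p (inr s) else 0.

Lemma dot_weight p : dot w p = \sum_o \sum_o' (T o o')%:R * (extc p o + extr p o').
Proof.
rewrite /dot big_sumType /= [RHS](eq_bigr (fun o =>
  \sum_o' (T o o')%:R * extc p o + \sum_o' (T o o')%:R * extr p o')); last first.
  by move=> o _; rewrite -big_split; apply: eq_bigr => o' _; rewrite mulrDr.
rewrite [RHS]big_split /= [X in _ = _ + X]exchange_big /=; congr (_ + _); symmetry.
  rewrite (sum_add_unit (fun o => \sum_o' (T o o')%:R * extc p o)) /=.
  rewrite [X in _ + X]big1 ?addr0 => [|o _]; last by rewrite mulr0.
  by apply: eq_bigr => s _; rewrite ffunE mulr_suml.
rewrite (sum_add_unit (fun o' => \sum_o (T o o')%:R * extr p o')) /=.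
rewrite [X in _ + X]big1 ?addr0 => [|o _]; last by rewrite mulr0.
by apply: eq_bigr => s _; rewrite ffunE mulr_suml.
Qed.

Lemma ext_feasible p : P_mu_plus mu p -> feasible add_zero (extc p) (extr p).
Proof.
by case=> Pp p0 [s|[]] [t|[]] /=; rewrite ?addr0 ?add0r //; apply: Pp.
Qed.

Let F : set (Defs.point R S) := [set p | P_mu_plus mu p /\ dot w p = b0]%classic.

Lemma touch_on_face p : F p -> forall o o', T o o' -> extc p o + extr p o' = add_zero o o'.
Proof.
case=> /ext_feasible Pp; rewrite dot_weight /b0 => eq o o' oo.
have nn a b : 0 <= (T a b)%:R * (extc p a + extr p b) - (T a b)%:R * add_zero a b.
  by rewrite -mulrBr mulr_ge0 // subr_ge0.
have : \sum_a \sum_b ((T a b)%:R * (extc p a + extr p b) -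
    (T a b)%:R * add_zero a b) = 0.
  under eq_bigr do rewrite sumrB.
  by rewrite sumrB eq subrr.
move/psumr_eq0P => /(_ (fun a _ => sumr_ge0 _ (fun b _ => nn a b))) /(_ o isT).
move/psumr_eq0P => /(_ (fun b _ => nn o b)) /(_ o' isT).
by rewrite oo !mul1r => /eqP; rewrite subr_eq0 => /eqP.
Qed.

Lemma face_of_touches : face (P_mu_plus mu) F.
Proof.
exists w, b0; split=> // p /ext_feasible Pp; rewrite dot_weight /b0.
by apply: ler_sum => o _; apply: ler_sum => o' _; apply: ler_wpM2l.
Qed.

(** Touching the extra terminal means being 0, so each coordinate is held up by a tight sum or by
    its own nonnegativity. *)
Lemma face_in_tight_span : (F `<=` T_mu mu)%classic.
Proof.
move=> p Fp; have [Pp _] := Fp; split=> // q /ext_feasible Pq qp.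
have qpc o : extc q o <= extc p o by case: o => [s|[]] //=; apply: qp.
have qpr o : extr q o <= extr p o by case: o => [s|[]] //=; apply: qp.
apply/ffunP => -[s|s]; apply/eqP; rewrite eq_le qp /=.
  have [o /(touch_on_face Fp)] := sp.1 (inl s).
  by move: (Pq (inl s) o) (qpr o); rewrite [extc p (inl s)]/= [extc q (inl s)]/=; lra.
have [o /(touch_on_face Fp)] := sp.2 (inl s).
by move: (Pq o (inl s)) (qpc o); rewrite [extr p (inl s)]/= [extr q (inl s)]/=; lra.
Qed.

(** The triangle of moving classes again, with the extra terminal in class 0: its coordinates stay
    0, so the moved points still come from [P_mu_plus]. The rows [s1] and [s2] witness the two
    independent motions. *)
Lemma two_dimensional_face : ~ dim_T_mu_le mu 1.
Proof.
move=> dimle.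
have [d [d0 hd]] : exists d, 0 < d /\ forall st : (S + unit) * (S + unit),
    ~~ T st.1 st.2 -> add_zero st.1 st.2 + d < pc st.1 + pr st.2.
  apply: (uniform_margin (Q := fun st d => ~~ T st.1 st.2 ->
    add_zero st.1 st.2 + d < pc st.1 + pr st.2)).
    by move=> st m m' m0 mm h /h; lra.
  move=> [s t] /=; case: (boolP (T s t)) => h; first by exists 1; split.
  exists ((pc s + pr t - add_zero s t) / 2); have : add_zero s t < pc s + pr t.
    rewrite lt_neqAle fe andbT; apply: contra h; rewrite /touch eq_sym.
    by move=> /eqP ->.
  by move=> lt; split=> [|_]; lra.
have {}hd s t := hd (s, t).
pose mv a b : Defs.point R S := [ffun v => match v with
  | inl s => move_c pc cc a b (inl s) | inr s => move_r pr cr a b (inl s) end].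
have mvF a b : 0 <= a -> 0 <= b -> a + b <= d -> F (mv a b).
  move=> a0 b0' ab.
  have [fe' T'] := move_touch cl hd a0 b0' ab.
  have m0 : move_c pc cc a b (inr tt) = 0 /\ move_r pr cr a b (inr tt) = 0.
    by rewrite /move_c /move_r /weight2 pc0 pr0 cc0 cr0 subr0 addr0.
  have ex o : extc (mv a b) o = move_c pc cc a b o /\
      extr (mv a b) o = move_r pr cr a b o.
    by case: o => [s|[]] /=; rewrite ?ffunE ?m0.1 ?m0.2.
  split.
    split=> [s t|[s|s]]; rewrite !ffunE; first exact: (fe' (inl s) (inl t)).
      by have := fe' (inl s) (inr tt); rewrite m0.2 addr0.
    by have := fe' (inr tt) (inl s); rewrite m0.1 add0r.
  rewrite dot_weight; apply: eq_bigr => o _; apply: eq_bigr => o' _.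
  rewrite (ex o).1 (ex o').2.
  by case: (boolP (T o o')); rewrite ?mul0r // -T' => /eqP ->.
pose tri (i : 'I_3) : Defs.point R S :=
  mv (if val i == 1%N then d else 0) (if val i == 2%N then d else 0).
suff : (2 <= 1)%N by [].
apply: (dimle F face_of_touches face_in_tight_span 2 tri).
  by case=> -[|[|[|//]]] lti; apply: mvF => /=; lra.
move=> al al0 comb.
have sum3 (f : 'I_3 -> R) : \sum_i f i =
    f (@Ordinal 3 0 isT) + f (@Ordinal 3 1 isT) + f (@Ordinal 3 2 isT).
  rewrite !big_ord_recl big_ord0 /= addr0 addrA.
  by congr (f _ + f _ + f _); apply: val_inj.
have h1 : al (@Ordinal 3 1 isT) = 0.
  have := congr1 (fun p : Defs.point R S => p (inl s1)) comb.
  rewrite sum_ffunE !sum3 !ffunE /= /move_c /weight2 cc1 /GRing.scale /=.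
  move: al0; rewrite sum3 => al0 e; apply: (mulIf (lt0r_neq0 d0)); rewrite mul0r -[RHS]e.
  have -> : al (@Ordinal 3 0 isT) = - al (@Ordinal 3 1 isT) - al (@Ordinal 3 2 isT) by lra.
  ring.
have h2 : al (@Ordinal 3 2 isT) = 0.
  have := congr1 (fun p : Defs.point R S => p (inl s2)) comb.
  rewrite sum_ffunE !sum3 !ffunE /= /move_c /weight2 cc2 /GRing.scale /=.
  move: al0; rewrite sum3 => al0 e; apply: (mulIf (lt0r_neq0 d0)); rewrite mul0r -[RHS]e.
  have -> : al (@Ordinal 3 0 isT) = - al (@Ordinal 3 1 isT) - al (@Ordinal 3 2 isT) by lra.
  ring.
move: al0; rewrite sum3 h1 h2 !addr0 => h0 i.
case: i => -[|[|[|//]]] lti; [rewrite -h0|rewrite -h1|rewrite -h2];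
  by congr (al _); apply: val_inj.
Qed.
End Face.

(** A violating submatrix, bordered by the extra terminal, is tropically nonsingular. *)
Lemma tight_span_minor (s1 s2 t1 t2 : S) : dim_T_mu_le mu 1 ->
  0 < mu s1 t1 -> 0 < mu s2 t2 -> mu s1 t1 + mu s2 t2 <= mu s1 t2 + mu s2 t1.
Proof.
move=> dimle a0 d0; rewrite leNgt; apply/negP => lt.
have [mu0 mus] := dmu; have b0 := mu0 s1 t2; have c0 := mu0 s2 t1.
(* The midpoint of the interval that columns [t1] and [t2] allow for the difference of the two row
   values; the bounds on [x2] make rows and columns positive, that is, strict against the extra
   terminal. *)
pose D := (mu s1 t2 - mu s2 t2 + mu s1 t1 - mu s2 t1) / 2.
have [x2 [l1 l2 l3 l4]] : exists x2, [/\ 0 < x2, - D < x2, x2 < mu s2 t2 & x2 < mu s1 t1 - D].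
  pose lo := Num.max 0 (- D); pose hi := Num.min (mu s2 t2) (mu s1 t1 - D).
  have lohi : lo < hi.
    by rewrite /lo /hi gt_max !lt_min /D; apply/andP; split; apply/andP; split; lra.
  exists ((lo + hi) / 2).
  have : lo < (lo + hi) / 2 by lra.
  have : (lo + hi) / 2 < hi by lra.
  by rewrite {2}/hi lt_min {3}/lo gt_max => /andP[? ?] /andP[? ?].
have [m [m0 m1 m2 m3]] : exists m, [/\ 0 < m, m < mu s1 t1 - D - x2,
    m < (mu s2 t2 - x2) / 2 & m < D - mu s1 t2 + mu s2 t2].
  by apply: small3; rewrite /D in l1 l2 l3 l4 *; lra.
pose y := of3 (inr tt : S + unit) (inl s1) (inl s2).
pose u := of3 (inr tt : S + unit) (inl t1) (inl t2).
pose x0 := of3 0 (x2 + D) x2.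
have [e [/andP[e0 em] ind]] := independent_shift add_zero x0 m0.
pose x := shifted x0 e.
have [x_0 x_1 x_2] : [/\ x (@Ordinal 3 0 isT) = 0, x (@Ordinal 3 1 isT) = x2 + D + e &
    x (@Ordinal 3 2 isT) = x2 + 2 * e].
  by rewrite /x /shifted /x0 /of3 /=; split; ring.
have [|pc [pr [fe sp pcy prP pcP]]] := @top_extension _ _ add_zero y x.
  apply: forall3; [exists (inr tt)|exists (inl t1)|exists (inl t2)]; apply: forall3;
    rewrite ?x_0 ?x_1 ?x_2 /y /of3 /=; rewrite /D in l1 l2 l3 l4 m1 m2 m3 *; lra.
have pc0 : pc (inr tt) = 0 by have := pcy (@Ordinal 3 0 isT); rewrite -/x x_0.
have pr0 : pr (inr tt) = 0.
  apply/eqP; rewrite eq_le; apply/andP; split; last first.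
    by have := fe (inr tt) (inr tt); rewrite pc0 add0r.
  have [i ->] := prP (inr tt); move: i; apply: forall3;
    rewrite ?x_0 ?x_1 ?x_2 /y /of3 /=; lra.
have [clc clr] := top_extension_classified prP pcP.
have /boolp.choice[cc ccP] := clc; have /boolp.choice[cr crP] := clr.
have same := classified_touch ind ccP crP.
have ccy i : cc (y i) = i.
  apply: ind; have := combinationN (ccP (y i)); rewrite pcy /x; congr combination; ring.
have cr0 : cr (inr tt) = @Ordinal 3 0 isT.
  rewrite -(ccy (@Ordinal 3 0 isT)); symmetry; apply: same.
  by rewrite /touch /y /of3 /= pc0 pr0 addr0.
apply: (@two_dimensional_face pc pr cc cr fe sp pc0 pr0 _ _ same s1 s2 _ _ dimle).
- by have := ccy (@Ordinal 3 0 isT); rewrite /y /of3 /= => ->.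
- by rewrite cr0.
- by have := ccy (@Ordinal 3 1 isT); rewrite /y /of3 /= => ->.
- by have := ccy (@Ordinal 3 2 isT); rewrite /y /of3 /= => ->.
Qed.

(** A positive entry satisfies the minor law with equality against the maximal entry [(s0, t0)], so
    the row and column of the latter determine it. For a zero entry only an inequality remains,
    which the truncation absorbs. *)
Lemma tight_span_segment : dim_T_mu_le mu 1 -> exists f h : S -> R,
  forall s t, mu s t = Num.max 0 (f s - h t).
Proof.
move=> dimT; have [mu0 mus] := dmu.
have [i|empty] := pickP S; last by exists (fun=> 0), (fun=> 0) => s; have := empty s.
have [[s0 t0] /= top] := ex_max (i, i) (fun st : S * S => mu st.1 st.2).
have {}top s t : mu s t <= mu s0 t0 by apply: (top (s, t)).
have [pos|] := ltP 0 (mu s0 t0); last first.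
  move=> zero; exists (fun=> 0), (fun=> 0) => s t; rewrite subrr maxxx.
  by apply/eqP; rewrite eq_le mu0 andbT (le_trans (top s t)).
exists (fun s => mu s t0), (fun t => mu s0 t0 - mu s0 t) => s t.
have h1 := top s t0; have h2 := top s0 t; have h0 := mu0 s t.
have b0 := mu0 s t0; have c0 := mu0 s0 t.
have [d0|d0] := ltP 0 (mu s t).
  have h3 := tight_span_minor dimT pos d0.
  have h4 : mu s t0 + mu s0 t <= mu s0 t0 + mu s t.
    have bp : 0 < mu s t0 by lra.
    have cp : 0 < mu s0 t by lra.
    by have := tight_span_minor dimT bp cp; lra.
  by rewrite maxEle; case: ifP; lra.
have e0 : mu s t = 0 by lra.
have [bp|] := ltP 0 (mu s t0); last by rewrite e0 maxEle; case: ifP; lra.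
have [cp|] := ltP 0 (mu s0 t); last by rewrite e0 maxEle; case: ifP; lra.
have := tight_span_minor dimT bp cp; rewrite e0 maxEle; case: ifP; lra.
Qed.

End TightSpan.

(** * Threshold cuts *)

Section Chain.
Variables (R : realType) (S : finType).
Local Notation cut := ({set S} * {set S} * R)%type.

Lemma layer_cake (v : seq R) : sorted <%R v -> {in v &, forall x y,
  Num.max 0 (x - y) = \sum_(0 <= i < (size v).-1)
    (v`_i.+1 - v`_i) * ((v`_i.+1 <= x) && (y <= v`_i))%:R}.
Proof.
move=> sv _ _ /(nthP 0)[j ltj <-] /(nthP 0)[k ltk <-].
have sv' : sorted <=%R v by apply: sub_sorted sv => x y; apply: ltW.
have le_nth a b : (a < size v)%N -> (b < size v)%N -> (v`_a <= v`_b) = (a <= b)%N.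
  move=> la lb; rewrite leqNgt; apply/idP/idP => [le|].
    apply: contraTN le => ba; rewrite -ltNge.
    exact: (sorted_ltn_nth lt_trans).
  by rewrite -leqNgt => ab; apply: (sorted_leq_nth le_trans lexx).
transitivity (\sum_(0 <= i < (size v).-1 | (k <= i < j)%N) (v`_i.+1 - v`_i)).
  transitivity (\sum_(k <= i < j) (v`_i.+1 - v`_i)).
    case: (leqP k j) => kj.
      by rewrite telescope_sumr // maxEle subr_ge0 le_nth // kj.
    by rewrite big_geq 1?ltnW // maxEle subr_ge0 le_nth // leqNgt kj.
  rewrite (big_nat_widenl _ 0%N) // (big_nat_widen _ _ (size v).-1); last first.
    by move: ltj; case: (size v).
  by apply: eq_bigl => i; rewrite /= andbC.
rewrite big_mkcond /= big_nat_cond [RHS]big_nat_cond; apply: eq_bigr => i /andP[lti _].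
have lti1 : (i.+1 < size v)%N by move: lti; case: (size v).
rewrite (le_nth i.+1) // (le_nth k) // ?(ltnW lti1) //.
by rewrite andbC; case: (_ && _); rewrite ?mulr1 ?mulr0.
Qed.

(** The zero diagonal gives [f s <= h s], which keeps the two sides of every threshold disjoint. *)
Lemma chain_of_cuts (mu : S -> S -> R) (f h : S -> R) : (forall s, mu s s = 0) ->
  (forall s t, mu s t = Num.max 0 (f s - h t)) ->
  exists E : seq cut, [/\ forall s t, mu s t =
      \sum_(e <- E) e.2 * ((s \in e.1.1) && (t \in e.1.2))%:R,
    forall e, e \in E -> 0 <= e.2 /\ [disjoint e.1.1 & e.1.2] &
    {in E &, forall e e' : cut, (e.1.1 \subset e'.1.1) && (e'.1.2 \subset e.1.2) ||
      (e'.1.1 \subset e.1.1) && (e.1.2 \subset e'.1.2)}].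
Proof.
move=> mus muE.
pose v := sort <=%R (undup (codom f ++ codom h)).
have sv : sorted <%R v by rewrite sort_lt_sorted undup_uniq.
have vf s : f s \in v by rewrite mem_sort mem_undup mem_cat codom_f.
have vh s : h s \in v by rewrite mem_sort mem_undup mem_cat codom_f orbT.
have mono i j : (i < size v)%N -> (j < size v)%N -> (i <= j)%N -> v`_i <= v`_j.
  move=> li lj; apply: (sorted_leq_nth le_trans lexx) => //.
  by rewrite sort_le_sorted.
pose lay i : cut := ([set s | v`_i.+1 <= f s], [set t | h t <= v`_i], v`_i.+1 - v`_i).
have layP e : e \in [seq lay i | i <- index_iota 0 (size v).-1] ->
    exists2 i, (i.+1 < size v)%N & e = lay i.
  case/mapP => i; rewrite mem_index_iota => lti ->; exists i => //.
  by move: lti; case: (size v).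
have lt i : (i.+1 < size v)%N -> v`_i < v`_i.+1.
  by move=> lti; apply: (sorted_ltn_nth lt_trans) => //; rewrite inE ltnW.
exists [seq lay i | i <- index_iota 0 (size v).-1]; split.
- move=> s t; rewrite muE big_map (layer_cake sv) //.
  by apply: eq_bigr => i _; rewrite !inE.
- move=> _ /layP[i lti ->] /=; split; first by rewrite subr_ge0 ltW ?lt.
  apply/pred0P => s /=; rewrite !inE; apply/negP => /andP[h1 h2].
  by have := mus s; have := lt i lti; rewrite muE maxEle; case: ifP; lra.
- move=> _ _ /layP[i li ->] /layP[j lj ->] /=.
  wlog ij : i j li lj / (i <= j)%N.
    by move=> wl; case/orP: (leq_total i j) => /wl; [apply|rewrite orbC; apply].
  have h1 := mono i j; have h2 := mono i.+1 j.+1.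
  apply/orP; right; apply/andP; split; apply/subsetP => s; rewrite !inE => h3.
    by apply: le_trans h3; apply: h2.
  by apply: le_trans h3 _; apply: h1 => //; apply: ltnW.
Qed.

End Chain.

Theorem theorem3p1 (R : realType) (S : finType) (mu : S -> S -> R)
    (hmu : directed_distance mu) :
  (dim_T_mu_le mu 1 ->
     forall N : network S,
       exists f : multiflow R N, integral f /\ optimal mu f)
  /\
  (dim_Q_slim_quotient_le mu 1 ->
     forall N : network S, properly_inner_eulerian mu N ->
       exists f : multiflow R N, integral f /\ optimal mu f).
Proof.
split=> [dimT N|dimQ N eul].
  have [f [h muE]] := tight_span_segment hmu dimT.
  have [E [muC posE nestE]] := chain_of_cuts hmu.2 muE.
  (* A chain has only nested pairs, and these put no condition on wild nodes; so all nodes are taken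
     to be wild. *)
  apply: (@integral_optimal R S N predT mu E) => // e e' Ee Ee'.
  by rewrite /compatible_cuts orbA nestE.
have nthree := dim_no_three_classes hmu dimQ.
pose Pi := [set s | boolp.asbool (proper_terminal mu s)].
have [E dec] : exists E, decomposes Pi mu E.
  apply: cut_decomposition => //.
  - exact: minor_free_of_no_three_classes.
  - apply: minor_free_of_no_three_classes; first exact: directed_distance_transpose.
    exact: no_three_classes_transpose.
  - move=> s; rewrite inE => /boolp.asboolP prs r z.
    exact: proper_terminal_one_way.
apply: (@integral_optimal R S N (fun v => v \in term N @: Pi) mu E).
- exact: dec_value dec.
- by move=> e /(dec_pos dec)[/ltW ? ? _ _].
- move=> v wild; apply: eul => s prs vs; case/imsetP: wild; exists s => //.
  by rewrite inE; apply/boolp.asboolP.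
have wildP (A B : {set S}) : Pi \subset A :|: B ->
    [forall v, (v \in term N @: Pi) ==> at_terms A v || at_terms B v].
  move=> /subsetP sub; apply/forallP => v; apply/implyP => /imsetP[s /sub].
  by move=> + ->; rewrite inE => /orP[] sA; apply/orP; [left|right]; apply: imset_f.
move=> e e' Ee Ee'; have := dec_compat dec Ee Ee'.
rewrite /compatible_up_to /compatible_cuts.
case/or4P => [->|->|/and3P[-> -> /wildP ->]|/and3P[-> -> /wildP ->]] //=;
  by rewrite !orbT.
Qed.
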